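(* Let $0<\beta<\alpha<\mu\le1$, let $k$ satisfy the kernel regularity assumption with exponent $\mu$ given in the context, and let $\lambda\in\mathbb C$ satisfy $\ker(I-\lambda K)=\{0\}$ in $X_\beta$. Fix $m\in\{2,3,4\}$. Suppose that there exist $0<\rho\le1$ and $L_\rho>0$ such that $a(t,\theta)=k(t,\gamma(\theta))\gamma'(\theta)$ satisfies $$\|a(\cdot,\theta)-a(\cdot,\eta)\|_{H_\mu(\Gamma)}\le L_\rho|\theta-\eta|^\rho,\qquad \theta,\eta\in[0,2\pi],$$ that the panel partitions satisfy $\max_{I\in\Pi_h}|I|\le C_\Pi h$, and that $q\ge\lceil m/2\rceil$. Let $f\in X_\alpha$ and let $\varphi$ be the unique solution of $\varphi-\lambda K\varphi=f$. Then, for all sufficiently small $h$, the fully discrete problem: find $u_h^q\in S_h$ such that $$(I-\lambda P_hK_h^q)u_h^q=P_h(f_C+\lambda K_h^qJ_f),$$ is uniquely solvable, and $\varphi_h^q:=u_h^q+J_f$ satisfies $$\|\varphi-\varphi_h^q\|_{X_\beta}\le C_\lambda\big(h^{\alpha-\beta}+h^\rho\big)\|f\|_{X_\alpha}$$ with $C_\lambda$ independent of $h$ and $f$. In particular, the rate $O(h^{\alpha-\beta})$ of exact collocation is preserved whenever $\rho\ge\alpha-\beta$.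
   Context: **Contour.** $\Gamma\subset\mathbb C$ is a simple, closed, positively oriented contour of class $C^2$ with a regular $C^2$, $2\pi$-periodic parametrization $\gamma:\mathbb R\to\Gamma$ (so $\gamma(\theta+2\pi)=\gamma(\theta)$, $\gamma'(\theta)\ne0$, $\gamma$ injective on $[0,2\pi)$). $\mathcal D=\{t_1^d,\ldots,t_{n_d}^d\}\subset\Gamma$, $n_d\ge1$, is a set of distinct points, $t_j^d=\gamma(\theta_j^d)$ with $0<\theta_1^d<\cdots<\theta_{n_d}^d<2\pi$; the point $t_*=\gamma(0)=\gamma(2\pi)\notin\mathcal D$ is the cut. The continuity arcs are the $n_d$ open arcs of $\Gamma\setminus\mathcal D$. For a function $v$ with one-sided limits, $v(t_j^d\pm0)$ denote the limits along the orientation ($-$: incoming, $+$: outgoing), $[v]_{t_j^d}:=v(t_j^d+0)-v(t_j^d-0)$, and functions are represented by incoming values $v(t_j^d)=v(t_j^d-0)$. **Spaces.** For $0<\sigma<1$, $X_\sigma=PH_\sigma(\Gamma,\mathcal D)$ is the space of complex functions that are $\sigma$-Hölder on every continuity arc and have finite lateral limits at all points of $\mathcal D$, with norm $\|v\|_{X_\sigma}=\max_I(\|v\|_{\infty,I}+[v]_{\sigma,I})$, the maximum over the continuity arcs $I$; here $\overline I^{\,\ell}$ is $I$ completed by its two endpoints carrying the lateral values, $\|v\|_{\infty,I}=\sup_{\overline I^{\,\ell}}|v|$ and $[v]_{\sigma,I}=\sup_{t\ne s\in\overline I^{\,\ell}}|v(t)-v(s)|/|t-s|^\sigma$. If $n_d=1$,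 the distance $|t-s|$ in this seminorm is understood as the distance along the (single) completed arc. $H_\sigma(\Gamma)$ ($0<\sigma\le1$) is the space of globally $\sigma$-Hölder (Lipschitz if $\sigma=1$) functions on $\Gamma$ with norm $\sup_\Gamma|v|+\sup_{t\ne s\in\Gamma}|v(t)-v(s)|/|t-s|^\sigma$. **Kernel regularity assumption.** There are constants $M_0,M_\mu$ with $|k(t,\tau)|\le M_0$ and $|k(t,\tau)-k(s,\tau)|\le M_\mu|t-s|^\mu$ for all $t,s,\tau\in\Gamma$, and a modulus of continuity $\omega_k$ with $\omega_k(r)\to0$ as $r\downarrow0$ such that $|k(t,\tau)-k(t,\zeta)|\le\omega_k(|\tau-\zeta|)$ for all $t,\tau,\zeta\in\Gamma$. **Operator.** $(Kv)(t)=\int_\Gamma k(t,\tau)v(\tau)\,d\tau=\int_0^{2\pi}a(t,\theta)v(\gamma(\theta))\,d\theta$. The solution $\varphi$ exists uniquely in $X_\beta$ and lies in $X_\alpha$. **Generators and decomposition of the data.** For $0\le\theta<2\pi$: $H_j(\gamma(\theta))=0$ if $0\le\theta\le\theta_j^d$ and $=1$ if $\theta_j^d<\theta<2\pi$; $R(\gamma(\theta))=\theta/(2\pi)$; $G_j:=H_j-R$. For $f\in X_\alpha$: $J_f=\sum_{j=1}^{n_d}[f]_{t_j^d}G_j$ and $f_C=f-J_f\in H_\alpha(\Gamma)$. **Splines.** For an integer $n_B\ge4$ put $h=2\pi/n_B$ and choose a phase $\rho_h\in[0,h)$ with $\operatorname{dist}(\theta_j^d-\rho_h,h\mathbb Z)\ge\eta_0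 h$ for $j=1,\ldots,n_d$, where $0<\eta_0<1/(2n_d)$ is fixed. Put $\theta_i^B=\rho_h+(i-1)h\ (\mathrm{mod}\ 2\pi)$, $t_i^B=\gamma(\theta_i^B)$, $i=1,\ldots,n_B$. Let $N_m$ be the centered cardinal B-spline of order $m$ (degree $m-1$, support $[-m/2,m/2]$, $\sum_{r\in\mathbb Z}N_m(x-r)=1$), $B_j(\gamma(\theta))=\sum_{\ell\in\mathbb Z}N_m\big((\theta-\theta_j^B)/h-\ell n_B\big)$, and $S_h=\operatorname{span}\{B_1,\ldots,B_{n_B}\}$. For a continuous function $v$ on $\Gamma$, $P_hv\in S_h$ is the unique spline with $(P_hv)(t_i^B)=v(t_i^B)$, $i=1,\ldots,n_B$. The parameter $h$ ranges over the values $2\pi/n_B$. **Quadrature.** $\Pi_h$ is a partition of $[0,2\pi]$ into panels (intervals) $I$ of length $|I|$ that is the common refinement of the breakpoints of the periodic splines in $S_h$, the jump parameters $\theta_j^d$, the cut, and possibly finitely many additional points; thus on every panel $v_h\circ\gamma$ is a polynomial of degree at most $m-1$ for $v_h\in S_h$ and $J_f\circ\gamma$ is affine. $C_\Pi$ is independent of $h$. $Q_I^q$ is the $q$-point Gauss–Legendre rule on $I$, and $(K_h^qv)(t):=\sum_{I\in\Pi_h}Q_I^q[a(t,\cdot)\,v(\gamma(\cdot))]$. *)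

(* Defs.v *)
(** Stdlib reals with Coquelicot.

    A function on the contour is a total function [C -> C] of which only the
    values on the contour matter; a point of the contour is written [gam th].
    Indices follow the mathematical numbering: jump points [1..nd], spline nodes
    [1..n], quadrature nodes [1..q].  An index [0] or beyond the range is junk.

    Pitfall: [Rpower 0 y = 1] in the standard library.  Every [Rpower x y] below
    either has [x > 0] or multiplies a constant in an upper bound of a quantity
    that vanishes when [x = 0]. *)

From Stdlib Require Import Reals Factorial ClassicalEpsilon List.
From Coquelicot Require Import Coquelicot.
Open Scope R_scope.

Notation CR := C_R_CompleteNormedModule.

Definition Sup (E : R -> Prop) : R := real (Lub_Rbar E).

(** * Contour *)

Definition dgam (gam : R -> C) (th : R) : C :=
  (Derive (fun s => Re (gam s)) th, Derive (fun s => Im (gam s)) th).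

Definition on_contour (gam : R -> C) (t : C) : Prop := exists th, gam th = t.

Definition eq_on (gam : R -> C) (u v : C -> C) : Prop :=
  forall t, on_contour gam t -> u t = v t.

Definition winding (gam : R -> C) (z : C) : C :=
  (RInt (V := CR) (fun th => dgam gam th / (gam th - z)) 0 (2 * PI)
     / (2 * PI * Ci))%C.

(** Positive orientation in the usual sense for a simple closed curve: no point
    off the curve has winding number other than [0] (exterior) or [1]
    (interior). *)
Record is_contour (gam : R -> C) : Prop := {
  contour_C1 : forall th, is_derive (V := CR) gam th (dgam gam th);
  contour_C2 : forall th,
    is_derive (V := CR) (dgam gam) th (dgam (dgam gam) th);
  contour_C2_cont : forall th, continuous (U := CR) (dgam (dgam gam)) th;
  contour_periodic : forall th, gam (th + 2 * PI) = gam th;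
  contour_regular : forall th, dgam gam th <> RtoC 0;
  contour_simple : forall x y,
    0 <= x < 2 * PI -> 0 <= y < 2 * PI -> gam x = gam y -> x = y;
  contour_positive : forall z, ~ on_contour gam z ->
    winding gam z = RtoC 0 \/ winding gam z = RtoC 1
}.

(** The parameter in [[0, 2 * PI)] of a point of the contour. *)
Definition par (gam : R -> C) (t : C) : R :=
  epsilon (inhabits 0) (fun th => 0 <= th < 2 * PI /\ gam th = t).

Definition is_jump_set (nd : nat) (thd : nat -> R) : Prop :=
  (1 <= nd)%nat /\ 0 < thd 1%nat /\ thd nd < 2 * PI /\
  forall j, (1 <= j)%nat -> (j < nd)%nat -> thd j < thd (S j).

(** * Piecewise Hoelder functions

    The [j]-th continuity arc is the image of the open parameter interval
    [(thd j, arc_end nd thd j)]; the last one passes through the cut. *)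

Definition arc_end (nd : nat) (thd : nat -> R) (j : nat) : R :=
  if Nat.eqb j nd then thd 1%nat + 2 * PI else thd (S j).

(** Distance between two points of a completed arc, given by parameters: with a
    single jump point the two ends of the arc are the same point of the plane,
    and the distance is measured along the arc. *)
Definition arc_dist (gam : R -> C) (nd : nat) (x y : R) : R :=
  if Nat.eqb nd 1 then Rabs (RInt (fun s => Cmod (dgam gam s)) x y)
  else Cmod (gam x - gam y)%C.

Definition has_lat_right (gam : R -> C) (v : C -> C) (th : R) (l : C) : Prop :=
  filterlim (fun s => v (gam s)) (at_right th) (@locally CR l).

Definition has_lat_left (gam : R -> C) (v : C -> C) (th : R) (l : C) : Prop :=
  filterlim (fun s => v (gam s)) (at_left th) (@locally CR l).

Definition lat_right (gam : R -> C) (v : C -> C) (th : R) : C :=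
  @iota CR (has_lat_right gam v th).

Definition lat_left (gam : R -> C) (v : C -> C) (th : R) : C :=
  @iota CR (has_lat_left gam v th).

Definition jump (gam : R -> C) (v : C -> C) (th : R) : C :=
  (lat_right gam v th - lat_left gam v th)%C.

(** [v] on the completed arc with parameters in [[a, b]]. *)
Definition arc_val (gam : R -> C) (v : C -> C) (a b x : R) : C :=
  if Req_EM_T x a then lat_right gam v a
  else if Req_EM_T x b then lat_left gam v b
  else v (gam x).

(** The third clause is the convention that functions are represented by their
    incoming values at the jump points. *)
Definition in_X (gam : R -> C) (nd : nat) (thd : nat -> R) (sigma : R)
    (v : C -> C) : Prop :=
  forall j, (1 <= j <= nd)%nat ->
    (exists L, forall x y,
       thd j < x < arc_end nd thd j -> thd j < y < arc_end nd thd j ->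
       Cmod (v (gam x) - v (gam y))%C
         <= L * Rpower (arc_dist gam nd x y) sigma) /\
    (exists l, has_lat_right gam v (thd j) l) /\
    has_lat_left gam v (thd j) (v (gam (thd j))).

Definition arc_sup (gam : R -> C) (v : C -> C) (a b : R) : R :=
  Sup (fun r => exists x, a <= x <= b /\ r = Cmod (arc_val gam v a b x)).

Definition arc_seminorm (gam : R -> C) (nd : nat) (sigma : R) (v : C -> C)
    (a b : R) : R :=
  Sup (fun r => exists x y, a <= x <= b /\ a <= y <= b /\ x <> y /\
    r = Cmod (arc_val gam v a b x - arc_val gam v a b y)%C
        / Rpower (arc_dist gam nd x y) sigma).

Definition X_norm (gam : R -> C) (nd : nat) (thd : nat -> R) (sigma : R)
    (v : C -> C) : R :=
  fold_right Rmax 0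
    (map (fun j => arc_sup gam v (thd j) (arc_end nd thd j)
                   + arc_seminorm gam nd sigma v (thd j) (arc_end nd thd j))
         (seq 1 nd)).

(** * Globally Hoelder functions *)

Definition in_H (gam : R -> C) (sigma : R) (v : C -> C) : Prop :=
  exists L, forall t s, on_contour gam t -> on_contour gam s ->
    Cmod (v t - v s)%C <= L * Rpower (Cmod (t - s)%C) sigma.

Definition H_norm (gam : R -> C) (sigma : R) (v : C -> C) : R :=
  Sup (fun r => exists t, on_contour gam t /\ r = Cmod (v t))
  + Sup (fun r => exists t s, on_contour gam t /\ on_contour gam s /\ t <> s /\
      r = Cmod (v t - v s)%C / Rpower (Cmod (t - s)%C) sigma).

(** * Integral operator *)

Definition kernel_regular (gam : R -> C) (k : C -> C -> C) (mu : R) : Prop :=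
  exists (M0 Mmu : R) (omega : R -> R),
    filterlim omega (at_right 0) (locally 0) /\
    (forall t tau, on_contour gam t -> on_contour gam tau ->
       Cmod (k t tau) <= M0) /\
    (forall t s tau, on_contour gam t -> on_contour gam s ->
       on_contour gam tau ->
       Cmod (k t tau - k s tau)%C <= Mmu * Rpower (Cmod (t - s)%C) mu) /\
    (forall t tau zeta, on_contour gam t -> on_contour gam tau ->
       on_contour gam zeta ->
       Cmod (k t tau - k t zeta)%C <= omega (Cmod (tau - zeta)%C)).

Definition a_ker (gam : R -> C) (k : C -> C -> C) (t : C) (th : R) : C :=
  (k t (gam th) * dgam gam th)%C.

Definition K_op (gam : R -> C) (k : C -> C -> C) (v : C -> C) (t : C) : C :=
  RInt (V := CR) (fun th => a_ker gam k t th * v (gam th))%C 0 (2 * PI).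

(** * Decomposition of the data *)

Definition H_step (gam : R -> C) (thj : R) (t : C) : R :=
  if Rle_dec (par gam t) thj then 0 else 1.

Definition R_ramp (gam : R -> C) (t : C) : R := par gam t / (2 * PI).

Definition G_gen (gam : R -> C) (thj : R) (t : C) : R :=
  H_step gam thj t - R_ramp gam t.

Definition J_part (gam : R -> C) (nd : nat) (thd : nat -> R) (f : C -> C)
    (t : C) : C :=
  sum_n_m (fun j => jump gam f (thd j) * RtoC (G_gen gam (thd j) t))%C 1 nd.

Definition C_part (gam : R -> C) (nd : nat) (thd : nat -> R) (f : C -> C)
    (t : C) : C :=
  (f t - J_part gam nd thd f t)%C.

(** * Splines *)

Definition mesh (n : nat) : R := 2 * PI / INR n.

(** Centered cardinal B-spline of order [m >= 2], as the normalized [m]-th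
    central difference of the truncated power of degree [m - 1]. *)
Definition cardinal_spline (m : nat) (x : R) : R :=
  / INR (fact (m - 1)) *
  sum_f_R0 (fun r => (-1) ^ r * Binomial.C m r
                     * Rmax 0 (x + INR m / 2 - INR r) ^ (m - 1)) m.

Definition sum_Z (F : Z -> R) : R :=
  Series (fun l => F (Z.of_nat l) + F (- Z.of_nat (S l))%Z).

(** No reduction modulo [2 * PI] is needed: for a phase [rho] in
    [[0, mesh n)] and [1 <= i <= n] this lies in [[0, 2 * PI)]. *)
Definition node (n : nat) (rho : R) (i : nat) : R :=
  rho + (INR i - 1) * mesh n.

Definition B_per (gam : R -> C) (m n : nat) (rho : R) (j : nat) (t : C) : R :=
  sum_Z (fun l => cardinal_spline m
    ((par gam t - node n rho j) / mesh n - IZR l * INR n)).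

Definition in_S (gam : R -> C) (m n : nat) (rho : R) (u : C -> C) : Prop :=
  exists c : nat -> C, forall t, on_contour gam t ->
    u t = sum_n_m (fun j => c j * RtoC (B_per gam m n rho j t))%C 1 n.

Definition interpolates (gam : R -> C) (n : nat) (rho : R) (v p : C -> C) :
    Prop :=
  forall i, (1 <= i <= n)%nat ->
    p (gam (node n rho i)) = v (gam (node n rho i)).

Definition P_op (gam : R -> C) (m n : nat) (rho : R) (v : C -> C) : C -> C :=
  epsilon (inhabits (fun _ : C => RtoC 0))
    (fun p => in_S gam m n rho p /\ interpolates gam n rho v p).

Definition admissible_phase (nd : nat) (thd : nat -> R) (eta0 : R) (n : nat)
    (rho : R) : Prop :=
  0 <= rho < mesh n /\
  forall j (l : Z), (1 <= j <= nd)%nat ->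
    eta0 * mesh n <= Rabs (thd j - rho - IZR l * mesh n).

(** * Quadrature *)

(** Bonnet's recursion; the pair is [(P_n, P_(n+1))]. *)
Fixpoint legendre_pair (n : nat) (x : R) : R * R :=
  match n with
  | O => (1, x)
  | S n' =>
      let (p0, p1) := legendre_pair n' x in
      (p1, ((2 * INR n + 1) * x * p1 - INR n * p0) / (INR n + 1))
  end.

Definition legendre (n : nat) (x : R) : R := fst (legendre_pair n x).

Definition lagrange_basis (q : nat) (xi : nat -> R) (i : nat) (x : R) : R :=
  fold_right Rmult 1
    (map (fun j => if Nat.eqb j i then 1 else (x - xi j) / (xi i - xi j))
         (seq 1 q)).

(** Nodes and weights on [[-1, 1]]: the [q] zeros of the Legendre polynomial of
    degree [q], with the interpolatory weights. *)
Definition is_gauss_legendre (q : nat) (xi w : nat -> R) : Prop :=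
  (forall i, (1 <= i <= q)%nat -> -1 < xi i < 1 /\ legendre q (xi i) = 0) /\
  (forall i, (1 <= i)%nat -> (i < q)%nat -> xi i < xi (S i)) /\
  (forall i, (1 <= i <= q)%nat ->
     w i = RInt (lagrange_basis q xi i) (-1) 1).

Definition gauss_rule (q : nat) (xi w : nat -> R) (a b : R) (g : R -> C) : C :=
  (RtoC ((b - a) / 2) *
   sum_n_m (fun i => RtoC (w i) *
     g ((a + b) / 2 + (b - a) / 2 * xi i)%R)%C 1 q)%C.

(** The panels are the intervals [[x i, x (S i)]], [i < N].  The last clause
    makes the spline breakpoints [rho + (i - m / 2) * mesh n] in [[0, 2 * PI]]
    panel endpoints; further endpoints are allowed. *)
Definition is_panel_partition (nd : nat) (thd : nat -> R) (m n : nat) (rho : R)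
    (N : nat) (x : nat -> R) : Prop :=
  x 0%nat = 0 /\ x N = 2 * PI /\
  (forall i, (i < N)%nat -> x i < x (S i)) /\
  (forall j, (1 <= j <= nd)%nat -> exists i, (i <= N)%nat /\ x i = thd j) /\
  (forall l : Z,
     let y := rho + (IZR l - INR m / 2) * mesh n in
     0 <= y <= 2 * PI -> exists i, (i <= N)%nat /\ x i = y).

Definition Kq_op (gam : R -> C) (k : C -> C -> C) (q : nat) (xi w : nat -> R)
    (N : nat) (x : nat -> R) (v : C -> C) (t : C) : C :=
  sum_n_m (fun i => gauss_rule q xi w (x (i - 1)%nat) (x i)
    (fun th => a_ker gam k t th * v (gam th))%C) 1 N.

(** * The continuous and the fully discrete equations *)

Definition solves_eq (gam : R -> C) (k : C -> C -> C) (lam : C)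
    (f phi : C -> C) : Prop :=
  eq_on gam (fun t => phi t - lam * K_op gam k phi t)%C f.

(** [P] and [Kq] stand for the interpolation and the quadrature operators. *)
Definition solves_discrete (gam : R -> C) (nd : nat) (thd : nat -> R)
    (lam : C) (m n : nat) (rho : R) (P Kq : (C -> C) -> C -> C)
    (f u : C -> C) : Prop :=
  in_S gam m n rho u /\
  eq_on gam
    (fun t => u t - lam * P (Kq u) t)%C
    (P (fun t => C_part gam nd thd f t
                 + lam * Kq (J_part gam nd thd f) t)%C).

(* Main.v *)
(** At the nodes the discrete equation reads [u = f_C + lam Kq (u + J_f)].  With
    [w = phi - J_f], the spline [d = P w - u] therefore satisfies
    [d = lam Kq d + g] at the nodes, where
    [g = lam ((K - Kq) (J_f + P w) + K (w - P w))].  The panel rule is exact for the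
    piecewise polynomial [J_f + P w], so [K - Kq] only sees the increment of the
    kernel over one panel and contributes [O(h^r)], even in the mu-Hoelder norm;
    [w] is alpha-Hoelder, so [w - P w] is [O(h^alpha)] uniformly and
    [O(h^(alpha - beta))] in the beta-Hoelder norm.

    Stability comes from compactness alone: if [v_n] is bounded and
    [v_n - lam K v_n -> 0], then [K v_n] is equi-Hoelder, a subsequence of [v_n]
    converges uniformly, and its limit lies in the kernel.  Hence
    [sup |v| <= A sup |v - lam K v|], which bounds [phi] and also splines: with
    [z = lam Kq d + g] one has [d = P z], and the terms [P z - z] and
    [lam (Kq - K) d] in [d - lam K d = (P z - z) + lam (Kq - K) d + g] are
    absorbed for small [h]. *)

Require Import Defs.
From Stdlib Require Import Reals ZArith Psatz List ClassicalEpsilon.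
From Coquelicot Require Import Coquelicot.
Open Scope R_scope.

(** All estimates are made for periodic functions of the parameter: on a completed arc [arc_dist]
    and the parameter distance are comparable, so only constants change. The jumps sit in the
    explicit [J_part]; [phi - J_f] and the error itself are globally Hoelder, and no estimate ever
    treats a spline near a jump. Compactness is used only for the continuous operator. Splines on
    all meshes are bounded integrable functions, so one constant [A] serves every [n]. Uniformity in
    [n] comes from the collocation matrix, a periodic tridiagonal matrix whose diagonal exceeds the
    neighbours by at least [/ 3]. It controls the spline coefficients and, since differences of
    coefficients satisfy the same system, also the Lipschitz constant of an interpolant. Existence
    of discrete solutions follows from uniqueness by finite dimension. As [Sup] returns [0] on
    unbounded sets, finiteness is secured before a norm is used; this is the purpose of bounds such
    as [M] that do not enter the constants. *)

Notation csum := (@sum_n_m C_AbelianMonoid).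
Notation rsum := (@sum_n_m R_AbelianMonoid).
Notation ccontinuous := (@continuous R_UniformSpace CR).

(* [ring] reads the carrier off the terms, and sums are typed in [C_AbelianMonoid]. *)
Ltac sum_in_C := cbv beta;
  repeat match goal with |- context [@sum_n_m C_AbelianMonoid ?f ?a ?b] =>
    let s := fresh "s" in pose (s := (@sum_n_m C_AbelianMonoid f a b : C));
    change (@sum_n_m C_AbelianMonoid f a b) with s; clearbody s end;
  match goal with |- @eq _ ?a ?b => change (@eq C a b) end.

Ltac cring := sum_in_C; ring.

Ltac rring := match goal with |- @eq _ ?a ?b => change (@eq R a b) end; ring.

(** * Elementary facts on powers and moduli *)

Lemma Rpower_pos x y : 0 < Rpower x y.
Proof. unfold Rpower; apply exp_pos. Qed.

Lemma Rpower_le_base x y s : 0 <= s -> 0 < x <= y -> Rpower x s <= Rpower y s.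
Proof. intros; apply Rle_Rpower_l; lra. Qed.

Lemma RtoC_m1 : RtoC (-1) = (- RtoC 1)%C.
Proof. rewrite <- RtoC_opp. reflexivity. Qed.

Lemma on_contour_param gam x : on_contour gam (gam x).
Proof. exists x. reflexivity. Qed.

Lemma Cmod_sub_sym x y : Cmod (x - y)%C = Cmod (y - x)%C.
Proof. rewrite <- Cmod_opp; f_equal; ring. Qed.

Lemma Cmod_sub_triangle x y z : Cmod (x - z)%C <= Cmod (x - y)%C + Cmod (y - z)%C.
Proof. replace (x - z)%C with ((x - y) + (y - z))%C by ring. apply Cmod_triangle. Qed.

Lemma Cmod_sub_le x y : Cmod (x - y)%C <= Cmod x + Cmod y.
Proof. unfold Cminus. eapply Rle_trans; [apply Cmod_triangle|]. rewrite Cmod_opp. lra. Qed.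

Lemma Cmod_sub_eq0 x y : Cmod (x - y)%C = 0 -> x = y.
Proof.
  intros H. apply Cmod_eq_0 in H.
  replace x with ((x - y) + y)%C by ring. rewrite H. ring.
Qed.

Lemma Cmod_sub_refl x : Cmod (x - x)%C = 0.
Proof. replace (x - x)%C with (RtoC 0) by ring. apply Cmod_0. Qed.

(** * Hoelder functions of a real variable *)

(** The strict [x < y] keeps the base of [Rpower] positive, since [Rpower 0 s] is [1]; the reversed
    order follows from the symmetry of the modulus. *)
Definition holder_on (s L : R) (g : R -> C) (a b : R) : Prop :=
  forall x y, a <= x -> x < y -> y <= b ->
    Cmod (g x - g y)%C <= L * Rpower (y - x) s.

Definition holder (s L : R) (g : R -> C) : Prop :=
  forall x y, x < y -> Cmod (g x - g y)%C <= L * Rpower (y - x) s.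

Definition periodic (g : R -> C) : Prop := forall x, g (x + 2 * PI) = g x.

Definition bounded_by (M : R) (g : R -> C) : Prop := forall x, Cmod (g x) <= M.

Lemma bounded_by_pos M g : bounded_by M g -> 0 <= M.
Proof. intros H. generalize (H 0) (Cmod_ge_0 (g 0)). lra. Qed.

Lemma holder_pos s L g : holder s L g -> 0 <= L.
Proof.
  intros H. specialize (H 0 1 ltac:(lra)).
  generalize (Cmod_ge_0 (g 0 - g 1)%C) (Rpower_pos (1 - 0) s). nra.
Qed.

Lemma holder_le s L L' g : L <= L' -> holder s L g -> holder s L' g.
Proof.
  intros HL H x y Hxy. eapply Rle_trans; [apply H; auto|].
  apply Rmult_le_compat_r; auto. left; apply Rpower_pos.
Qed.

Lemma holder_on_glue s L1 L2 g a b c :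
  0 <= s -> 0 <= L1 -> 0 <= L2 ->
  holder_on s L1 g a b -> holder_on s L2 g b c -> holder_on s (L1 + L2) g a c.
Proof.
  intros Hs H1 H2 Hab Hbc x y Hx Hxy Hy.
  generalize (Rpower_pos (y - x) s); intros Hp.
  destruct (Rle_dec y b) as [Hyb|Hyb].
  { generalize (Hab x y Hx Hxy Hyb). nra. }
  destruct (Rle_dec b x) as [Hbx|Hbx].
  { generalize (Hbc x y Hbx Hxy Hy). nra. }
  generalize (Hab x b Hx ltac:(lra) ltac:(lra)) (Hbc b y ltac:(lra) ltac:(lra) Hy).
  generalize (Rpower_le_base (b - x) (y - x) s Hs ltac:(lra)).
  generalize (Rpower_le_base (y - b) (y - x) s Hs ltac:(lra)).
  generalize (Cmod_sub_triangle (g x) (g b) (g y)). nra.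
Qed.

(** With exponent 1 the two lengths add up to [y - x], so the constant does not grow, unlike in
    [holder_on_glue]. This matters in [unrolled_lipschitz], where the number of glued cells grows
    with [n]. *)
Lemma lipschitz_on_glue L g a b c :
  holder_on 1 L g a b -> holder_on 1 L g b c -> holder_on 1 L g a c.
Proof.
  intros Hab Hbc x y Hx Hxy Hy.
  rewrite Rpower_1 by lra.
  destruct (Rle_dec y b) as [Hyb|Hyb].
  { generalize (Hab x y Hx Hxy Hyb). rewrite Rpower_1 by lra; auto. }
  destruct (Rle_dec b x) as [Hbx|Hbx].
  { generalize (Hbc x y Hbx Hxy Hy).  rewrite Rpower_1 by lra; auto. }
  generalize (Hab x b Hx ltac:(lra) ltac:(lra)) (Hbc b y ltac:(lra) ltac:(lra) Hy).
  rewrite !Rpower_1 by lra.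
  generalize (Cmod_sub_triangle (g x) (g b) (g y)). nra.
Qed.

Lemma period_reduce x a : exists k : Z, a <= x - IZR k * (2 * PI) < a + 2 * PI.
Proof.
  generalize PI_RGT_0; intros HP.
  exists (Int_part ((x - a) / (2 * PI))).
  destruct (base_Int_part ((x - a) / (2 * PI))) as [H1 H2].
  set (k := IZR (Int_part _)) in *.
  assert (E : (x - a) / (2 * PI) * (2 * PI) = x - a) by (field; lra).
  assert (F1 : k * (2 * PI) <= x - a).
  { rewrite <- E. apply Rmult_le_compat_r; lra. }
  assert (F2 : ((x - a) / (2 * PI) - 1) * (2 * PI) < k * (2 * PI)).
  { apply Rmult_lt_compat_r; lra. }
  lra.
Qed.

Lemma periodic_Z g : periodic g -> forall (k : Z) x, g (x + IZR k * (2 * PI)) = g x.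
Proof.
  intros Hg k.
  assert (Hn : forall (n : nat) x, g (x + INR n * (2 * PI)) = g x).
  { induction n as [|n IH]; intros x.
    - change (INR 0) with 0; f_equal; ring.
    - rewrite S_INR. replace (x + (INR n + 1) * (2 * PI)) with ((x + INR n * (2 * PI)) + 2 * PI) by ring.
      rewrite Hg; apply IH. }
  intros x. destruct (Z_le_gt_dec 0 k) as [Hk|Hk].
  - rewrite <- (Z2Nat.id k) by lia. rewrite <- INR_IZR_INZ. apply Hn.
  - rewrite <- (Hn (Z.to_nat (- k))). f_equal.
    rewrite INR_IZR_INZ, Z2Nat.id by lia. rewrite opp_IZR. ring.
Qed.

Lemma periodic_reduce (g : R -> C) : periodic g ->
  forall x, exists y, 0 <= y < 2 * PI /\ g x = g y.
Proof.
  intros Hg x. destruct (period_reduce x 0) as [k Hk].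
  exists (x - IZR k * (2 * PI)). split; [lra|].
  rewrite <- (periodic_Z g Hg k (x - _)). f_equal. ring.
Qed.

(** Two points less than a period apart fit, after a common shift, into two consecutive periods;
    gluing these doubles the constant. *)
Lemma holder_periodic s L g : 0 <= s -> 0 <= L -> periodic g ->
  holder_on s L g 0 (2 * PI) -> holder s (L + L) g.
Proof.
  intros Hs HL Hg H.
  generalize PI_RGT_0; intros HP.
  assert (H2 : holder_on s L g (2 * PI) (4 * PI)).
  { intros x y Hx Hxy Hy.
    rewrite <- (periodic_Z g Hg (-1) x), <- (periodic_Z g Hg (-1) y).
    replace (y - x) with ((y + -1 * (2 * PI)) - (x + -1 * (2 * PI))) by ring.
    apply H; lra. }
  generalize (holder_on_glue s L L g _ _ _ Hs HL HL H H2); intros H3.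
  intros x y Hxy.
  destruct (period_reduce x 0) as [k Hk].
  destruct (period_reduce y x) as [l Hl].
  set (y' := y - IZR l * (2 * PI)) in *.
  assert (Ey : g y = g (y' - IZR k * (2 * PI))).
  { rewrite <- (periodic_Z g Hg (k + l) (y' - _)). f_equal. unfold y'.
    rewrite plus_IZR. ring. }
  assert (Ex : g x = g (x - IZR k * (2 * PI))).
  { rewrite <- (periodic_Z g Hg k (x - _)). f_equal. ring. }
  assert (Hp : 0 <= (L + L) * Rpower (y - x) s).
  { apply Rmult_le_pos; [lra|]. left; apply Rpower_pos. }
  rewrite Ex, Ey.
  destruct (Req_dec x y') as [E|E].
  { rewrite <- E, Cmod_sub_refl. exact Hp. }
  eapply Rle_trans.
  { apply H3; lra. }
  replace (y' - IZR k * (2 * PI) - (x - IZR k * (2 * PI))) with (y' - x) by ring.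
  apply Rmult_le_compat_l; [lra|]. apply Rpower_le_base; auto.
  split; [lra|].
  (* Since [x < y], moving [y] into the period that starts at [x] shifts it to the left, and the
     distance can only shrink. *)
  assert (Hl0 : (0 <= l)%Z).
  { apply Znot_gt_le; intros Hn. assert (Hn' : IZR l <= -1) by (apply IZR_le; lia).
    unfold y' in *. nra. }
  apply IZR_le in Hl0. unfold y'. nra.
Qed.

(** At distance at most 1 lowering the exponent enlarges the power; beyond it the power is at least
    1 and the bound [2 * M] of the increment suffices. *)
Lemma holder_exponent s s' L M g : 0 <= s <= s' -> holder s' L g -> bounded_by M g ->
  holder s (L + 2 * M) g.
Proof.
  intros Hs H Hb x y Hxy.
  generalize (holder_pos _ _ _ H) (bounded_by_pos _ _ Hb); intros HL HM.
  generalize (Rpower_pos (y - x) s); intros Hp.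
  destruct (Rle_dec (y - x) 1) as [H1|H1].
  - eapply Rle_trans; [apply H; auto|].
    assert (Rpower (y - x) s' <= Rpower (y - x) s).
    { unfold Rpower.
      assert (H0 : ln (y - x) <= 0).
      { rewrite <- ln_1. apply ln_le; lra. }
      assert (H2 : s' * ln (y - x) <= s * ln (y - x)) by nra.
      destruct (Rle_lt_or_eq_dec _ _ H2) as [h|h]; [left; apply exp_increasing; auto| rewrite h; lra]. }
    nra.
  - eapply Rle_trans; [apply Cmod_sub_le|]. generalize (Hb x) (Hb y). intros.
    assert (1 <= Rpower (y - x) s).
    { rewrite <- (Rpower_O (y - x)) by lra. apply Rle_Rpower; lra. }
    nra.
Qed.

Lemma bounded_by_periodic M g : periodic g ->
  (forall x, 0 <= x < 2 * PI -> Cmod (g x) <= M) -> bounded_by M g.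
Proof.
  intros Hg H x. destruct (periodic_reduce g Hg x) as [y [Hy E]].
  rewrite E; auto.
Qed.

(** * Sums *)

Lemma csum_0 (f : nat -> C) : csum f 1 0 = RtoC 0.
Proof. rewrite sum_n_m_zero by lia. reflexivity. Qed.

Lemma csum_S (f : nat -> C) (n : nat) :
  csum f 1 (S n) = (csum f 1 n + f (S n))%C.
Proof. rewrite sum_n_Sm by lia. reflexivity. Qed.

Lemma csum_ext (f g : nat -> C) n : (forall i, (1 <= i <= n)%nat -> f i = g i) ->
  csum f 1 n = csum g 1 n.
Proof. intros H; apply sum_n_m_ext_loc; auto. Qed.

Lemma csum_plus (f g : nat -> C) n :
  (csum (fun i => f i + g i) 1 n =
   csum f 1 n + csum g 1 n)%C.
Proof. apply (sum_n_m_plus (G := C_AbelianMonoid)). Qed.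

Lemma csum_mult (c : C) (f : nat -> C) n :
  (csum (fun i => c * f i) 1 n =
   c * csum f 1 n)%C.
Proof. apply (sum_n_m_mult_l (K := C_Ring)). Qed.

Lemma csum_minus (f g : nat -> C) n :
  (csum (fun i => f i - g i) 1 n =
   csum f 1 n - csum g 1 n)%C.
Proof.
  induction n as [|n IH]; [rewrite !csum_0; cring|].
  rewrite !csum_S, IH. cring.
Qed.

Lemma csum_bound (f : nat -> C) (b : nat -> R) n :
  (forall i, (1 <= i <= n)%nat -> Cmod (f i) <= b i) ->
  Cmod (csum f 1 n) <= rsum b 1 n.
Proof.
  induction n as [|n IH]; intros H.
  - rewrite csum_0. rewrite Cmod_0, sum_n_m_zero by lia. apply Rle_refl.
  - rewrite csum_S, sum_n_Sm by lia. eapply Rle_trans; [apply Cmod_triangle|].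
    apply Rplus_le_compat; [apply IH; intros; apply H; lia| apply H; lia].
Qed.

Lemma rsum_S (f : nat -> R) (n : nat) :
  rsum f 1 (S n) = rsum f 1 n + f (S n).
Proof. rewrite sum_n_Sm by lia. reflexivity. Qed.

Lemma rsum_0 (f : nat -> R) : rsum f 1 0 = 0.
Proof. rewrite sum_n_m_zero by lia. reflexivity. Qed.

Lemma rsum_const a n : rsum (fun _ => a) 1 n = INR n * a.
Proof. induction n; [rewrite rsum_0; change (INR 0) with 0; rring|]. rewrite rsum_S, IHn, S_INR. rring. Qed.

(** * Integrals of complex functions *)

(** [CR] is a module over the reals, so a complex factor is not a scalar of it and is handled
    through real and imaginary parts. *)
Lemma is_RInt_Cmult (c : C) (f : R -> C) a b (l : C) :
  is_RInt (V := CR) f a b l -> is_RInt (V := CR) (fun x => c * f x)%C a b (c * l)%C.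
Proof.
  intros H.
  generalize (is_RInt_fct_extend_fst f a b l H) (is_RInt_fct_extend_snd f a b l H); intros H1 H2.
  generalize (is_RInt_minus (V := R_NormedModule) _ _ _ _ _ _
    (is_RInt_scal (V := R_NormedModule) _ _ _ (fst c) _ H1)
    (is_RInt_scal (V := R_NormedModule) _ _ _ (snd c) _ H2)); intros H3.
  generalize (is_RInt_plus (V := R_NormedModule) _ _ _ _ _ _
    (is_RInt_scal (V := R_NormedModule) _ _ _ (fst c) _ H2)
    (is_RInt_scal (V := R_NormedModule) _ _ _ (snd c) _ H1)); intros H4.
  exact (is_RInt_fct_extend_pair (U := R_NormedModule) (V := R_NormedModule)
    (fun x => c * f x)%C a b _ _ H3 H4).
Qed.

Lemma is_RInt_Cplus (f g : R -> C) a b (l l' : C) :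
  is_RInt (V := CR) f a b l -> is_RInt (V := CR) g a b l' ->
  is_RInt (V := CR) (fun x => f x + g x)%C a b (l + l')%C.
Proof. intros H H'. apply (is_RInt_plus (V := CR)); auto. Qed.

Lemma is_RInt_Cminus (f g : R -> C) a b (l l' : C) :
  is_RInt (V := CR) f a b l -> is_RInt (V := CR) g a b l' ->
  is_RInt (V := CR) (fun x => f x - g x)%C a b (l - l')%C.
Proof. intros H H'. apply (is_RInt_minus (V := CR)); auto. Qed.

Lemma is_RInt_C_bound (f : R -> C) a b (l : C) M : a <= b ->
  (forall x, a <= x <= b -> Cmod (f x) <= M) ->
  is_RInt (V := CR) f a b l -> Cmod l <= (b - a) * M.
Proof.
  intros Hab H Hi. rewrite Cmod_norm.
  apply (norm_RInt_le_const (V := CR) f a b l M Hab); auto.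
  intros x Hx. generalize (H x Hx). rewrite Cmod_norm. auto.
Qed.

Lemma filterlim_C {T : Type} {F : (T -> Prop) -> Prop} {FF : Filter F} (f : T -> C) (l : C) :
  filterlim f F (@locally CR l) <-> forall eps, 0 < eps -> F (fun x => Cmod (f x - l)%C < eps).
Proof.
  rewrite (filterlim_locally_ball_norm (K := R_AbsRing) (U := CR) f l).
  split.
  - intros H eps He. generalize (H (mkposreal eps He)). apply filter_imp. intros x Hx.
    unfold ball_norm in Hx. rewrite Cmod_norm. exact Hx.
  - intros H eps. generalize (H eps (cond_pos eps)). apply filter_imp. intros x Hx.
    unfold ball_norm. rewrite Cmod_norm in Hx. exact Hx.
Qed.

Lemma continuous_C (f : R -> C) x :
  ccontinuous f x <->
  forall eps, 0 < eps -> exists d, 0 < d /\ forall y, Rabs (y - x) < d -> Cmod (f y - f x)%C < eps.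
Proof.
  unfold continuous. rewrite filterlim_C. split; intros H eps He; specialize (H eps He).
  - destruct H as [d Hd]. exists d. split; [apply d|]. intros y Hy. apply Hd. exact Hy.
  - destruct H as [d [Hd H]]. exists (mkposreal d Hd). intros y Hy. apply H. exact Hy.
Qed.

(** * The contour *)

Lemma dgam_periodic gam : periodic gam -> periodic (dgam gam).
Proof.
  intros H x. unfold dgam, Derive.
  f_equal; f_equal; apply Lim_ext; intros h; rewrite <- (H x), <- (H (x + h));
  replace (x + 2 * PI + h) with (x + h + 2 * PI) by ring; reflexivity.
Qed.

Lemma gam_periodic gam : is_contour gam -> periodic gam.
Proof. intros H x; apply (contour_periodic _ H). Qed.

Lemma pullback_periodic gam (v : C -> C) : is_contour gam -> periodic (fun x => v (gam x)).
Proof. intros H x. rewrite (gam_periodic _ H). reflexivity. Qed.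

Lemma dgam_continuous gam : is_contour gam -> forall x, ccontinuous (dgam gam) x.
Proof.
  intros H x. apply (ex_derive_continuous (V := CR)). eexists; apply (contour_C2 _ H).
Qed.

Lemma speed_continuous gam : is_contour gam -> forall x, continuous (fun s => Cmod (dgam gam s)) x.
Proof.
  intros H x. apply (continuous_ext (fun s => norm (K := R_AbsRing) (V := CR) (dgam gam s))).
  { intros y; symmetry; apply Cmod_norm. }
  apply (continuous_comp (V := CR) (dgam gam) (fun z => norm z)).
  - apply dgam_continuous; auto.
  - apply (filterlim_norm (V := CR)).
Qed.

Lemma speed_bounds gam : is_contour gam ->
  exists c L, 0 < c /\ 0 < L /\ forall x, c <= Cmod (dgam gam x) <= L.
Proof.
  intros H. generalize PI_RGT_0; intros HP.
  assert (Hc : forall c, 0 <= c <= 2 * PI -> continuity_pt (fun s => Cmod (dgam gam s)) c).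
  { intros c _. apply continuity_pt_filterlim. apply speed_continuous; auto. }
  destruct (continuity_ab_maj _ 0 (2 * PI) ltac:(lra) Hc) as [xM [HM _]].
  destruct (continuity_ab_min _ 0 (2 * PI) ltac:(lra) Hc) as [xm [Hm _]].
  assert (Hpos : forall x, 0 < Cmod (dgam gam x)).
  { intros x. apply Cmod_gt_0. apply (contour_regular _ H). }
  exists (Cmod (dgam gam xm)), (Cmod (dgam gam xM)).
  split; [apply Hpos|]. split; [apply Hpos|].
  intros x. destruct (periodic_reduce (dgam gam) (dgam_periodic _ (gam_periodic _ H)) x) as [y [Hy E]].
  rewrite E. split; [apply Hm|apply HM]; lra.
Qed.

Lemma gam_diff gam : is_contour gam -> forall x y,
  is_RInt (V := CR) (dgam gam) x y (gam y - gam x)%C.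
Proof.
  intros H x y. apply (is_RInt_derive (V := CR) gam (dgam gam)).
  - intros; apply (contour_C1 _ H).
  - intros; apply dgam_continuous; auto.
Qed.

Lemma gam_lipschitz gam L : is_contour gam -> (forall x, Cmod (dgam gam x) <= L) ->
  forall x y, Cmod (gam x - gam y)%C <= L * Rabs (x - y).
Proof.
  intros H HL.
  assert (A : forall x y, x <= y -> Cmod (gam x - gam y)%C <= L * Rabs (x - y)).
  { intros x y Hxy. rewrite Cmod_sub_sym, (Rabs_left1 (x - y)) by lra.
    replace (L * - (x - y)) with ((y - x) * L) by ring.
    apply (is_RInt_C_bound (dgam gam)); auto. apply gam_diff; auto. }
  intros x y. destruct (Rle_dec x y); [auto|].
  rewrite Cmod_sub_sym, Rabs_minus_sym. apply A; lra.
Qed.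

(** Where the derivative differs from its value at [u] by less than half the modulus of that value,
    integration bounds the chord from below. One number [d] is both radius and constant, which suits
    the compactness argument of [chord_arc]. *)
Lemma gam_local_chord gam u : is_contour gam ->
  exists d, 0 < d /\ forall x y, Rabs (x - u) < d -> Rabs (y - u) < d ->
    d * Rabs (x - y) <= Cmod (gam x - gam y)%C.
Proof.
  intros H.
  assert (Hp : 0 < Cmod (dgam gam u)) by (apply Cmod_gt_0, (contour_regular _ H)).
  set (e := Cmod (dgam gam u) / 2) in *.
  assert (He : 0 < e) by (unfold e; lra).
  generalize (dgam_continuous _ H u); intros Hc.
  generalize (proj1 (continuous_C _ _) Hc); clear Hc; intros Hc. destruct (Hc e He) as [d [Hd0 Hd]].
  exists (Rmin d e). split; [apply Rmin_pos; auto|].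
  assert (A : forall x y, x <= y -> Rabs (x - u) < Rmin d e -> Rabs (y - u) < Rmin d e ->
    Rmin d e * Rabs (x - y) <= Cmod (gam x - gam y)%C).
  { intros x y Hxy Hx Hy.
    assert (I : is_RInt (V := CR) (fun s => dgam gam s - dgam gam u)%C x y
       (gam y - gam x - RtoC (y - x) * dgam gam u)%C).
    { apply is_RInt_Cminus; [apply gam_diff; auto|].
      generalize (is_RInt_const (V := CR) x y (dgam gam u)). rewrite <- scal_R_Cmult. auto. }
    assert (B : Cmod (gam y - gam x - RtoC (y - x) * dgam gam u)%C <= (y - x) * e).
    { eapply is_RInt_C_bound; [lra| |exact I].
      intros s Hs. left. apply Hd.
      apply Rle_lt_trans with (Rmax (Rabs (x - u)) (Rabs (y - u))).
      - apply RmaxAbs; lra.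
      - apply Rmax_lub_lt; eapply Rlt_le_trans; eauto; apply Rmin_l. }
    assert (D : (y - x) * (2 * e) <= Cmod (gam y - gam x)%C + (y - x) * e).
    { replace ((y - x) * (2 * e)) with (Cmod (RtoC (y - x) * dgam gam u)%C).
      2:{ rewrite Cmod_mult, Cmod_R, Rabs_right by lra. unfold e; field. }
      replace (RtoC (y - x) * dgam gam u)%C with ((gam y - gam x) - (gam y - gam x - RtoC (y - x)
        * dgam gam u))%C by ring.
      eapply Rle_trans; [apply Cmod_sub_le|]. lra. }
    rewrite Cmod_sub_sym, (Rabs_left1 (x - y)) by lra.
    assert (Rmin d e <= e) by apply Rmin_r. nra. }
  intros x y Hx Hy. destruct (Rle_dec x y); [auto|].
  rewrite Cmod_sub_sym, Rabs_minus_sym. apply A; auto; lra.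
Qed.

Lemma gam_injective gam : is_contour gam -> forall x y, x < y < x + 2 * PI -> gam x <> gam y.
Proof.
  intros H x y Hxy E.
  generalize (gam_periodic _ H) PI_RGT_0; intros Hp HP.
  destruct (period_reduce x 0) as [k Hk]. destruct (period_reduce y 0) as [l Hl].
  rewrite <- (periodic_Z gam Hp (- k) x), <- (periodic_Z gam Hp (- l) y) in E.
  rewrite !opp_IZR in E.
  assert (E' := contour_simple _ H (x + - IZR k * (2 * PI)) (y + - IZR l * (2 * PI)) ltac:(lra) ltac:(lra) E).
  assert (F : y - x = (IZR (l - k)) * (2 * PI)) by (rewrite minus_IZR; lra).
  destruct (Z_le_gt_dec (l - k) 0) as [h|h].
  - apply IZR_le in h. nra.
  - assert (h' : (1 <= l - k)%Z) by lia. apply IZR_le in h'. nra.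
Qed.

(** Compactness of the square: near the diagonal regularity of the parametrization gives the bound,
    away from it injectivity does, and [b < a + 2 * PI] prevents the two ends from meeting. *)
Lemma chord_arc gam a b : is_contour gam -> a < b < a + 2 * PI ->
  exists c, 0 < c /\ forall x y, a <= x <= b -> a <= y <= b ->
    c * Rabs (x - y) <= Cmod (gam x - gam y)%C.
Proof.
  intros H Hab.
  destruct (speed_bounds _ H) as [c0 [L [_ [HL Hs]]]].
  assert (Hlip := gam_lipschitz gam L H (fun x => proj2 (Hs x))).
  assert (Hd : forall u v, exists d : posreal, a <= u <= b -> a <= v <= b ->
    forall x y, Rabs (x - u) < d -> Rabs (y - v) < d -> d * Rabs (x - y) <= Cmod (gam x - gam y)%C).
  { intros u v.
    destruct (excluded_middle_informative ((a <= u <= b) /\ (a <= v <= b))) as [[Hu Hv]|Hn].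
    2:{ exists (mkposreal 1 ltac:(lra)). intros; tauto. }
    destruct (Req_dec u v) as [E|E].
    - subst v. destruct (gam_local_chord gam u H) as [d [Hd Hd']].
      exists (mkposreal d Hd). simpl. intros _ _. exact Hd'.
    - set (d0 := Cmod (gam u - gam v)%C).
      assert (Hd0 : 0 < d0).
      { apply Cmod_gt_0. intros F.
        assert (G : gam u = gam v) by (apply Cmod_sub_eq0; rewrite F; apply Cmod_0).
        destruct (Rlt_dec u v); [apply (gam_injective gam H u v)|apply (gam_injective gam H v u)]; auto; lra. }
      (* With [d <= 1] and [d * B <= d0], the chord keeps at least [d0 - 2 * L * d], which still
         exceeds [d * (b - a + 2)], and [b - a + 2] bounds the parameter distance. *)
      set (B := 2 * L + (b - a) + 2).
      assert (HB : 0 < B) by (unfold B; lra).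
      assert (Hdp : 0 < Rmin 1 (d0 / B)).
      { apply Rmin_pos; [lra|]. apply Rdiv_lt_0_compat; auto. }
      exists (mkposreal _ Hdp). simpl. intros _ _ x y Hx Hy.
      set (d := Rmin 1 (d0 / B)) in *.
      assert (d <= 1) by apply Rmin_l.
      assert (dB : d * B <= d0).
      { replace d0 with (d0 / B * B) by (field; lra). apply Rmult_le_compat_r; [lra|apply Rmin_r]. }
      assert (Rabs (x - y) <= b - a + 2).
      { apply Rabs_def2 in Hx. apply Rabs_def2 in Hy. apply Rabs_le. lra. }
      assert (d0 <= Cmod (gam x - gam y)%C + L * d + L * d).
      { unfold d0. generalize (Cmod_sub_triangle (gam u) (gam x) (gam v)) (Cmod_sub_triangle (gam x) (gam y)
        (gam v)).
        generalize (Hlip u x) (Hlip y v). rewrite (Rabs_minus_sym u x). nra. }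
      unfold B in dB. nra. }
  set (delta := fun u v => proj1_sig (constructive_indefinite_description _ (Hd u v))).
  assert (Hdelta : forall u v, a <= u <= b -> a <= v <= b ->
    forall x y, Rabs (x - u) < delta u v -> Rabs (y - v) < delta u v ->
      delta u v * Rabs (x - y) <= Cmod (gam x - gam y)%C).
  { intros u v. unfold delta. destruct (constructive_indefinite_description _ (Hd u v)); auto. }
  destruct (compactness_value_2d a b a b delta) as [d Hdd].
  exists d. split; [apply d|]. intros x y Hx Hy.
  apply Rnot_lt_le; intros Hlt. apply (Hdd x y Hx Hy). intros [u [v [Hu [Hv [Hxu [Hyv Hle]]]]]].
  generalize (Hdelta u v Hu Hv x y Hxu Hyv) (Rabs_pos (x - y)). nra.
Qed.

Lemma jump_set_incr nd thd : is_jump_set nd thd -> forall i j, (1 <= i)%nat -> (i < j <= nd)%nat ->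
  thd i < thd j.
Proof.
  intros [_ [_ [_ H]]] i j Hi Hj. destruct Hj as [Hij Hj]. induction Hij as [|j Hij IH].
  - apply H; lia.
  - apply Rlt_trans with (thd j); [apply IH; lia| apply H; lia].
Qed.

Lemma jump_set_range nd thd : is_jump_set nd thd -> forall j, (1 <= j <= nd)%nat -> 0 < thd j < 2 * PI.
Proof.
  intros H j Hj. destruct H as [H1 [H2 [H3 H4]]] eqn:E. clear E.
  generalize (jump_set_incr nd thd H); intros Hi.
  split.
  - destruct (Nat.eq_dec j 1) as [->|]; auto. apply Rlt_trans with (thd 1%nat); auto. apply Hi; lia.
  - destruct (Nat.eq_dec j nd) as [->|]; auto. apply Rlt_trans with (thd nd); auto. apply Hi; lia.
Qed.

Lemma arc_end_bounds nd thd : is_jump_set nd thd -> forall j, (1 <= j <= nd)%nat ->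
  thd j < arc_end nd thd j <= thd j + 2 * PI /\
  (nd <> 1%nat -> arc_end nd thd j < thd j + 2 * PI).
Proof.
  intros H j Hj. generalize (jump_set_incr nd thd H) (jump_set_range nd thd H); intros Hi Hr.
  unfold arc_end. destruct (Nat.eqb_spec j nd) as [->|Hn].
  - generalize (Hr 1%nat ltac:(lia)) (Hr nd ltac:(lia)); intros.
    destruct (Nat.eq_dec nd 1) as [->|Hn]; [split; [lra|tauto]|].
    generalize (Hi 1%nat nd ltac:(lia) ltac:(lia)). lra.
  - generalize (Hi j (S j) ltac:(lia) ltac:(lia)) (Hr j ltac:(lia)) (Hr (S j) ltac:(lia)). lra.
Qed.

(** This moves every Hoelder norm to the parameter. A single arc spans a whole period, where the
    chord degenerates and the bounds of the speed apply to the arc length; otherwise [chord_arc] is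
    applied to each arc and the smallest constant is kept. *)
Lemma arc_dist_bounds gam nd thd : is_contour gam -> is_jump_set nd thd ->
  exists c L, 0 < c /\ 0 < L /\ forall j x y, (1 <= j <= nd)%nat ->
    thd j <= x <= arc_end nd thd j -> thd j <= y <= arc_end nd thd j ->
    c * Rabs (x - y) <= arc_dist gam nd x y <= L * Rabs (x - y).
Proof.
  intros H Hj. destruct (speed_bounds _ H) as [c0 [L [Hc0 [HL Hs]]]].
  unfold arc_dist. destruct (Nat.eqb_spec nd 1) as [E|Hn].
  - exists c0, L. split; auto. split; auto. intros j x y _ _ _.
    assert (A : forall x y, x <= y ->
      c0 * Rabs (x - y) <= Rabs (RInt (fun s => Cmod (dgam gam s)) x y) <= L * Rabs (x - y)).
    { clear x y. intros x y Hxy.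
      assert (I : is_RInt (fun s => Cmod (dgam gam s)) x y (RInt (fun s => Cmod (dgam gam s)) x y)).
      { apply (RInt_correct (V := R_CompleteNormedModule)).
        apply (ex_RInt_continuous (V := R_CompleteNormedModule)). intros; apply speed_continuous; auto. }
      assert (I1 : is_RInt (fun _ => c0) x y (c0 * (y - x))).
      { generalize (is_RInt_const (V := R_NormedModule) x y c0). rewrite Rmult_comm. auto. }
      assert (I2 : is_RInt (fun _ => L) x y (L * (y - x))).
      { generalize (is_RInt_const (V := R_NormedModule) x y L). rewrite Rmult_comm. auto. }
      generalize (is_RInt_le _ _ _ _ _ _ Hxy I1 I (fun s _ => proj1 (Hs s)))
                 (is_RInt_le _ _ _ _ _ _ Hxy I I2 (fun s _ => proj2 (Hs s))).
      intros B1 B2. rewrite (Rabs_left1 (x - y)) by lra. rewrite Rabs_right by nra. lra. }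
    destruct (Rle_dec x y) as [Hxy|Hxy]; [auto|].
    rewrite Rabs_minus_sym.
    replace (RInt _ x y) with (- RInt (fun s => Cmod (dgam gam s)) y x).
    2:{ apply (opp_RInt_swap (V := R_CompleteNormedModule)).
      apply (ex_RInt_continuous (V := R_CompleteNormedModule)). intros; apply speed_continuous; auto. }
    rewrite Rabs_Ropp. apply A; lra.
  - assert (B : forall k, (k <= nd)%nat -> exists c, 0 < c /\ forall j x y, (1 <= j <= k)%nat ->
      thd j <= x <= arc_end nd thd j -> thd j <= y <= arc_end nd thd j ->
      c * Rabs (x - y) <= Cmod (gam x - gam y)%C).
    { induction k as [|k IH]; intros Hk.
      - exists 1. split; [lra|]. intros; lia.
      - destruct (IH ltac:(lia)) as [c1 [Hc1 H1]].
        destruct (arc_end_bounds nd thd Hj (S k) ltac:(lia)) as [Hb1 Hb2].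
        destruct (chord_arc gam (thd (S k)) (arc_end nd thd (S k)) H ltac:(split;
          [apply Hb1|auto])) as [c2 [Hc2 H2]].
        exists (Rmin c1 c2). split; [apply Rmin_pos; auto|].
        intros j x y Hjk Hx Hy. generalize (Rabs_pos (x - y)) (Rmin_l c1 c2) (Rmin_r c1 c2); intros.
        destruct (Nat.eq_dec j (S k)) as [->|].
        + generalize (H2 x y Hx Hy). nra.
        + generalize (H1 j x y ltac:(lia) Hx Hy). nra. }
    destruct (B nd ltac:(lia)) as [c [Hc Hc']].
    exists c, L. split; auto. split; auto. intros j x y Hjk Hx Hy. split; [eauto|].
    apply gam_lipschitz; auto. intros; apply Hs.
Qed.

Lemma par_spec gam x : is_contour gam -> 0 <= x < 2 * PI -> par gam (gam x) = x.
Proof.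
  intros H Hx. unfold par.
  destruct (epsilon_spec (inhabits 0) (fun th => 0 <= th < 2 * PI /\ gam th = gam x)) as [H1 H2].
  { exists x; auto. }
  apply (contour_simple _ H); auto.
Qed.

(** * Piecewise Hoelder functions *)

(** [Sup] turns an infinite least upper bound into [0]: the empty set makes [0 <= M] necessary here,
    and unbounded sets make an a priori bound necessary in [Sup_ge]. *)
Lemma Sup_le (E : R -> Prop) M : 0 <= M -> (forall x, E x -> x <= M) -> Sup E <= M.
Proof.
  intros HM H. unfold Sup. destruct (Lub_Rbar_correct E) as [_ H2].
  assert (L : Rbar_le (Lub_Rbar E) M) by (apply H2; intros x Hx; apply H, Hx).
  destruct (Lub_Rbar E); simpl in *; auto.
Qed.

Lemma Sup_ge (E : R -> Prop) M x : (forall y, E y -> y <= M) -> E x -> x <= Sup E.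
Proof.
  intros H Hx. unfold Sup. destruct (Lub_Rbar_correct E) as [H1 H2].
  assert (L : Rbar_le (Lub_Rbar E) M) by (apply H2; intros y Hy; apply H, Hy).
  specialize (H1 x Hx). destruct (Lub_Rbar E); simpl in *; auto; tauto.
Qed.

Lemma fold_Rmax_le (l : list R) M : 0 <= M -> (forall x, In x l -> x <= M) -> fold_right Rmax 0 l <= M.
Proof.
  intros HM. induction l as [|a l IH]; simpl; intros H; auto.
  apply Rmax_lub; auto.
Qed.

Lemma fold_Rmax_ge (l : list R) x : In x l -> x <= fold_right Rmax 0 l.
Proof.
  induction l as [|a l IH]; simpl; [tauto|]. intros [->|H].
  - apply Rmax_l.
  - eapply Rle_trans; [apply IH, H|apply Rmax_r].
Qed.

Lemma fold_Rmax_pos (l : list R) : 0 <= fold_right Rmax 0 l.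
Proof. induction l as [|a l IH]; simpl; [lra|]. eapply Rle_trans; [apply IH|apply Rmax_r]. Qed.

Lemma X_norm_pos gam nd thd s v : 0 <= X_norm gam nd thd s v.
Proof. apply fold_Rmax_pos. Qed.

Lemma has_lat_right_eps gam v th l : has_lat_right gam v th l <->
  forall eps, 0 < eps -> exists d, 0 < d /\ forall s, th < s < th + d -> Cmod (v (gam s) - l)%C < eps.
Proof.
  unfold has_lat_right. rewrite filterlim_C. split; intros H eps He; specialize (H eps He).
  - destruct H as [d Hd]. exists d. split; [apply d|]. intros s Hs. apply Hd; [|lra].
    apply Rabs_def1; unfold minus, plus, opp; simpl; lra.
  - destruct H as [d [Hd H]]. exists (mkposreal d Hd). intros s Hs Hs'. apply H.
    apply Rabs_def2 in Hs. unfold minus, plus, opp in Hs; simpl in Hs. lra.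
Qed.

Lemma has_lat_left_eps gam v th l : has_lat_left gam v th l <->
  forall eps, 0 < eps -> exists d, 0 < d /\ forall s, th - d < s < th -> Cmod (v (gam s) - l)%C < eps.
Proof.
  unfold has_lat_left. rewrite filterlim_C. split; intros H eps He; specialize (H eps He).
  - destruct H as [d Hd]. exists d. split; [apply d|]. intros s Hs. apply Hd; [|lra].
    apply Rabs_def1; unfold minus, plus, opp; simpl; lra.
  - destruct H as [d [Hd H]]. exists (mkposreal d Hd). intros s Hs Hs'. apply H.
    apply Rabs_def2 in Hs. unfold minus, plus, opp in Hs; simpl in Hs. lra.
Qed.

Lemma lat_right_eq gam v th l : has_lat_right gam v th l -> lat_right gam v th = l.
Proof. intros H. apply (iota_filterlim_locally (V := CR)); auto. Qed.

Lemma lat_left_eq gam v th l : has_lat_left gam v th l -> lat_left gam v th = l.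
Proof. intros H. apply (iota_filterlim_locally (V := CR)); auto. Qed.

Lemma has_lat_left_period gam v th l : periodic gam -> has_lat_left gam v th l ->
  has_lat_left gam v (th + 2 * PI) l.
Proof.
  rewrite !has_lat_left_eps. intros Hp H eps He. destruct (H eps He) as [d [Hd H']].
  exists d. split; auto. intros s Hs.
  replace (gam s) with (gam (s - 2 * PI)) by (rewrite <- Hp; f_equal; ring).
  apply H'. lra.
Qed.

Lemma Rpower_small s L eps : 0 < s -> 0 <= L -> 0 < eps ->
  exists d, 0 < d /\ forall x, 0 < x < d -> L * Rpower x s < eps.
Proof.
  intros Hs HL He.
  exists (Rpower (eps / (L + 1)) (/ s)). split; [apply Rpower_pos|].
  intros x Hx.
  assert (Hq : 0 < eps / (L + 1)) by (apply Rdiv_lt_0_compat; lra).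
  assert (Rpower x s <= eps / (L + 1)).
  { replace (eps / (L + 1)) with (Rpower (Rpower (eps / (L + 1)) (/ s)) s).
    - apply Rpower_le_base; lra.
    - rewrite Rpower_mult, Rinv_l, Rpower_1 by lra. reflexivity. }
  assert (L * Rpower x s <= L * (eps / (L + 1))) by (apply Rmult_le_compat_l; auto).
  assert ((L + 1) * (eps / (L + 1)) = eps) by (field; lra).
  set (q := eps / (L + 1)) in *. lra.
Qed.

Lemma holder_modulus s L g : 0 < s -> holder s L g -> forall eps, 0 < eps ->
  exists d, 0 < d /\ forall x y, Rabs (x - y) < d -> Cmod (g x - g y)%C < eps.
Proof.
  intros Hs H eps He. destruct (Rpower_small s L eps Hs (holder_pos _ _ _ H) He) as [d [Hd Hd']].
  exists d. split; auto.
  assert (A : forall x y, x < y -> Rabs (x - y) < d -> Cmod (g x - g y)%C < eps).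
  { intros x y Hxy Hd2. eapply Rle_lt_trans; [apply H, Hxy|]. apply Hd'.
    rewrite Rabs_left in Hd2 by lra. lra. }
  intros x y Hxy. destruct (Rtotal_order x y) as [h|[h|h]].
  - auto.
  - subst. rewrite Cmod_sub_refl. auto.
  - rewrite Cmod_sub_sym. apply A; auto. rewrite Rabs_minus_sym; auto.
Qed.

Lemma holder_continuous s L g : 0 < s -> holder s L g -> forall x, ccontinuous g x.
Proof.
  intros Hs H x. apply continuous_C. intros eps He.
  destruct (holder_modulus s L g Hs H eps He) as [d [Hd Hd']]. exists d. split; auto.
Qed.

Section PiecewiseHoelder.

Variables (gam : R -> C) (nd : nat) (thd : nat -> R).
Hypothesis Hgam : is_contour gam.
Hypothesis Hj : is_jump_set nd thd.

(** Without jumps the lateral values are the values, so [arc_val] is [v] along [gam]; comparing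
    distances costs the factor [Rpower (/ c) s]. The error of the method is measured through this
    lemma. *)
Lemma X_norm_le_holder s : 0 < s -> exists K, 0 <= K /\ forall v E,
  holder s E (fun x => v (gam x)) -> bounded_by E (fun x => v (gam x)) ->
  in_X gam nd thd s v /\ X_norm gam nd thd s v <= K * E.
Proof.
  intros Hs. destruct (arc_dist_bounds gam nd thd Hgam Hj) as [c [L [Hc [HL Hd]]]].
  exists (1 + Rpower (/ c) s). split. { generalize (Rpower_pos (/ c) s); lra. }
  intros v E Hh Hb.
  assert (HE := bounded_by_pos _ _ Hb).
  assert (Hr : forall th, has_lat_right gam v th (v (gam th))).
  { intros th. apply has_lat_right_eps. intros eps He.
    destruct (holder_modulus s E _ Hs Hh eps He) as [d [Hd0 Hd']].
    exists d. split; auto. intros x Hx. apply Hd'. apply Rabs_def1; lra. }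
  assert (Hl : forall th, has_lat_left gam v th (v (gam th))).
  { intros th. apply has_lat_left_eps. intros eps He.
    destruct (holder_modulus s E _ Hs Hh eps He) as [d [Hd0 Hd']].
    exists d. split; auto. intros x Hx. apply Hd'. apply Rabs_def1; lra. }
  assert (Hav : forall a b x, arc_val gam v a b x = v (gam x)).
  { intros a b x. unfold arc_val. destruct (Req_EM_T x a) as [->|]; [apply lat_right_eq, Hr|].
    destruct (Req_EM_T x b) as [->|]; [apply lat_left_eq, Hl|]. reflexivity. }
  assert (Hq : forall j x y, (1 <= j <= nd)%nat -> thd j <= x <= arc_end nd thd j ->
    thd j <= y <= arc_end nd thd j ->
    x <> y -> Cmod (v (gam x) - v (gam y))%C <= Rpower (/ c) s * E * Rpower (arc_dist gam nd x y) s).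
  { intros j x y Hjn Hx Hy Hxy.
    assert (Hab : 0 < Rabs (x - y)) by (apply Rabs_pos_lt; lra).
    assert (A : Cmod (v (gam x) - v (gam y))%C <= E * Rpower (Rabs (x - y)) s).
    { destruct (Rtotal_order x y) as [h|[h|h]]; [|lra|].
      - rewrite Rabs_left1 by lra. replace (- (x - y)) with (y - x) by ring. apply Hh; auto.
      - rewrite Cmod_sub_sym, Rabs_right by lra. apply Hh; auto. }
    eapply Rle_trans; [apply A|].
    replace (Rpower (/ c) s * E * Rpower (arc_dist gam nd x y) s) with (E * (Rpower (/ c)
      s * Rpower (arc_dist gam nd x y) s)) by ring.
    apply Rmult_le_compat_l; auto.
    destruct (Hd j x y Hjn Hx Hy) as [D _].
    assert (0 < arc_dist gam nd x y) by nra.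
    assert (0 < / c) by (apply Rinv_0_lt_compat; auto).
    rewrite Rpower_mult_distr by auto. apply Rpower_le_base; [lra|].
    split; auto. apply Rmult_le_reg_l with c; auto.
    replace (c * (/ c * arc_dist gam nd x y)) with (arc_dist gam nd x y) by (field; lra). auto. }
  split.
  - intros j Hjn. split; [|split].
    + exists (Rpower (/ c) s * E). intros x y Hx Hy. destruct (Req_dec x y) as [->|Hxy].
      * rewrite Cmod_sub_refl. apply Rmult_le_pos; [apply Rmult_le_pos; auto|]; left; apply Rpower_pos.
      * apply (Hq j); auto; lra.
    + exists (v (gam (thd j))). apply Hr.
    + apply Hl.
  - apply fold_Rmax_le.
    { apply Rmult_le_pos; auto. generalize (Rpower_pos (/ c) s); lra. }
    intros r Hin. apply in_map_iff in Hin. destruct Hin as [j [<- Hin]]. apply in_seq in Hin.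
    rewrite Rmult_plus_distr_r, Rmult_1_l. apply Rplus_le_compat; apply Sup_le; auto.
    + intros r [x [Hx ->]]. rewrite Hav. apply Hb.
    + apply Rmult_le_pos; auto. left; apply Rpower_pos.
    + intros r [x [y [Hx [Hy [Hxy ->]]]]]. rewrite !Hav.
      apply Rmult_le_reg_r with (Rpower (arc_dist gam nd x y) s); [apply Rpower_pos|].
      unfold Rdiv. rewrite Rmult_assoc, Rinv_l, Rmult_1_r by (generalize (Rpower_pos (arc_dist gam nd x y) s);
        lra).
      apply (Hq j); auto. lia.
Qed.

Lemma in_X_lat_left s v j : in_X gam nd thd s v -> (1 <= j <= nd)%nat ->
  has_lat_left gam v (arc_end nd thd j) (v (gam (arc_end nd thd j))).
Proof.
  intros Hv Hjn. unfold arc_end. destruct (Nat.eqb_spec j nd) as [E|E].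
  - rewrite (gam_periodic _ Hgam). apply has_lat_left_period; [apply gam_periodic, Hgam|].
    apply Hv; lia.
  - apply Hv; lia.
Qed.

Lemma arc_val_incoming s v j x : in_X gam nd thd s v -> (1 <= j <= nd)%nat ->
  thd j < x <= arc_end nd thd j -> arc_val gam v (thd j) (arc_end nd thd j) x = v (gam x).
Proof.
  intros Hv Hjn Hx. unfold arc_val. destruct (Req_EM_T x (thd j)); [lra|].
  destruct (Req_EM_T x (arc_end nd thd j)) as [->|]; auto.
  apply lat_left_eq. apply (in_X_lat_left s); auto.
Qed.

(** [in_X] speaks of the open arc only; the bound passes to the lateral values in the limit. It is
    qualitative, and serves to make the suprema in [X_norm] finite. *)
Lemma arc_val_holder s v j : 0 < s -> in_X gam nd thd s v -> (1 <= j <= nd)%nat ->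
  exists L, 0 <= L /\ holder_on s L (arc_val gam v (thd j) (arc_end nd thd j)) (thd j) (arc_end nd thd j).
Proof.
  intros Hs Hv Hjn. destruct (arc_dist_bounds gam nd thd Hgam Hj) as [c [L [Hc [HL Hd]]]].
  destruct (arc_end_bounds nd thd Hj j Hjn) as [[Hab _] _].
  destruct (Hv j Hjn) as [[L0 H0] [[l Hl] _]].
  generalize (in_X_lat_left s v j Hv Hjn) (arc_val_incoming s v j) ; intros Hr Hin.
  set (a := thd j) in *. set (b := arc_end nd thd j) in *.
  set (L1 := Rmax L0 0 * Rpower L s).
  assert (HL1 : 0 <= L1) by (apply Rmult_le_pos; [apply Rmax_r|left; apply Rpower_pos]).
  assert (H1 : forall x y, a < x -> x < y -> y < b -> Cmod (v (gam x) - v (gam y))%C <= L1 * Rpower (y - x) s).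
  { intros x y Hx Hxy Hy. eapply Rle_trans; [apply H0; lra|].
    unfold L1. rewrite Rmult_assoc, Rpower_mult_distr by lra.
    destruct (Hd j x y Hjn ltac:(split; unfold a, b in *; lra) ltac:(unfold a, b in *; split; lra)) as [D1 D2].
    rewrite Rabs_left in D1, D2 by lra.
    apply Rmult_le_compat; try (left; apply Rpower_pos); try apply Rmax_l.
    - destruct (Rle_dec 0 L0) as [h|h]; auto. exfalso.
      specialize (H0 x y ltac:(lra) ltac:(lra)).
      generalize (Cmod_ge_0 (v (gam x) - v (gam y))%C) (Rpower_pos (arc_dist gam nd x y) s). nra.
    - apply Rpower_le_base; [lra|]. split; [|replace (y - x) with (- (x - y)) by ring; auto]. nra. }
  exists L1. split; auto. intros x y Hx Hxy Hy.
  apply le_epsilon. intros eps He.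
  (* The substitutes for [x] and [y] stay in separate halves of [[x, y]], so they keep their order
     and are no farther apart. *)
  assert (X : exists x', a < x' /\ x <= x' < (x + y) / 2 /\
    Cmod (arc_val gam v a b x - v (gam x'))%C <= eps / 2).
  { destruct (Req_dec x a) as [->|Hxa].
    - assert (arc_val gam v a b a = l) as ->.
      { unfold arc_val. destruct (Req_EM_T a a); [|tauto]. apply lat_right_eq, Hl. }
      destruct (proj1 (has_lat_right_eps _ _ _ _) Hl (eps / 2) ltac:(lra)) as [d [Hd0 Hd']].
      exists (a + Rmin (d / 2) ((y - a) / 4)).
      assert (0 < Rmin (d / 2) ((y - a) / 4)) by (apply Rmin_pos; lra).
      generalize (Rmin_l (d / 2) ((y - a) / 4)) (Rmin_r (d / 2) ((y - a) / 4)); intros.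
      repeat split; try lra. rewrite Cmod_sub_sym. left. apply Hd'. lra.
    - exists x. repeat split; try lra. rewrite Hin by (auto; lra). rewrite Cmod_sub_refl. lra. }
  assert (Y : exists y', y' < b /\ (x + y) / 2 < y' <= y /\
    Cmod (arc_val gam v a b y - v (gam y'))%C <= eps / 2).
  { destruct (Req_dec y b) as [->|Hyb].
    - rewrite Hin by (auto; lra).
      destruct (proj1 (has_lat_left_eps _ _ _ _) Hr (eps / 2) ltac:(lra)) as [d [Hd0 Hd']].
      exists (b - Rmin (d / 2) ((b - x) / 4)).
      assert (0 < Rmin (d / 2) ((b - x) / 4)) by (apply Rmin_pos; lra).
      generalize (Rmin_l (d / 2) ((b - x) / 4)) (Rmin_r (d / 2) ((b - x) / 4)); intros.
      repeat split; try lra. rewrite Cmod_sub_sym. left. apply Hd'. lra.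
    - exists y. repeat split; try lra. rewrite Hin by (auto; lra). rewrite Cmod_sub_refl. lra. }
  destruct X as [x' [X1 [X2 X3]]]. destruct Y as [y' [Y1 [Y2 Y3]]].
  generalize (H1 x' y' X1 ltac:(lra) Y1).
  assert (L1 * Rpower (y' - x') s <= L1 * Rpower (y - x) s).
  { apply Rmult_le_compat_l; auto. apply Rpower_le_base; lra. }
  generalize (Cmod_sub_triangle (arc_val gam v a b x) (v (gam x')) (arc_val gam v a b y))
    (Cmod_sub_triangle (v (gam x')) (v (gam y')) (arc_val gam v a b y)).
  rewrite (Cmod_sub_sym (v (gam y'))). lra.
Qed.

(** Converse of [X_norm_le_holder]: once [arc_val_holder] has made the suprema finite, they bound
    each quotient, and [Rpower L s] converts distances on the arc to parameter distances. *)
Lemma X_norm_arc s : 0 < s -> exists K, 0 <= K /\ forall v, in_X gam nd thd s v ->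
  forall j, (1 <= j <= nd)%nat ->
    holder_on s (K * X_norm gam nd thd s v) (arc_val gam v (thd j) (arc_end nd thd j)) (thd j)
      (arc_end nd thd j) /\
    forall x, thd j <= x <= arc_end nd thd j ->
      Cmod (arc_val gam v (thd j) (arc_end nd thd j) x) <= X_norm gam nd thd s v.
Proof.
  intros Hs. destruct (arc_dist_bounds gam nd thd Hgam Hj) as [c [L [Hc [HL Hd]]]].
  exists (Rpower L s). split; [left; apply Rpower_pos|]. intros v Hv j Hjn.
  destruct (arc_val_holder s v j Hs Hv Hjn) as [L0 [HL0 H0]].
  destruct (arc_end_bounds nd thd Hj j Hjn) as [[Hab _] _].
  assert (Hd' := fun x y => Hd j x y Hjn).
  assert (Hle : arc_sup gam v (thd j) (arc_end nd thd j) +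
    arc_seminorm gam nd s v (thd j) (arc_end nd thd j) <= X_norm gam nd thd s v).
  { apply fold_Rmax_ge. apply in_map_iff. exists j. split; auto. apply in_seq. lia. }
  set (a := thd j) in *. set (b := arc_end nd thd j) in *. set (G := arc_val gam v a b) in *.
  assert (HG : forall x y, a <= x <= b -> a <= y <= b -> x <> y ->
    Cmod (G x - G y)%C <= L0 * Rpower (Rabs (x - y)) s).
  { intros x y Hx Hy Hxy. destruct (Rtotal_order x y) as [h|[h|h]]; [|lra|].
    - rewrite Rabs_left1 by lra. replace (- (x - y)) with (y - x) by ring. apply H0; lra.
    - rewrite Cmod_sub_sym, Rabs_right by lra. apply H0; lra. }
  assert (Hsup : forall x, a <= x <= b -> Cmod (G x) <= arc_sup gam v a b).
  { intros x Hx. apply Sup_ge with (M := Cmod (G a) + L0 * Rpower (b - a) s).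
    - intros r [y [Hy ->]]. fold G. destruct (Req_dec y a) as [->|Hya].
      + assert (0 <= L0 * Rpower (b - a) s) by (apply Rmult_le_pos; auto; left; apply Rpower_pos). lra.
      + generalize (HG y a Hy ltac:(lra) Hya).
        assert (L0 * Rpower (Rabs (y - a)) s <= L0 * Rpower (b - a) s).
        { apply Rmult_le_compat_l; auto. rewrite Rabs_right by lra. apply Rpower_le_base; lra. }
        replace (G y) with ((G y - G a) + G a)%C at 2 by ring.
        generalize (Cmod_triangle (G y - G a) (G a)). lra.
    - exists x; split; auto. }
  assert (Hsem : forall x y, a <= x <= b -> a <= y <= b -> x <> y ->
     Cmod (G x - G y)%C / Rpower (arc_dist gam nd x y) s <= arc_seminorm gam nd s v a b).
  { intros x y Hx Hy Hxy. apply Sup_ge with (M := L0 * Rpower (/ c) s).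
    - clear x y Hx Hy Hxy. intros r [x [y [Hx [Hy [Hxy ->]]]]]. fold G.
      apply Rmult_le_reg_r with (Rpower (arc_dist gam nd x y) s); [apply Rpower_pos|].
      unfold Rdiv. rewrite Rmult_assoc, Rinv_l, Rmult_1_r by (generalize (Rpower_pos (arc_dist gam nd x y) s);
        lra).
      eapply Rle_trans; [apply HG; auto|]. rewrite Rmult_assoc. apply Rmult_le_compat_l; auto.
      assert (Hpos : 0 < Rabs (x - y)) by (apply Rabs_pos_lt; lra).
      destruct (Hd' x y Hx Hy) as [D _].
      assert (0 < arc_dist gam nd x y) by nra.
      assert (0 < / c) by (apply Rinv_0_lt_compat; auto).
      rewrite Rpower_mult_distr by auto. apply Rpower_le_base; [lra|]. split; auto.
      apply Rmult_le_reg_l with c; auto.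
      replace (c * (/ c * arc_dist gam nd x y)) with (arc_dist gam nd x y) by (field; lra). auto.
    - exists x, y; auto. }
  assert (P1 : 0 <= arc_sup gam v a b) by (eapply Rle_trans; [apply Cmod_ge_0|apply (Hsup a); lra]).
  assert (P2 : 0 <= arc_seminorm gam nd s v a b).
  { eapply Rle_trans; [|apply (Hsem a b); lra]. apply Rmult_le_pos; [apply Cmod_ge_0|].
    left; apply Rinv_0_lt_compat, Rpower_pos. }
  split.
  - intros x y Hx Hxy Hy.
    assert (S := Hsem x y ltac:(lra) ltac:(lra) ltac:(lra)).
    destruct (Hd' x y ltac:(lra) ltac:(lra)) as [D1 D2]. rewrite Rabs_left in D1, D2 by lra.
    assert (Hp : 0 < arc_dist gam nd x y) by nra.
    assert (E : Cmod (G x - G y)%C =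
      Cmod (G x - G y)%C / Rpower (arc_dist gam nd x y) s * Rpower (arc_dist gam nd x y) s).
    { field. generalize (Rpower_pos (arc_dist gam nd x y) s); lra. }
    rewrite E. rewrite (Rmult_comm (Rpower L s)), Rmult_assoc, Rpower_mult_distr by lra.
    apply Rmult_le_compat.
    + apply Rmult_le_pos; [apply Cmod_ge_0|]. left; apply Rinv_0_lt_compat, Rpower_pos.
    + left; apply Rpower_pos.
    + lra.
    + apply Rpower_le_base; [lra|]. split; auto. replace (y - x) with (- (x - y)) by ring. auto.
  - intros x Hx. generalize (Hsup x Hx). lra.
Qed.

Lemma find_arc x : thd 1%nat < x <= thd 1%nat + 2 * PI ->
  exists j, (1 <= j <= nd)%nat /\ thd j < x <= arc_end nd thd j.
Proof.
  intros Hx. destruct Hj as [Hnd _].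
  assert (A : forall k, (1 <= k <= nd)%nat ->
    thd k < x \/ exists j, (1 <= j < k)%nat /\ thd j < x <= thd (S j)).
  { induction k as [|k IH]; [lia|]. intros Hk. destruct (Nat.eq_dec k 0) as [->|Hk0]; [left; lra|].
    destruct (IH ltac:(lia)) as [h|[j [h1 h2]]].
    - destruct (Rlt_dec (thd (S k)) x); [left; auto|]. right. exists k. split; [lia|lra].
    - right. exists j. split; [lia|auto]. }
  destruct (A nd ltac:(lia)) as [h|[j [h1 h2]]].
  - exists nd. split; [lia|]. unfold arc_end. rewrite Nat.eqb_refl. lra.
  - exists j. split; [lia|]. unfold arc_end. destruct (Nat.eqb_spec j nd); [lia|auto].
Qed.

Lemma X_norm_bounded s v : 0 < s -> in_X gam nd thd s v ->
  bounded_by (X_norm gam nd thd s v) (fun x => v (gam x)).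
Proof.
  intros Hs Hv x. destruct (X_norm_arc s Hs) as [K [_ H]].
  (* Reducing [- x] yields a representative in an interval open on the left and closed on the right,
     as incoming values require. *)
  destruct (period_reduce (- x) (- (thd 1%nat + 2 * PI))) as [k Hk].
  assert (E : gam x = gam (x + IZR k * (2 * PI))).
  { symmetry. apply periodic_Z, gam_periodic, Hgam. }
  rewrite E. destruct (find_arc (x + IZR k * (2 * PI)) ltac:(lra)) as [j [Hjn Hx]].
  rewrite <- (arc_val_incoming s v j) by auto. apply H; auto. lra.
Qed.

Lemma jump_bound s v j : 0 < s -> in_X gam nd thd s v -> (1 <= j <= nd)%nat ->
  Cmod (jump gam v (thd j)) <= 2 * X_norm gam nd thd s v.
Proof.
  intros Hs Hv Hjn. unfold jump.
  rewrite (lat_left_eq gam v (thd j) (v (gam (thd j)))) by (apply Hv; auto).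
  eapply Rle_trans; [apply Cmod_sub_le|].
  generalize (X_norm_bounded s v Hs Hv (thd j)); simpl.
  destruct (X_norm_arc s Hs) as [K [_ H]]. destruct (H v Hv j Hjn) as [_ H2].
  destruct (arc_end_bounds nd thd Hj j Hjn) as [[Hab _] _].
  specialize (H2 (thd j) ltac:(lra)).
  unfold arc_val in H2. destruct (Req_EM_T (thd j) (thd j)); [|tauto]. lra.
Qed.

Definition step (a x : R) : R := if Rle_dec x a then 0 else 1.

Lemma J_part_param v x : 0 <= x < 2 * PI -> J_part gam nd thd v (gam x) =
  (csum (fun j => jump gam v (thd j) * RtoC (step (thd j) x - x / (2 * PI)))%C 1 nd).
Proof.
  intros Hx. unfold J_part. apply csum_ext. intros j _. do 2 f_equal. unfold G_gen, H_step, R_ramp.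
  rewrite par_spec by auto. reflexivity.
Qed.

Lemma J_part_bounded s v : 0 < s -> in_X gam nd thd s v ->
  bounded_by (INR nd * (2 * X_norm gam nd thd s v)) (fun x => J_part gam nd thd v (gam x)).
Proof.
  intros Hs Hv. apply bounded_by_periodic.
  { apply pullback_periodic, Hgam. }
  intros x Hx. rewrite J_part_param by auto. rewrite <- rsum_const. apply csum_bound.
  intros j Hjn. rewrite Cmod_mult, Cmod_R.
  generalize (jump_bound s v j Hs Hv Hjn) (Cmod_ge_0 (jump gam v (thd j))); intros.
  assert (0 <= x / (2 * PI) <= 1).
  { split; [apply Rmult_le_pos; [lra|left; apply Rinv_0_lt_compat; lra]|].
    apply Rmult_le_reg_r with (2 * PI); [lra|]. replace (x / (2 * PI) * (2 * PI)) with x by (field; lra). lra. }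
  assert (Rabs (step (thd j) x - x / (2 * PI)) <= 1).
  { unfold step. apply Rabs_le. destruct (Rle_dec x (thd j)); lra. }
  generalize (Rabs_pos (step (thd j) x - x / (2 * PI))). nra.
Qed.

Lemma step_sum (J : nat -> C) x i n : (i <= n)%nat ->
  (forall j, (1 <= j <= n)%nat -> thd j < x <-> (j <= i)%nat) ->
  csum (fun j => J j * RtoC (step (thd j) x))%C 1 n =
  csum J 1 i.
Proof.
  intros Hin. induction Hin as [|n Hin IH]; intros H.
  - apply csum_ext. intros j Hjn. unfold step. destruct (Rle_dec x (thd j)) as [h|h].
    + exfalso. assert (thd j < x) by (apply H; lia). lra.
    + cring.
  - rewrite csum_S, IH.
    + unfold step. destruct (Rle_dec x (thd (S n))) as [h|h]; [cring|].
      exfalso. assert (S n <= i)%nat by (apply H; [lia|lra]). lia.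
    + intros j Hjn. apply H. lia.
Qed.

(** The index [i] counts the jumps strictly before [x], in accordance with incoming values. The
    parameter [2 * PI] is included although [par] sends its point to [0]: there all jumps are
    subtracted and the ramp adds them back. *)
Lemma C_part_param v x i : 0 <= x <= 2 * PI -> (i <= nd)%nat ->
  (forall j, (1 <= j <= nd)%nat -> thd j < x <-> (j <= i)%nat) ->
  C_part gam nd thd v (gam x) =
  (v (gam x) - csum (fun j => jump gam v (thd j)) 1 i
   + RtoC (x / (2 * PI)) * csum (fun j => jump gam v (thd j)) 1 nd)%C.
Proof.
  intros Hx Hi H.
  assert (A : forall x i, 0 <= x < 2 * PI -> (i <= nd)%nat ->
   (forall j, (1 <= j <= nd)%nat -> thd j < x <-> (j <= i)%nat) ->
   C_part gam nd thd v (gam x) =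
  (v (gam x) - csum (fun j => jump gam v (thd j)) 1 i
   + RtoC (x / (2 * PI)) * csum (fun j => jump gam v (thd j)) 1 nd)%C).
  { clear x i Hx Hi H. intros x i Hx Hi H. unfold C_part. rewrite J_part_param by auto.
    rewrite <- (step_sum _ x i nd Hi H), <- csum_mult.
    unfold Cminus. rewrite <- Cplus_assoc. f_equal.
    rewrite <- (Cplus_comm (sum_n_m _ 1 nd)).
    match goal with |- Copp ?a = (?b + - ?c)%C => assert (E : (a = c - b)%C) end.
    { rewrite <- csum_minus. apply csum_ext. intros j _. rewrite RtoC_minus. cring. }
    rewrite E. ring. }
  destruct (Req_dec x (2 * PI)) as [->|Hn].
  - assert (i = nd) as ->.
    { destruct (Nat.eq_dec i nd); auto. assert (nd <= i)%nat; [|lia]. apply H; [destruct Hj; lia|].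
      apply (jump_set_range nd thd Hj nd). destruct Hj; lia. }
    replace (2 * PI) with (0 + 2 * PI) at 1 2 by ring. rewrite !(gam_periodic _ Hgam).
    rewrite (A 0 0%nat); [|generalize PI_RGT_0; lra|lia|].
    2:{ intros j Hjn. generalize (jump_set_range nd thd Hj j Hjn). split; [lra|lia]. }
    rewrite csum_0. replace (0 / (2 * PI)) with 0 by (field; generalize PI_RGT_0; lra).
    replace (2 * PI / (2 * PI)) with 1 by (field; generalize PI_RGT_0; lra). ring.
  - apply A; auto. lra.
Qed.

(* On each parameter interval between consecutive points of [0, thd 1, .., thd nd, 2 pi]
   the function [C_part v] differs from the completed arc of [v] by an affine function:
   the step at [thd j] absorbs the jump there, and the ramp closes up at the cut. *)
Lemma C_part_holder s : 0 < s <= 1 -> exists K, 0 <= K /\ forall v, in_X gam nd thd s v ->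
  holder s (K * X_norm gam nd thd s v) (fun x => C_part gam nd thd v (gam x)) /\
  bounded_by (K * X_norm gam nd thd s v) (fun x => C_part gam nd thd v (gam x)).
Proof.
  intros Hs. destruct (X_norm_arc s ltac:(lra)) as [K [HK HX]].
  generalize PI_RGT_0 (jump_set_range nd thd Hj) (jump_set_incr nd thd Hj) (arc_end_bounds nd thd Hj);
    intros HP Hr Hi He.
  assert (Hnd : (1 <= nd)%nat) by apply Hj.
  (* The ramp is Lipschitz with constant at most 1 on a length at most [2 * PI], hence s-Hoelder
     with constant [Rpower (2 * PI) (1 - s)]; it multiplies the total jump, at most
     [INR nd * 2 * F]. Below, [S nd] pieces are glued and [holder_periodic] doubles the result. *)
  set (K1 := K + INR nd * 2 * Rpower (2 * PI) (1 - s)).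
  assert (HK1 : 0 <= K1).
  { unfold K1. generalize (pos_INR nd) (Rpower_pos (2 * PI) (1 - s)). nra. }
  exists ((INR (S nd) * K1 + INR (S nd) * K1) + (1 + INR nd * 2)).
  assert (HKK : 0 <= INR (S nd) * K1) by (apply Rmult_le_pos; auto; apply pos_INR).
  split. { generalize (pos_INR nd). lra. }
  intros v Hv. set (F := X_norm gam nd thd s v). assert (HF : 0 <= F) by apply X_norm_pos.
  set (g := fun x => C_part gam nd thd v (gam x)).
  set (J := fun j => jump gam v (thd j)). set (SJ := csum J 1 nd).
  assert (HSJ : Cmod SJ <= INR nd * 2 * F).
  { unfold SJ. rewrite Rmult_assoc, <- rsum_const. apply csum_bound. intros j Hjn. apply jump_bound; auto. lra.
    }
  assert (Hpiece : forall (G : R -> C) (k : C) a b, 0 <= a -> a <= b <= 2 * PI -> holder_on s (K * F) G a b ->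
     (forall x, a <= x <= b -> g x = G x - k + RtoC (x / (2 * PI)) * SJ)%C -> holder_on s (K1 * F) g a b).
  { intros G k a b Ha Hb HG Hg x y Hx Hxy Hy. rewrite !Hg by lra.
    replace (_ - _)%C with ((G x - G y) + RtoC ((x - y) / (2 * PI)) * SJ)%C.
    2:{ replace ((x - y) / (2 * PI)) with (x / (2 * PI) - y / (2 * PI)) by (field; lra). rewrite RtoC_minus.
      ring. }
    eapply Rle_trans; [apply Cmod_triangle|].
    unfold K1. rewrite !Rmult_plus_distr_r. apply Rplus_le_compat; [apply HG; auto|].
    rewrite Cmod_mult, Cmod_R.
    assert (A : Rabs ((x - y) / (2 * PI)) <= Rpower (2 * PI) (1 - s) * Rpower (y - x) s).
    { apply Rle_trans with (y - x).
      - unfold Rdiv. rewrite Rabs_mult, (Rabs_left (x - y)) by lra.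
        rewrite Rabs_right by (left; apply Rinv_0_lt_compat; lra).
        rewrite <- (Rmult_1_r (y - x)). replace (- (x - y)) with (y - x) by ring.
        apply Rmult_le_compat_l; [lra|]. rewrite <- Rinv_1. apply Rinv_le_contravar; [lra|].
        generalize PI2_3_2. lra.
      - rewrite <- (Rpower_1 (y - x)) at 1 by lra. replace 1 with ((1 - s) + s) at 1 by ring.
        rewrite Rpower_plus. apply Rmult_le_compat_r; [left; apply Rpower_pos|].
        apply Rpower_le_base; lra. }
    generalize (Cmod_ge_0 SJ) (Rabs_pos ((x - y) / (2 * PI))); intros.
    replace (INR nd * 2 * Rpower (2 * PI) (1 - s) * F * Rpower (y - x) s) with
      ((Rpower (2 * PI) (1 - s) * Rpower (y - x) s) * (INR nd * 2 * F)) by ring.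
    apply Rmult_le_compat; auto. }
  assert (H0 : holder_on s (K1 * F) g 0 (thd 1%nat)).
  (* The piece before the first jump is the end of the last arc, which runs through the cut, so it
     is read one period later. *)
  { generalize (Hr 1%nat ltac:(lia)) (Hr nd ltac:(lia)); intros.
    apply (Hpiece (fun x => arc_val gam v (thd nd) (arc_end nd thd nd) (x + 2 * PI)) (RtoC 0)); [lra|lra| |].
    - intros x y Hx Hxy Hy. replace (y - x) with ((y + 2 * PI) - (x + 2 * PI)) by ring.
      destruct (HX v Hv nd ltac:(lia)) as [Hh _]. apply Hh; [lra|lra|].
      unfold arc_end. rewrite Nat.eqb_refl. lra.
    - intros x Hx. rewrite (arc_val_incoming s v nd (x + 2 * PI) Hv).
      2:{ lia. }
      2:{ unfold arc_end; rewrite Nat.eqb_refl; lra. }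
      rewrite (gam_periodic _ Hgam). unfold g. rewrite (C_part_param v x 0%nat); [|lra|lia|].
      + rewrite csum_0. reflexivity.
      + intros j Hjn. split; [|lia]. intros h. destruct (Nat.eq_dec j 1) as [->|]; [lra|].
        generalize (Hi 1%nat j ltac:(lia) ltac:(lia)). lra. }
  assert (H1 : forall i b, (1 <= i <= nd)%nat -> b = (if Nat.eqb i nd then 2 * PI else thd (S i)) ->
     holder_on s (K1 * F) g (thd i) b).
  { intros i b Hin Hb.
    assert (Hbb : thd i < b <= 2 * PI /\ b <= arc_end nd thd i /\ forall j, (i < j <= nd)%nat -> b <= thd j).
    { subst b. unfold arc_end. generalize (Hr 1%nat ltac:(lia)) (Hr i ltac:(lia)); intros.
      destruct (Nat.eqb_spec i nd) as [->|Hn].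
      - split; [lra|]. split; [lra|]. intros; lia.
      - generalize (Hi i (S i) ltac:(lia) ltac:(lia)) (Hr (S i) ltac:(lia)); intros.
        split; [lra|]. split; [lra|]. intros j Hjn. destruct (Nat.eq_dec j (S i)) as [->|]; [lra|].
        left. apply Hi; lia. }
    destruct Hbb as [Hb1 [Hb2 Hb3]].
    generalize (Hr i Hin); intros Hri.
    apply (Hpiece (arc_val gam v (thd i) (arc_end nd thd i)) (csum J 1 i)); [lra|lra| |].
    - destruct (HX v Hv i Hin) as [Hh _]. intros x y Hx Hxy Hy. apply Hh; lra.
    - intros x Hx. destruct (Req_dec x (thd i)) as [->|Hn].
      + destruct i as [|i]; [lia|].
        unfold g. rewrite (C_part_param v (thd (S i)) i); [|lra|lia|].
        * rewrite csum_S. fold J. unfold arc_val. destruct (Req_EM_T (thd (S i)) (thd (S i))); [|tauto].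
          unfold J at 4. unfold jump. rewrite (lat_left_eq gam v (thd (S i)) (v (gam (thd (S i)))))
            by (apply Hv; lia).
          fold SJ. ring.
        * intros j Hjn. split; intros h.
          -- destruct (le_lt_dec j i); auto. destruct (Nat.eq_dec j (S i)) as [->|]; [lra|].
             generalize (Hi (S i) j ltac:(lia) ltac:(lia)). lra.
          -- apply Hi; lia.
      + rewrite (arc_val_incoming s) by (auto; lra). unfold g. apply C_part_param; [lra|lia|].
        intros j Hjn. split; intros h.
        * destruct (le_lt_dec j i); auto. generalize (Hb3 j ltac:(lia)). lra.
        * destruct (Nat.eq_dec j i) as [->|]; [lra|]. generalize (Hi j i ltac:(lia) ltac:(lia)). lra. }
  assert (H2 : forall i, (1 <= i <= nd)%nat -> holder_on s (INR i * (K1 * F)) g 0 (thd i)).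
  { induction i as [|i IH]; [lia|]. intros Hin. destruct (Nat.eq_dec i 0) as [->|].
    - simpl INR. rewrite Rmult_1_l. auto.
    - rewrite S_INR, Rmult_plus_distr_r, Rmult_1_l.
      assert (0 <= K1 * F) by (apply Rmult_le_pos; auto).
      apply holder_on_glue with (thd i); auto; try lra.
      + apply Rmult_le_pos; auto. apply pos_INR.
      + apply IH; lia.
      + apply H1; [lia|]. destruct (Nat.eqb_spec i nd); [lia|auto]. }
  assert (H3 : holder_on s (INR (S nd) * (K1 * F)) g 0 (2 * PI)).
  { rewrite S_INR, Rmult_plus_distr_r, Rmult_1_l.
      assert (0 <= K1 * F) by (apply Rmult_le_pos; auto).
      apply holder_on_glue with (thd nd); auto; try lra.
      + apply Rmult_le_pos; auto. apply pos_INR.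
      + apply H1; [lia|]. rewrite Nat.eqb_refl; auto. }
  rewrite <- Rmult_assoc in H3.
  split.
  - apply holder_le with (INR (S nd) * K1 * F + INR (S nd) * K1 * F).
    + generalize (pos_INR nd). nra.
    + apply holder_periodic; auto; [lra| |].
      * apply Rmult_le_pos; auto.
      * apply pullback_periodic; auto.
  - intros x. unfold C_part. eapply Rle_trans; [apply Cmod_sub_le|].
    generalize (X_norm_bounded s v ltac:(lra) Hv x) (J_part_bounded s v ltac:(lra) Hv x). fold F. cbv beta.
    generalize (Rmult_le_pos _ _ HKK HF). lra.
Qed.

End PiecewiseHoelder.

(** * Compactness of bounded equi-Hoelder sequences *)

Definition infinite (A : nat -> Prop) : Prop := forall n, exists k, (n <= k)%nat /\ A k.

Lemma infinite_or (A B : nat -> Prop) : infinite (fun k => A k \/ B k) -> infinite A \/ infinite B.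
Proof.
  intros H. destruct (classic (infinite A)) as [h|h]; [left; auto|right].
  apply not_all_ex_not in h. destruct h as [n0 h]. intros n.
  destruct (H (max n n0)) as [k [Hk [Ha|Hb]]].
  - exfalso; apply h. exists k. split; auto. lia.
  - exists k. split; auto. lia.
Qed.

Lemma infinite_sub (A B : nat -> Prop) : (forall k, A k -> B k) -> infinite A -> infinite B.
Proof. intros H HA n. destruct (HA n) as [k [Hk Ha]]. exists k; auto. Qed.

(** Bisection of [[- B, B]]: one of the halves always keeps infinitely many values, and [n] halvings
    bring the length below [eps]. *)
Lemma pigeonhole_bounded (r : nat -> R) B A eps : 0 < eps -> (forall k, Rabs (r k) <= B) -> infinite A ->
  exists A', infinite A' /\ (forall k, A' k -> A k) /\ forall k l, A' k -> A' l -> Rabs (r k - r l) <= eps.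
Proof.
  intros He HB HA.
  assert (HB0 : 0 <= B) by (eapply Rle_trans; [apply Rabs_pos|apply (HB 0%nat)]).
  assert (H : forall n, exists a, infinite (fun k => A k /\ a <= r k <= a + 2 * B * (/ 2) ^ n)).
  { induction n as [|n [a IH]].
    - exists (- B). eapply infinite_sub; [|exact HA]. intros k Hk. split; auto.
      generalize (HB k); intros h. apply Rabs_le_between in h. simpl. lra.
    - assert (I : infinite (fun k => (A k /\ a <= r k <= a + 2 * B * (/ 2) ^ S n) \/
         (A k /\ (a + 2 * B * (/ 2) ^ S n) <= r k <= (a + 2 * B * (/ 2) ^ S n) + 2 * B * (/ 2) ^ S n))).
      { eapply infinite_sub; [|exact IH]. intros k [Hk1 Hk2]. simpl.
        destruct (Rle_dec (r k) (a + 2 * B * (/ 2 * (/ 2) ^ n))); [left|right]; split; auto; lra. }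
      destruct (infinite_or _ _ I) as [h|h]; eexists; exact h. }
  destruct (pow_lt_1_zero (/ 2) ltac:(rewrite Rabs_right;
    lra) (eps / (2 * B + 1)) ltac:(apply Rdiv_lt_0_compat; lra)) as [n Hn].
  specialize (Hn n ltac:(lia)). rewrite Rabs_right in Hn by (apply Rle_ge, pow_le; lra).
  destruct (H n) as [a Ha].
  exists (fun k => A k /\ a <= r k <= a + 2 * B * (/ 2) ^ n). split; auto. split; [tauto|].
  intros k l [_ Hk] [_ Hl].
  assert ((2 * B + 1) * (eps / (2 * B + 1)) = eps) by (field; lra).
  set (q := eps / (2 * B + 1)) in *. set (p := (/ 2) ^ n) in *.
  assert (0 <= p) by (apply pow_le; lra).
  assert (2 * B * p <= eps) by nra.
  apply Rabs_le. lra.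
Qed.

Lemma pigeonhole_list (B : R) (l : list (nat -> R)) A eps : 0 < eps ->
  (forall r, In r l -> forall k, Rabs (r k) <= B) -> infinite A ->
  exists A', infinite A' /\ (forall k, A' k -> A k) /\
    forall r, In r l -> forall i j, A' i -> A' j -> Rabs (r i - r j) <= eps.
Proof.
  intros He. induction l as [|r l IH]; intros HB HA.
  - exists A. split; auto. split; auto. simpl. tauto.
  - destruct IH as [A1 [H1 [H2 H3]]]; auto. { intros; apply HB; simpl; auto. }
    destruct (pigeonhole_bounded r B A1 eps He) as [A2 [G1 [G2 G3]]]; auto.
    { apply HB; simpl; auto. }
    exists A2. split; auto. split; auto.
    intros r' [<-|Hr'] i j Hi Hj'; auto.
Qed.

Lemma Cmod_le_parts z : Cmod z <= Rabs (fst z) + Rabs (snd z).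
Proof.
  replace z with (RtoC (fst z) + Ci * RtoC (snd z))%C at 1.
  - eapply Rle_trans; [apply Cmod_triangle|]. rewrite Cmod_mult, !Cmod_R.
    replace (Cmod Ci) with 1; [lra|]. unfold Cmod, Ci; simpl.
    replace (0 * (0 * 1) + 1 * (1 * 1)) with 1 by ring. symmetry; apply sqrt_1.
  - destruct z; unfold RtoC, Ci, Cplus, Cmult; simpl; f_equal; ring.
Qed.

Lemma parts_le_Cmod z : Rabs (fst z) <= Cmod z /\ Rabs (snd z) <= Cmod z.
Proof. generalize (Rmax_Cmod z) (Rmax_l (Rabs (fst z)) (Rabs (snd z))) (Rmax_r (Rabs (fst z)) (Rabs (snd z))).
lra. Qed.

Section EquiHoelder.

Variables (z : nat -> R -> C) (s B : R).
Hypothesis Hs : 0 < s.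
Hypothesis Hper : forall k, periodic (z k).
Hypothesis Hhol : forall k, holder s B (z k).
Hypothesis Hbnd : forall k, bounded_by B (z k).

(** The Arzela-Ascoli argument at one accuracy. A grid of width [d / 2] on one period is fine enough
    for a variation of [eps / 4], uniformly in [k]; real and imaginary parts at the finitely many
    grid points are then thinned out to within [eps / 8] each. *)
Lemma equi_holder_step A eps : 0 < eps -> infinite A ->
  exists A', infinite A' /\ (forall k, A' k -> A k) /\
    forall k l, A' k -> A' l -> forall x, Cmod (z k x - z l x)%C <= eps.
Proof.
  intros He HA. generalize PI_RGT_0; intros HP.
  assert (HB : 0 <= B) by apply (bounded_by_pos _ _ (Hbnd 0)).
  destruct (Rpower_small s B (eps / 4) Hs HB ltac:(lra)) as [d [Hd Hd']].
  destruct (INR_unbounded (2 * PI / (d / 2))) as [p Hp].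
  set (pt := fun i => INR i * (d / 2)).
  set (l := map (fun i k => fst (z k (pt i))) (seq 0 (S p)) ++ map (fun i k => snd (z k (pt i))) (seq 0 (S p))).
  destruct (pigeonhole_list B l A (eps / 8) ltac:(lra)) as [A' [H1 [H2 H3]]]; auto.
  { intros r Hr k. unfold l in Hr. apply in_app_or in Hr.
    destruct Hr as [Hr|Hr]; apply in_map_iff in Hr; destruct Hr as [i [<- _]];
    (eapply Rle_trans; [|apply (Hbnd k (pt i))]); apply parts_le_Cmod. }
  exists A'. split; auto. split; auto. intros k m Hk Hm x.
  assert (Hper2 : periodic (fun x => z k x - z m x)%C).
  { intros y. rewrite !Hper. reflexivity. }
  destruct (periodic_reduce _ Hper2 x) as [y [Hy ->]]. clear x.
  assert (Hi : exists i, (i <= p)%nat /\ Rabs (y - pt i) < d).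
  { assert (C : forall n, y < INR n * (d / 2) -> exists i, (i < n)%nat /\ Rabs (y - pt i) < d).
    { induction n as [|n IH]; intros Hn. { simpl in Hn. lra. }
      destruct (Rlt_dec y (INR n * (d / 2))) as [h|h].
      - destruct (IH h) as [i [Hi1 Hi2]]. exists i. split; auto.
      - exists n. split; auto. unfold pt. rewrite S_INR in Hn. apply Rabs_def1; lra. }
    destruct (C p) as [i [Hi1 Hi2]].
    - apply Rlt_trans with (2 * PI); [lra|].
      replace (2 * PI) with (2 * PI / (d / 2) * (d / 2)) by (field; lra).
      apply Rmult_lt_compat_r; lra.
    - exists i. split; auto. lia. }
  destruct Hi as [i [Hi1 Hi2]].
  assert (Hz : forall k, Cmod (z k y - z k (pt i))%C <= eps / 4).
  { intros k'. destruct (Rtotal_order y (pt i)) as [h|[h|h]].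
    - eapply Rle_trans; [apply Hhol; auto|]. left; apply Hd'. rewrite Rabs_left in Hi2 by lra. lra.
    - rewrite h, Cmod_sub_refl. lra.
    - rewrite Cmod_sub_sym. eapply Rle_trans; [apply Hhol; auto|]. left; apply Hd'.
      rewrite Rabs_right in Hi2 by lra. lra. }
  assert (Hm' : Cmod (z k (pt i) - z m (pt i))%C <= eps / 4).
  { eapply Rle_trans; [apply Cmod_le_parts|].
    assert (F1 : Rabs (fst (z k (pt i)) - fst (z m (pt i))) <= eps / 8).
    { apply (H3 (fun k => fst (z k (pt i)))); auto. unfold l. apply in_or_app. left.
      apply in_map_iff. exists i. split; auto. apply in_seq. lia. }
    assert (F2 : Rabs (snd (z k (pt i)) - snd (z m (pt i))) <= eps / 8).
    { apply (H3 (fun k => snd (z k (pt i)))); auto. unfold l. apply in_or_app. right.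
      apply in_map_iff. exists i. split; auto. apply in_seq. lia. }
    unfold Cminus, Cplus, Copp; simpl. unfold Rminus in F1, F2. lra. }
  generalize (Cmod_sub_triangle (z k y) (z k (pt i)) (z m y)) (Cmod_sub_triangle (z k (pt i)) (z m (pt i))
    (z m y)).
  generalize (Hz k) (Hz m). rewrite (Cmod_sub_sym (z m (pt i)) (z m y)). lra.
Qed.

(* Nested infinite index sets on which the oscillation is at most [1 / (j + 1)]; [phi j]
   is picked in the [j]-th one, so no monotonicity of [phi] is needed. *)
Lemma equi_holder_subsequence : exists phi : nat -> nat, (forall j, (j <= phi j)%nat) /\
  forall j l, (j <= l)%nat -> forall x, Cmod (z (phi j) x - z (phi l) x)%C <= / INR (S j).
Proof.
  assert (Hpos : forall j, 0 < / INR (S j)) by (intros j; apply Rinv_0_lt_compat, lt_0_INR; lia).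
  set (next := fun j (A : {A | infinite A}) =>
    constructive_indefinite_description _ (equi_holder_step (proj1_sig A) (/ INR (S j)) (Hpos j)
      (proj2_sig A))).
  set (AA := fix AA j : {A | infinite A} :=
    match j with O => exist _ (fun _ => True) (fun n => ex_intro _ n (conj (le_n n) I))
     | S j => exist _ (proj1_sig (next j (AA j))) (proj1 (proj2_sig (next j (AA j)))) end).
  assert (Hsub : forall j l, (j <= l)%nat -> forall k, proj1_sig (AA l) k -> proj1_sig (AA j) k).
  { intros j l Hjl. induction Hjl as [|l Hjl IH]; auto. intros k Hk. apply IH.
    apply (proj2_sig (next l (AA l))). exact Hk. }
  assert (Hphi : forall j, exists k, (j <= k)%nat /\ proj1_sig (AA (S j)) k).
  { intros j. apply (proj2_sig (AA (S j))). }
  set (phi := fun j => proj1_sig (constructive_indefinite_description _ (Hphi j))).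
  assert (Hphi' : forall j, (j <= phi j)%nat /\ proj1_sig (AA (S j)) (phi j)).
  { intros j. unfold phi. destruct (constructive_indefinite_description _ (Hphi j)); auto. }
  exists phi. split; [apply Hphi'|]. intros j l Hjl x.
  apply (proj2_sig (next j (AA j))).
  - apply (Hphi' j).
  - apply (Hsub (S j) (S l)); [lia|]. apply Hphi'.
Qed.

End EquiHoelder.

(** * Admissible integrands *)

(* Coquelicot's Riemann integral has no product lemma, so the definition asks for
   integrability against every continuous factor. *)
Definition admissible (gam : R -> C) (v : C -> C) : Prop :=
  forall g : R -> C, (forall x, ccontinuous g x) ->
    ex_RInt (V := CR) (fun th => g th * v (gam th))%C 0 (2 * PI).

Lemma continuous_Cmult (f g : R -> C) x :
  ccontinuous f x -> ccontinuous g x ->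
  ccontinuous (fun y => f y * g y)%C x.
Proof.
  rewrite !continuous_C. intros Hf Hg eps He.
  set (M := Cmod (f x) + Cmod (g x) + 1).
  assert (HM : 0 < M) by (unfold M; generalize (Cmod_ge_0 (f x)) (Cmod_ge_0 (g x)); lra).
  set (e := Rmin 1 (eps / (2 * M))).
  assert (He' : 0 < e) by (apply Rmin_pos; [lra|apply Rdiv_lt_0_compat; lra]).
  assert (He1 : e <= 1) by apply Rmin_l.
  assert (He2 : e * (2 * M) <= eps).
  { replace eps with (eps / (2 * M) * (2 * M)) by (field; lra). apply Rmult_le_compat_r; [lra|apply Rmin_r]. }
  destruct (Hf e He') as [d1 [Hd1 H1]]. destruct (Hg e He') as [d2 [Hd2 H2]].
  exists (Rmin d1 d2). split; [apply Rmin_pos; auto|]. intros y Hy.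
  specialize (H1 y ltac:(eapply Rlt_le_trans; [exact Hy|apply Rmin_l])).
  specialize (H2 y ltac:(eapply Rlt_le_trans; [exact Hy|apply Rmin_r])).
  replace (f y * g y - f x * g x)%C with ((f y - f x) * (g y - g x) + (f y - f x) * g x +
    f x * (g y - g x))%C by ring.
  eapply Rle_lt_trans; [apply Cmod_triangle|]. eapply Rle_lt_trans; [apply Rplus_le_compat_r, Cmod_triangle|].
  rewrite !Cmod_mult. unfold M in *.
  generalize (Cmod_ge_0 (f x)) (Cmod_ge_0 (g x)) (Cmod_ge_0 (f y - f x)%C) (Cmod_ge_0 (g y - g x)%C). nra.
Qed.

Lemma admissible_continuous gam v :
  (forall x, ccontinuous (fun x => v (gam x)) x) -> admissible gam v.
Proof.
  intros Hv g Hg. apply (ex_RInt_continuous (V := CR)). intros x _.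
  apply (continuous_Cmult g (fun x => v (gam x))); auto.
Qed.

Lemma admissible_ext gam u v : (forall x, u (gam x) = v (gam x)) -> admissible gam u -> admissible gam v.
Proof.
  intros H Hu g Hg. apply (ex_RInt_ext (V := CR) (fun th => g th * u (gam th))%C); auto.
  intros x _. rewrite H; auto.
Qed.

Lemma admissible_plus gam u v : admissible gam u -> admissible gam v -> admissible gam (fun t => u t + v t)%C.
Proof.
  intros Hu Hv g Hg. apply (ex_RInt_ext (V := CR) (fun th => g th * u (gam th) + g th * v (gam th))%C).
  { intros x _. cring. }
  apply (ex_RInt_plus (V := CR)); auto.
Qed.

Lemma admissible_scal gam c u : admissible gam u -> admissible gam (fun t => c * u t)%C.
Proof.
  intros Hu g Hg. destruct (Hu g Hg) as [l Hl]. exists (c * l)%C.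
  eapply (is_RInt_ext (V := CR)); [|apply is_RInt_Cmult, Hl]. intros x _. cring.
Qed.

Lemma admissible_minus gam u v : admissible gam u -> admissible gam v -> admissible gam (fun t => u t - v t)%C.
Proof.
  intros Hu Hv. apply admissible_ext with (fun t => u t + (RtoC (-1)) * v t)%C.
  - intros x. rewrite RtoC_m1. ring.
  - apply admissible_plus; auto. apply admissible_scal; auto.
Qed.

Lemma admissible_sum gam (u : nat -> C -> C) n : (forall j, (1 <= j <= n)%nat -> admissible gam (u j)) ->
  admissible gam (fun t => csum (fun j => u j t) 1 n).
Proof.
  induction n as [|n IH]; intros H.
  - apply admissible_ext with (fun _ => RtoC 0).
    + intros x. rewrite csum_0. reflexivity.
    + intros g Hg. apply (ex_RInt_ext (V := CR) (fun _ => RtoC 0)); [intros; cring|].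
      apply (ex_RInt_const (V := CR)).
  - apply admissible_ext with (fun t => csum (fun j => u j t) 1 n + u (S n) t)%C.
    + intros x. rewrite csum_S. reflexivity.
    + apply admissible_plus; [apply IH; intros; apply H; lia|apply H; lia].
Qed.

Lemma RtoC_continuous (f : R -> R) x : continuous f x -> ccontinuous (fun y => RtoC (f y)) x.
Proof.
  intros H. apply continuous_C. intros eps He.
  apply (filterlim_locally (U := R_UniformSpace)) with (eps := mkposreal eps He) in H.
  destruct H as [d Hd]. exists d. split; [apply d|]. intros y Hy.
  rewrite <- RtoC_minus, Cmod_R. apply Hd. exact Hy.
Qed.

(** In the parameter each generator is affine on both sides of [thd j], so the integral is split
    there; the values at the ends of the pieces do not matter. *)
Lemma admissible_J_part gam nd thd v : is_contour gam -> is_jump_set nd thd ->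
  admissible gam (J_part gam nd thd v).
Proof.
  intros H Hj. generalize PI_RGT_0; intros HP.
  apply (admissible_sum gam (fun j t => jump gam v (thd j) * RtoC (G_gen gam (thd j) t))%C).
  intros j Hjn. generalize (jump_set_range nd thd Hj j Hjn); intros Hr.
  apply admissible_scal. intros g Hg.
  assert (Hl : forall c x, continuous (fun x => c - x / (2 * PI)) x).
  { intros c x. apply (continuous_minus (V := R_NormedModule)); [apply continuous_const|].
    unfold Rdiv. apply (continuous_mult (K := R_AbsRing)); [apply continuous_id|apply continuous_const]. }
  assert (Hc : forall c a b, ex_RInt (V := CR) (fun x => g x * RtoC (c - x / (2 * PI)))%C a b).
  { intros c a b. apply (ex_RInt_continuous (V := CR)). intros x _.
    apply (continuous_Cmult g (fun x => RtoC (c - x / (2 * PI)))); auto. apply RtoC_continuous, Hl. }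
  apply (ex_RInt_Chasles (V := CR)) with (thd j).
  - apply (ex_RInt_ext (V := CR)) with (2 := Hc 0 0 (thd j)).
    intros x Hx. rewrite Rmin_left, Rmax_right in Hx by lra.
    unfold G_gen, H_step, R_ramp. rewrite par_spec by (auto; lra).
    destruct (Rle_dec x (thd j)); [reflexivity|lra].
  - apply (ex_RInt_ext (V := CR)) with (2 := Hc 1 (thd j) (2 * PI)).
    intros x Hx. rewrite Rmin_left, Rmax_right in Hx by lra.
    unfold G_gen, H_step, R_ramp. rewrite par_spec by (auto; lra).
    destruct (Rle_dec x (thd j)); [lra|reflexivity].
Qed.

(** Removing the steps leaves the continuous [C_part], so integrability reduces to the continuous
    case and to [J_part]. *)
Lemma admissible_in_X gam nd thd s v : is_contour gam -> is_jump_set nd thd -> 0 < s <= 1 ->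
  in_X gam nd thd s v -> admissible gam v.
Proof.
  intros H Hj Hs Hv. apply admissible_ext with (fun t => C_part gam nd thd v t + J_part gam nd thd v t)%C.
  - intros x. unfold C_part. ring.
  - apply admissible_plus; [|apply admissible_J_part; auto].
    apply admissible_continuous. destruct (C_part_holder gam nd thd H Hj s Hs) as [K [_ HK]].
    destruct (HK v Hv) as [Hh _]. eapply holder_continuous; [|exact Hh]. lra.
Qed.

(** * The integral operator *)

Section IntegralOperator.

Variables (gam : R -> C) (k : C -> C -> C) (mu : R).
Hypothesis Hgam : is_contour gam.
Hypothesis Hk : kernel_regular gam k mu.

Lemma a_ker_continuous x th : ccontinuous (a_ker gam k (gam x)) th.
Proof.
  destruct Hk as [M0 [Mmu [om [Hom [_ [_ H]]]]]].
  destruct (speed_bounds _ Hgam) as [c [L [Hc [HL HcL]]]].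
  assert (Hlip := gam_lipschitz gam L Hgam (fun x => proj2 (HcL x))).
  apply (continuous_Cmult (fun th => k (gam x) (gam th)) (dgam gam)); [|apply dgam_continuous; auto].
  apply continuous_C. intros eps He.
  apply (filterlim_locally (U := R_UniformSpace)) with (eps := mkposreal eps He) in Hom.
  destruct Hom as [d Hd]. exists (d / L). split; [apply Rdiv_lt_0_compat; [apply d|auto]|].
  intros y Hy.
  (* Smallness of the modulus of continuity is known only at positive arguments, so coinciding
     points are treated apart. *)
  destruct (Ceq_dec (gam y) (gam th)) as [->|E].
  { rewrite Cmod_sub_refl. auto. }
  eapply Rle_lt_trans; [apply H; eexists; reflexivity|].
  assert (Hp : 0 < Cmod (gam y - gam th)%C).
  { apply Cmod_gt_0. intros F. apply E. apply Cmod_sub_eq0. rewrite F. apply Cmod_0. }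
  assert (Hlt : Cmod (gam y - gam th)%C < d).
  { eapply Rle_lt_trans; [apply Hlip|].
    replace (pos d) with (L * (d / L)) by (field; lra). apply Rmult_lt_compat_l; auto. }
  assert (B : ball 0 d (Cmod (gam y - gam th)%C)).
  { apply Rabs_def1; unfold minus, plus, opp; simpl; lra. }
  specialize (Hd _ B Hp). apply Rabs_def2 in Hd. unfold minus, plus, opp in Hd; simpl in Hd. lra.
Qed.

Lemma a_ker_bounds : 0 < mu -> exists M, 0 <= M /\ (forall x th, Cmod (a_ker gam k (gam x) th) <= M) /\
  forall th, holder mu M (fun x => a_ker gam k (gam x) th).
Proof.
  intros Hmu. destruct Hk as [M0 [Mmu [om [_ [H1 [H2 _]]]]]].
  destruct (speed_bounds _ Hgam) as [c [L [Hc [HL HcL]]]].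
  assert (Hlip := gam_lipschitz gam L Hgam (fun x => proj2 (HcL x))).
  assert (HM0 : 0 <= M0).
  { eapply Rle_trans; [apply Cmod_ge_0|]. apply (H1 (gam 0) (gam 0)); eexists; reflexivity. }
  generalize (Rmax_r Mmu 0) (Rmax_l Mmu 0) (Rpower_pos L mu); intros.
  assert (HP : 0 <= Rmax Mmu 0 * Rpower L mu * L).
  { apply Rmult_le_pos; [apply Rmult_le_pos|]; lra. }
  assert (HP2 : 0 <= M0 * L) by (apply Rmult_le_pos; lra).
  exists (M0 * L + Rmax Mmu 0 * Rpower L mu * L).
  split; [lra|]. split.
  - intros x th. unfold a_ker. rewrite Cmod_mult.
    apply Rle_trans with (M0 * L); [|lra]. apply Rmult_le_compat; try apply Cmod_ge_0; [|apply HcL].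
    apply H1; eexists; reflexivity.
  - intros th x y Hxy. unfold a_ker.
    replace (_ - _)%C with ((k (gam x) (gam th) - k (gam y) (gam th)) * dgam gam th)%C by ring.
    rewrite Cmod_mult.
    apply Rle_trans with ((Rmax Mmu 0 * Rpower L mu * L) * Rpower (y - x) mu).
    2:{ apply Rmult_le_compat_r; [left; apply Rpower_pos|lra]. }
    replace (Rmax Mmu 0 * Rpower L mu * L * Rpower (y - x) mu)
      with ((Rmax Mmu 0 * (Rpower L mu * Rpower (y - x) mu)) * L) by ring.
    apply Rmult_le_compat; try apply Cmod_ge_0; [|apply HcL].
    destruct (Ceq_dec (gam x) (gam y)) as [->|E].
    { rewrite Cmod_sub_refl. apply Rmult_le_pos; auto. apply Rmult_le_pos; left; apply Rpower_pos. }
    eapply Rle_trans; [apply H2; eexists; reflexivity|].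
    apply Rmult_le_compat; auto.
    + assert (A := H2 (gam x) (gam y) (gam th) (on_contour_param _ _) (on_contour_param _ _)
      (on_contour_param _ _)).
      generalize (Cmod_ge_0 (k (gam x) (gam th) - k (gam y) (gam th))%C) (Rpower_pos (Cmod (gam x - gam y)%C)
        mu). nra.
    + left; apply Rpower_pos.
    + rewrite Rpower_mult_distr by lra. apply Rpower_le_base; [lra|]. split.
      * apply Cmod_gt_0. intros F. apply E. apply Cmod_sub_eq0. rewrite F. apply Cmod_0.
      * generalize (Hlip x y). rewrite Rabs_left by lra. intros. replace (y - x) with (- (x - y)) by ring. auto.
Qed.

Lemma K_op_is_RInt v x : admissible gam v ->
  is_RInt (V := CR) (fun th => a_ker gam k (gam x) th * v (gam th))%C 0 (2 * PI) (K_op gam k v (gam x)).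
Proof.
  intros Hv. apply (RInt_correct (V := CR)). apply Hv. intros; apply a_ker_continuous.
Qed.

Lemma K_op_minus u v x : admissible gam u -> admissible gam v ->
  K_op gam k (fun t => u t - v t)%C (gam x) = (K_op gam k u (gam x) - K_op gam k v (gam x))%C.
Proof.
  intros Hu Hv. apply (is_RInt_unique (V := CR)).
  eapply (is_RInt_ext (V := CR)); [|apply is_RInt_Cminus;
    [apply (K_op_is_RInt u x Hu)|apply (K_op_is_RInt v x Hv)]].
  intros th _. cring.
Qed.

Lemma K_op_plus u v x : admissible gam u -> admissible gam v ->
  K_op gam k (fun t => u t + v t)%C (gam x) = (K_op gam k u (gam x) + K_op gam k v (gam x))%C.
Proof.
  intros Hu Hv. apply (is_RInt_unique (V := CR)).
  eapply (is_RInt_ext (V := CR)); [|apply is_RInt_Cplus;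
    [apply (K_op_is_RInt u x Hu)|apply (K_op_is_RInt v x Hv)]].
  intros th _. cring.
Qed.

Lemma K_op_scal c u x : admissible gam u ->
  K_op gam k (fun t => c * u t)%C (gam x) = (c * K_op gam k u (gam x))%C.
Proof.
  intros Hu. apply (is_RInt_unique (V := CR)).
  eapply (is_RInt_ext (V := CR)); [|apply is_RInt_Cmult; apply (K_op_is_RInt u x Hu)].
  intros th _. cring.
Qed.

(** The smoothing property behind all compactness: a uniform bound of [v] alone controls the
    mu-Hoelder constant of its image, because the kernel is mu-Hoelder in its first variable
    uniformly in the second. *)
Lemma K_op_bounds : 0 < mu -> exists M, 0 <= M /\ forall v B, admissible gam v ->
  bounded_by B (fun x => v (gam x)) ->
  bounded_by (M * B) (fun x => K_op gam k v (gam x)) /\ holder mu (M * B) (fun x => K_op gam k v (gam x)).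
Proof.
  intros Hmu. generalize PI_RGT_0; intros HP. destruct (a_ker_bounds Hmu) as [M [HM [H1 H2]]].
  exists (2 * PI * M). split; [apply Rmult_le_pos; lra|]. intros v B Hv Hb.
  assert (HB := bounded_by_pos _ _ Hb). split.
  - intros x. replace (2 * PI * M * B) with ((2 * PI - 0) * (M * B)) by ring.
    eapply is_RInt_C_bound; [lra| |apply K_op_is_RInt, Hv].
    intros th _. simpl. rewrite Cmod_mult. apply Rmult_le_compat; try apply Cmod_ge_0; [apply H1|apply Hb].
  - intros x y Hxy. replace (2 * PI * M * B * Rpower (y - x) mu) with ((2 * PI - 0) * (M * Rpower (y - x)
    mu * B)) by ring.
    eapply is_RInt_C_bound; [lra| |apply is_RInt_Cminus; apply K_op_is_RInt, Hv].
    intros th _. simpl.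
    replace (_ - _)%C with ((a_ker gam k (gam x) th - a_ker gam k (gam y) th) * v (gam th))%C by ring.
    rewrite Cmod_mult. apply Rmult_le_compat; try apply Cmod_ge_0; [apply (H2 th x y Hxy)|apply Hb].
Qed.

End IntegralOperator.

(** * Stability of the continuous equation by compactness *)

Lemma archimed_inv C eps : 0 <= C -> 0 < eps -> exists j, forall l, (j <= l)%nat -> C * / INR (S l) < eps.
Proof.
  intros HC He. destruct (INR_unbounded (C / eps)) as [j Hj]. exists j. intros l Hl.
  assert (INR j < INR (S l)) by (apply lt_INR; lia).
  assert (0 < INR (S l)) by (apply lt_0_INR; lia).
  apply Rmult_lt_reg_r with (INR (S l)); auto. rewrite Rmult_assoc, Rinv_l, Rmult_1_r by lra.
  assert (E : C = C / eps * eps) by (field; lra). rewrite E. set (q := C / eps) in *.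
  rewrite (Rmult_comm eps). apply Rmult_lt_compat_r; lra.
Qed.

Lemma Rle_all_inv a b C : (forall j, a <= b + C * / INR (S j)) -> a <= b.
Proof.
  intros H. apply le_epsilon. intros eps He.
  destruct (archimed_inv (Rmax C 0) eps (Rmax_r _ _) He) as [j Hj]. specialize (Hj j (le_n j)).
  specialize (H j).
  assert (0 < / INR (S j)) by (apply Rinv_0_lt_compat, lt_0_INR; lia).
  generalize (Rmax_l C 0). nra.
Qed.

Section Stability.

Variables (gam : R -> C) (nd : nat) (thd : nat -> R) (k : C -> C -> C) (lam : C) (mu beta : R).
Hypothesis Hgam : is_contour gam.
Hypothesis Hj : is_jump_set nd thd.
Hypothesis Hk : kernel_regular gam k mu.
Hypothesis Hexp : 0 < beta <= mu.
Hypothesis Hker : forall v, in_X gam nd thd beta v ->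
     solves_eq gam k lam (fun _ => RtoC 0) v -> eq_on gam v (fun _ => RtoC 0).

(** If [S n] fails as a stability constant, the supremum of [v] exceeds [INR (S n) * d]; dividing
    [v] by it leaves a residual of at most [/ INR (S n)]. *)
Lemma stability_normalize v M d (n : nat) : admissible gam v -> bounded_by M (fun x => v (gam x)) ->
  bounded_by d (fun x => v (gam x) - lam * K_op gam k v (gam x))%C ->
  ~ bounded_by (INR (S n) * d) (fun x => v (gam x)) ->
  exists w, admissible gam w /\ bounded_by 1 (fun x => w (gam x)) /\
    bounded_by (/ INR (S n)) (fun x => w (gam x) - lam * K_op gam k w (gam x))%C /\
    exists x, / 2 <= Cmod (w (gam x)).
Proof.
  intros Hv HM Hd Hn.
  destruct (completeness (fun r => exists x, r = Cmod (v (gam x)))) as [S [HS1 HS2]].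
  { exists M. intros r [x ->]. apply HM. }
  { exists (Cmod (v (gam 0))). exists 0. auto. }
  apply not_all_ex_not in Hn. destruct Hn as [x0 Hx0]. apply Rnot_le_lt in Hx0.
  assert (Hd0 := bounded_by_pos _ _ Hd).
  assert (Hin : 0 < INR (Datatypes.S n)) by (apply lt_0_INR; lia).
  assert (HS0 : INR (Datatypes.S n) * d < S).
  { eapply Rlt_le_trans; [exact Hx0|]. apply HS1. exists x0; auto. }
  assert (HSp : 0 < S) by nra.
  exists (fun t => RtoC (/ S) * v t)%C. split; [apply admissible_scal; auto|].
  assert (HiS : 0 < / S) by (apply Rinv_0_lt_compat; auto).
  split; [|split].
  - intros x. rewrite Cmod_mult, Cmod_R, Rabs_right by lra.
    rewrite <- (Rinv_l S) by lra. apply Rmult_le_compat_l; [lra|]. apply HS1. exists x; auto.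
  - intros x. rewrite (K_op_scal gam k mu) by auto.
    replace (_ - _)%C with (RtoC (/ S) * (v (gam x) - lam * K_op gam k v (gam x)))%C by ring.
    rewrite Cmod_mult, Cmod_R, Rabs_right by lra.
    apply Rle_trans with (/ S * d); [apply Rmult_le_compat_l; [lra|apply Hd]|].
    apply Rmult_le_reg_l with S; auto. rewrite <- Rmult_assoc, Rinv_r, Rmult_1_l by lra.
    apply Rmult_le_reg_r with (INR (Datatypes.S n)); auto. rewrite Rmult_assoc, Rinv_l by lra. lra.
  (* The supremum need not be attained, whence one half instead of 1. *)
  - apply NNPP. intros Hno. assert (S <= S / 2); [|lra].
    apply HS2. intros r [x ->]. apply Rnot_lt_le. intros Hlt. apply Hno. exists x.
    rewrite Cmod_mult, Cmod_R, Rabs_right by lra.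
    apply Rmult_le_reg_l with S; auto. rewrite <- Rmult_assoc, Rinv_r, Rmult_1_l by lra. lra.
Qed.

(** The functions [w n] are merely bounded and integrable; convergence is obtained for their images
    under [K] and carried back by writing [w] as its residual plus [lam] times its image. The
    conclusion contradicts the lower bound [/ 2] of [stability_normalize]. *)
Lemma no_unit_approximate_kernel (w : nat -> C -> C) :
  (forall n, admissible gam (w n)) -> (forall n, bounded_by 1 (fun x => w n (gam x))) ->
  (forall n, bounded_by (/ INR (S n)) (fun x => w n (gam x) - lam * K_op gam k (w n) (gam x))%C) ->
  exists n, forall x, Cmod (w n (gam x)) < / 2.
Proof.
  intros Ha Hb Hr.
  destruct (K_op_bounds gam k mu Hgam Hk ltac:(lra)) as [MK [HMK HK]].
  set (z := fun n x => K_op gam k (w n) (gam x)).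
  destruct (equi_holder_subsequence z mu (MK * 1) ltac:(lra)) as [phi [Hphi Hz]].
  { intros n. apply (pullback_periodic gam (K_op gam k (w n)) Hgam). }
  { intros n. apply (HK (w n) 1); auto. }
  { intros n. apply (HK (w n) 1); auto. }
  (* Two residuals and [Cmod lam] times the oscillation of [z] along the subsequence, each of size
     [/ INR (S j)]. *)
  set (D := 2 + Cmod lam).
  assert (HD : 0 <= D) by (unfold D; generalize (Cmod_ge_0 lam); lra).
  assert (Hr' : forall j x, Cmod (w (phi j) (gam x) - lam * z (phi j) x)%C <= / INR (S j)).
  { intros j x. eapply Rle_trans; [apply Hr|]. apply Rinv_le_contravar; [apply lt_0_INR; lia|].
    apply le_INR. generalize (Hphi j). lia. }
  assert (Hcau : forall j l, (j <= l)%nat ->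
    forall x, Cmod (w (phi j) (gam x) - w (phi l) (gam x))%C <= D * / INR (S j)).
  { intros j l Hjl x.
    replace (w (phi j) (gam x) - w (phi l) (gam x))%C with
      ((w (phi j) (gam x) - lam * z (phi j) x) +
        lam * (z (phi j) x - z (phi l) x) - (w (phi l) (gam x) - lam * z (phi l) x))%C by ring.
    eapply Rle_trans; [apply Cmod_sub_le|]. eapply Rle_trans; [apply Rplus_le_compat_r, Cmod_triangle|].
    rewrite Cmod_mult. unfold D.
    assert (/ INR (S l) <= / INR (S j)). { apply Rinv_le_contravar; [apply lt_0_INR; lia|]. apply le_INR; lia. }
    generalize (Hr' j x) (Hr' l x) (Rmult_le_compat_l _ _ _ (Cmod_ge_0 lam) (Hz j l Hjl x)). lra. }
  assert (Hlim : forall t, exists l : C, on_contour gam t ->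
    forall j, Cmod (w (phi j) t - l)%C <= D * / INR (S j)).
  { intros t. destruct (excluded_middle_informative (on_contour gam t)) as [[x <-]|Hno].
    2:{ exists (RtoC 0). tauto. }
    assert (E : exists y : CR, filterlim (fun j => w (phi j) (gam x) : CR) eventually (locally y)).
    { apply (filterlim_locally_cauchy (U := CR)). intros eps.
      destruct (archimed_inv D (eps / 2) HD) as [j0 Hj0]. { generalize (cond_pos eps); lra. }
      exists (fun j => (j0 <= j)%nat). split; [exists j0; auto|].
      intros u v Hu Hv. apply (norm_compat1 (V := CR)).
      unfold minus. change (plus (w (phi v) (gam x) : CR) (opp (w (phi u) (gam x) : CR))) with (w (phi v)
        (gam x) - w (phi u) (gam x))%C.
      rewrite <- Cmod_norm.
      generalize (Cmod_sub_triangle (w (phi v) (gam x)) (w (phi j0) (gam x)) (w (phi u) (gam x))).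
      generalize (Hcau j0 u Hu x) (Hcau j0 v Hv x).
      rewrite (Cmod_sub_sym (w (phi v) (gam x)) (w (phi j0) (gam x))).
      generalize (Hj0 j0 (le_n _)). lra. }
    destruct E as [l Hl]. exists l. intros _ j. apply le_epsilon. intros eps He.
    destruct (proj1 (filterlim_C (fun j => w (phi j) (gam x)) l) Hl eps He) as [j0 Hj0].
    specialize (Hj0 (max j j0) ltac:(lia)).
    generalize (Hcau j (max j j0) ltac:(lia) x) (Cmod_sub_triangle (w (phi j) (gam x)) (w (phi (max j j0))
      (gam x)) l). lra. }
  set (V := fun t => proj1_sig (constructive_indefinite_description _ (Hlim t))).
  assert (HV : forall j x, Cmod (w (phi j) (gam x) - V (gam x))%C <= D * / INR (S j)).
  { intros j x. unfold V. destruct (constructive_indefinite_description _ (Hlim (gam x))) as [l Hl]. apply Hl.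
    exists x; auto. }
  (* The limit inherits the Hoelder constant of [lam * z]: the residuals at [x] and [y] contribute 2
     and the distances to [V] contribute [2 * D], all of which vanish with [j]. Hence [V] is regular
     enough for the kernel hypothesis. *)
  assert (HVh : holder mu (Cmod lam * (MK * 1)) (fun x => V (gam x))).
  { intros x y Hxy. apply Rle_all_inv with (2 * D + 2). intros j.
    replace (V (gam x) - V (gam y))%C with
      ((w (phi j) (gam x) - lam * z (phi j) x) - (w (phi j) (gam x) - V (gam x)) +
        lam * (z (phi j) x - z (phi j) y)
       - ((w (phi j) (gam y) - lam * z (phi j) y) - (w (phi j) (gam y) - V (gam y))))%C by ring.
    eapply Rle_trans; [apply Cmod_sub_le|].
    eapply Rle_trans; [apply Rplus_le_compat; [apply Cmod_triangle|apply Cmod_sub_le]|].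
    eapply Rle_trans; [apply Rplus_le_compat_r, Rplus_le_compat_r, Cmod_sub_le|].
    rewrite Cmod_mult.
    assert (A : Cmod (z (phi j) x - z (phi j) y)%C <= MK * 1 * Rpower (y - x) mu) by (apply (HK (w (phi j)) 1);
      auto).
    generalize (Hr' j x) (Hr' j y) (HV j x) (HV j y) (Rmult_le_compat_l _ _ _ (Cmod_ge_0 lam) A). lra. }
  assert (HVb : bounded_by (1 + D) (fun x => V (gam x))).
  { intros x. replace (V (gam x)) with (w (phi 0%nat) (gam x) - (w (phi 0%nat) (gam x) - V (gam x)))%C by ring.
    eapply Rle_trans; [apply Cmod_sub_le|]. generalize (Hb (phi 0%nat) x) (HV 0%nat x). simpl. lra. }
  assert (HVc : admissible gam V).
  { apply admissible_continuous. eapply holder_continuous; [|exact HVh]. lra. }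
  assert (HVX : in_X gam nd thd beta V).
  { destruct (X_norm_le_holder gam nd thd Hgam Hj beta ltac:(lra)) as [K [_ HX]].
    set (E := Cmod lam * (MK * 1) + 2 * (1 + D)).
    assert (0 <= Cmod lam * (MK * 1)) by (apply Rmult_le_pos; [apply Cmod_ge_0|lra]).
    apply (HX V E).
    - unfold E. apply holder_exponent with mu; auto. lra.
    - intros x. generalize (HVb x). unfold E. lra. }
  assert (HV0 : forall x, V (gam x) = RtoC 0).
  { intros x. apply (Hker V HVX); [|exists x; auto].
    intros t [y <-]. apply Cmod_eq_0, Rle_antisym; [|apply Cmod_ge_0].
    apply Rle_all_inv with (D + 1 + Cmod lam * (MK * D)). intros j.
    destruct (HK (fun t => w (phi j) t - V t)%C (D * / INR (S j)) (admissible_minus _ _ _ (Ha _) HVc) (HV j))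
      as [HKd _].
    specialize (HKd y). cbv beta in HKd. rewrite (K_op_minus gam k mu) in HKd by auto.
    fold (z (phi j) y) in HKd.
    replace (V (gam y) - lam * K_op gam k V (gam y))%C with
      ((w (phi j) (gam y) - lam * z (phi j) y) +
        lam * (z (phi j) y - K_op gam k V (gam y)) - (w (phi j) (gam y) - V (gam y)))%C by ring.
    eapply Rle_trans; [apply Cmod_sub_le|]. eapply Rle_trans; [apply Rplus_le_compat_r, Cmod_triangle|].
    rewrite Cmod_mult.
    generalize (Hr' j y) (HV j y) (Rmult_le_compat_l _ _ _ (Cmod_ge_0 lam) HKd). lra. }
  destruct (archimed_inv D (/ 2) HD ltac:(lra)) as [j Hjj]. exists (phi j). intros x.
  generalize (HV j x) (Hjj j (le_n _)). rewrite HV0.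
  replace (w (phi j) (gam x) - 0)%C with (w (phi j) (gam x)) by ring. lra.
Qed.

(** The bound [M] only makes the supremum of [v] finite; [A] does not depend on it. This is what
    allows one constant for [phi] and for splines on every mesh. *)
Lemma continuous_stability : exists A, 0 <= A /\ forall v M d, admissible gam v ->
  bounded_by M (fun x => v (gam x)) ->
  bounded_by d (fun x => v (gam x) - lam * K_op gam k v (gam x))%C ->
  bounded_by (A * d) (fun x => v (gam x)).
Proof.
  apply NNPP. intros Hno.
  assert (H : forall n, exists w, admissible gam w /\ bounded_by 1 (fun x => w (gam x)) /\
    bounded_by (/ INR (S n)) (fun x => w (gam x) - lam * K_op gam k w (gam x))%C /\
    exists x, / 2 <= Cmod (w (gam x))).
  { intros n. apply NNPP. intros Hn. apply Hno. exists (INR (S n)). split; [apply pos_INR|].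
    intros v M d H1 H2 H3. apply NNPP. intros H4. apply Hn. eapply stability_normalize; eauto. }
  set (w := fun n => proj1_sig (constructive_indefinite_description _ (H n))).
  assert (Hw : forall n, admissible gam (w n) /\ bounded_by 1 (fun x => w n (gam x)) /\
    bounded_by (/ INR (S n)) (fun x => w n (gam x) - lam * K_op gam k (w n) (gam x))%C /\
    exists x, / 2 <= Cmod (w n (gam x))).
  { intros n. unfold w. destruct (constructive_indefinite_description _ (H n)); auto. }
  destruct (no_unit_approximate_kernel w) as [n Hn]; try apply Hw.
  destruct (Hw n) as [_ [_ [_ [x Hx]]]]. generalize (Hn x). lra.
Qed.

End Stability.

(** * Square linear systems *)

Lemma csum_app (f : nat -> C) a b : csum f 1 (a + b) =
  (csum f 1 a + csum (fun i => f (a + i)%nat) 1 b)%C.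
Proof.
  induction b as [|b IH].
  - rewrite csum_0, Nat.add_0_r. cring.
  - rewrite Nat.add_succ_r, !csum_S, IH, Nat.add_succ_r. cring.
Qed.

Lemma csum_zero (f : nat -> C) n : (forall i, (1 <= i <= n)%nat -> f i = RtoC 0) ->
  csum f 1 n = RtoC 0.
Proof.
  induction n as [|n IH]; intros H; [apply csum_0|].
  rewrite csum_S, IH, H by (try lia; intros; apply H; lia). cring.
Qed.

Definition skip (j0 j : nat) : nat := if Nat.ltb j j0 then j else S j.

Lemma csum_skip (f : nat -> C) j0 n : (1 <= j0 <= S n)%nat ->
  csum f 1 (S n) =
  (f j0 + csum (fun j => f (skip j0 j)) 1 n)%C.
Proof.
  induction n as [|n IH]; intros H.
  - assert (j0 = 1%nat) as -> by lia. rewrite csum_S, !csum_0. cring.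
  - rewrite csum_S. destruct (Nat.eq_dec j0 (S (S n))) as [->|Hn].
    + rewrite Cplus_comm. f_equal. apply csum_ext. intros i Hi. unfold skip.
      destruct (Nat.ltb_spec i (S (S n))); [reflexivity|lia].
    + rewrite IH by lia. rewrite csum_S. unfold skip at 3.
      destruct (Nat.ltb_spec (S n) j0); [lia|]. cring.
Qed.

(** Gaussian elimination on the last equation: if its row vanishes, the last unknown is set to [0];
    otherwise a pivot [j0] is eliminated from the other rows and recovered from the last equation as
    [t]. *)
Lemma underdetermined_system n : forall a : nat -> nat -> C, exists c : nat -> C,
  (exists j, (1 <= j <= S n)%nat /\ c j <> RtoC 0) /\
  forall i, (1 <= i <= n)%nat -> csum (fun j => a i j * c j)%C 1 (S n) = RtoC 0.
Proof.
  induction n as [|n IH]; intros a.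
  - exists (fun _ => RtoC 1). split; [|intros; lia]. exists 1%nat. split; [lia|]. apply C1_nz.
  - assert (D : (forall j, (1 <= j <= S (S n))%nat ->
    a (S n) j = RtoC 0) \/ exists j, (1 <= j <= S (S n))%nat /\ a (S n) j <> RtoC 0).
    { generalize (S (S n)). intros k. induction k as [|k IHk]; [left; intros; lia|].
      destruct IHk as [h|[j [h1 h2]]]; [|right; exists j; split; [lia|auto]].
      destruct (Ceq_dec (a (S n) (S k)) (RtoC 0)) as [e|e].
      - left. intros j Hj. destruct (Nat.eq_dec j (S k)) as [->|]; auto. apply h; lia.
      - right. exists (S k). split; [lia|auto]. }
    destruct D as [D|[j0 [Hj0 Hne]]].
    + destruct (IH a) as [c [[j [Hj Hcj]] Hc]].
      exists (fun j => if Nat.leb j (S n) then c j else RtoC 0). split.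
      * exists j. split; [lia|]. destruct (Nat.leb_spec j (S n)); [auto|lia].
      * intros i Hi. destruct (Nat.eq_dec i (S n)) as [->|Hin].
        -- apply csum_zero. intros l Hl. rewrite D by lia. ring.
        -- rewrite csum_S. destruct (Nat.leb_spec (S (S n)) (S n)); [lia|].
           rewrite (csum_ext _ (fun j => a i j * c j)%C).
           { rewrite Hc by lia. cring. }
           intros l Hl. destruct (Nat.leb_spec l (S n)); [reflexivity|lia].
    + set (a' := fun i j => (a i (skip j0 j) - a i j0 * (a (S n) (skip j0 j) / a (S n) j0))%C).
      destruct (IH a') as [c' [[j [Hj Hcj]] Hc]].
      set (t := (- (csum (fun j => a (S n) (skip j0 j) * c' j) 1 (S n)) / a (S n) j0)%C).
      set (c := fun j => if Nat.eqb j j0 then t else if Nat.ltb j j0 then c' j else c' (pred j)).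
      assert (Hcs : forall j, c (skip j0 j) = c' j).
      { intros l. unfold c, skip. destruct (Nat.ltb_spec l j0).
        - destruct (Nat.eqb_spec l j0); [lia|]. destruct (Nat.ltb_spec l j0); [auto|lia].
        - destruct (Nat.eqb_spec (S l) j0); [lia|]. destruct (Nat.ltb_spec (S l) j0); [lia|auto]. }
      assert (Hct : c j0 = t) by (unfold c; rewrite Nat.eqb_refl; auto).
      exists c. split.
      * exists (skip j0 j). split; [unfold skip; destruct (Nat.ltb_spec j j0); lia|]. rewrite Hcs; auto.
      * intros i Hi. rewrite (csum_skip _ j0) by lia. rewrite Hct.
        rewrite (csum_ext _ (fun j => a i (skip j0 j) * c' j)%C) by (intros; rewrite Hcs; auto).
        destruct (Nat.eq_dec i (S n)) as [->|Hin].
        -- unfold t. sum_in_C. field. auto.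
        -- rewrite <- (Hc i ltac:(lia)). unfold a', t.
           rewrite (csum_ext (fun j => (a i (skip j0 j) - a i j0 * (a (S n) (skip j0 j) / a (S n) j0)) * c' j)%C
             (fun j => a i (skip j0 j) * c' j - (a i j0 / a (S n) j0) * (a (S n) (skip j0 j) * c' j))%C).
           2:{ intros l Hl. field. auto. }
           rewrite csum_minus, csum_mult. sum_in_C. field. auto.
Qed.

(** With [- b] appended as one more column the system has a nontrivial solution; by injectivity its
    last entry is nonzero, and dividing by it solves the original system. *)
Lemma injective_system_solvable n (A : nat -> nat -> C) :
  (forall c, (forall i, (1 <= i <= n)%nat -> csum (fun j => A i j * c j)%C 1 n = RtoC 0) ->
     forall j, (1 <= j <= n)%nat -> c j = RtoC 0) ->
  forall b, exists c, forall i, (1 <= i <= n)%nat -> csum (fun j => A i j * c j)%C 1 n = b i.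
Proof.
  intros H b.
  destruct (underdetermined_system n (fun i j => if Nat.leb j n then A i j else (- b i)%C))
    as [c [[j [Hj Hcj]] Hc]].
  assert (Hc' : forall i, (1 <= i <= n)%nat -> csum (fun j => A i j * c j)%C 1 n = (b i * c (S n))%C).
  { intros i Hi. specialize (Hc i Hi). rewrite csum_S in Hc. destruct (Nat.leb_spec (S n) n); [lia|].
    rewrite (csum_ext _ (fun j => A i j * c j)%C) in Hc.
    2:{ intros l Hl. destruct (Nat.leb_spec l n); [reflexivity|lia]. }
    assert (E : forall s x y : C, (s + (- x) * y)%C = RtoC 0 -> s = (x * y)%C).
    { intros s x y Es. replace s with ((s + (- x) * y) + x * y)%C by ring. rewrite Es. ring. }
    apply E. exact Hc. }
  destruct (Ceq_dec (c (S n)) (RtoC 0)) as [e|e].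
  - exfalso. apply Hcj. destruct (Nat.eq_dec j (S n)) as [->|]; auto.
    apply H; [|lia]. intros i Hi. rewrite Hc', e by auto. cring.
  - exists (fun j => c j / c (S n))%C. intros i Hi.
    rewrite (csum_ext _ (fun j => (/ c (S n)) * (A i j * c j))%C) by (intros; field; auto).
    rewrite csum_mult, Hc' by auto. sum_in_C; field. auto.
Qed.

(** * Cardinal splines *)

Lemma cardinal_spline_2 x : cardinal_spline 2 x = Rmax 0 (x + 1) - 2 * Rmax 0 x + Rmax 0 (x - 1).
Proof.
  unfold cardinal_spline, Binomial.C. simpl sum_f_R0. simpl fact. simpl INR.
  replace (x + (1 + 1) / 2 - 0) with (x + 1) by field. replace (x + (1 + 1) / 2 - 1) with x by field.
  replace (x + (1 + 1) / 2 - (1 + 1)) with (x - 1) by field.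
  simpl. field.
Qed.

Lemma cardinal_spline_3 x : cardinal_spline 3 x = / 2 * (Rmax 0 (x + 3 / 2) ^ 2 - 3 * Rmax 0 (x + / 2) ^ 2
  + 3 * Rmax 0 (x - / 2) ^ 2 - Rmax 0 (x - 3 / 2) ^ 2).
Proof.
  unfold cardinal_spline, Binomial.C. simpl sum_f_R0. simpl fact. simpl INR.
  replace (x + (1 + 1 + 1) / 2 - 0) with (x + 3 / 2) by field.
  replace (x + (1 + 1 + 1) / 2 - 1) with (x + / 2) by field.
  replace (x + (1 + 1 + 1) / 2 - (1 + 1)) with (x - / 2) by field.
  replace (x + (1 + 1 + 1) / 2 - (1 + 1 + 1)) with (x - 3 / 2) by field.
  simpl. field.
Qed.

Lemma cardinal_spline_4 x : cardinal_spline 4 x = / 6 * (Rmax 0 (x + 2) ^ 3 - 4 * Rmax 0 (x + 1) ^ 3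
  + 6 * Rmax 0 x ^ 3 - 4 * Rmax 0 (x - 1) ^ 3 + Rmax 0 (x - 2) ^ 3).
Proof.
  unfold cardinal_spline, Binomial.C. simpl sum_f_R0. simpl fact. simpl INR.
  replace (x + (1 + 1 + 1 + 1) / 2 - 0) with (x + 2) by field.
  replace (x + (1 + 1 + 1 + 1) / 2 - 1) with (x + 1) by field.
  replace (x + (1 + 1 + 1 + 1) / 2 - (1 + 1)) with x by field.
  replace (x + (1 + 1 + 1 + 1) / 2 - (1 + 1 + 1)) with (x - 1) by field.
  replace (x + (1 + 1 + 1 + 1) / 2 - (1 + 1 + 1 + 1)) with (x - 2) by field.
  simpl. field.
Qed.

Section CardinalSpline.

Variable m : nat.
Hypothesis Hm : m = 2%nat \/ m = 3%nat \/ m = 4%nat.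

Ltac spl_cases := destruct Hm as [->|[->| ->]];
  [rewrite ?cardinal_spline_2|rewrite ?cardinal_spline_3|rewrite ?cardinal_spline_4].

Lemma cardinal_spline_support x : 2 <= Rabs x -> cardinal_spline m x = 0.
Proof.
  intros Hx. assert (H : x <= -2 \/ 2 <= x).
  { unfold Rabs in Hx. destruct (Rcase_abs x); lra. }
  destruct H as [H|H].
  - spl_cases; rewrite !Rmax_left by lra; ring.
  - spl_cases; rewrite !Rmax_right by lra; field.
Qed.

(** These values are the rows of the collocation matrix. The excess [b0 - 2 * b1] equals 1, 1/2 and
    1/3 for the orders 2, 3 and 4; its positivity makes interpolation stable uniformly in [n]. *)
Lemma cardinal_spline_nodes : exists b0 b1, 0 <= b1 /\ / 3 <= b0 - 2 * b1 /\
  cardinal_spline m 0 = b0 /\ cardinal_spline m 1 = b1 /\ cardinal_spline m (-1) = b1.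
Proof.
  spl_cases.
  - exists 1, 0. unfold Rmax; repeat split; try lra; repeat destruct Rle_dec; lra.
  - exists (3 / 4), (/ 8). unfold Rmax; repeat split; try lra; repeat destruct Rle_dec; lra.
  - exists (2 / 3), (/ 6). unfold Rmax; repeat split; try lra; repeat destruct Rle_dec; lra.
Qed.

Lemma cardinal_spline_partition y : 0 <= y <= 1 ->
  cardinal_spline m (y + 1) + cardinal_spline m y + cardinal_spline m (y - 1) + cardinal_spline m (y - 2) = 1.
Proof.
  intros Hy. spl_cases.
  - rewrite (Rmax_right 0 (y + 1 + 1)), (Rmax_right 0 (y + 1)), (Rmax_right 0 (y + 1 - 1)), (Rmax_right 0 y),
     (Rmax_left 0 (y - 1)), (Rmax_left 0 (y - 1 - 1)), (Rmax_left 0 (y - 2 +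
       1)), (Rmax_left 0 (y - 2)), (Rmax_left 0 (y - 2 - 1)) by lra.
    replace (y - 1 + 1) with y by ring. rewrite (Rmax_right 0 y) by lra. ring.
  (* For order 3 the sign of [y - / 2] is open on [[0, 1]]; the four truncated powers with this
     argument carry the weights -1, 3, -3, 1 and cancel. *)
  - rewrite (Rmax_right 0 (y + 1 + 3 / 2)), (Rmax_right 0 (y + 1 + / 2)), (Rmax_right 0 (y + 1 - / 2)),
      (Rmax_right 0 (y + 3 / 2)), (Rmax_right 0 (y + / 2)), (Rmax_left 0 (y - 3 / 2)),
      (Rmax_right 0 (y - 1 + 3 / 2)), (Rmax_left 0 (y - 1 - / 2)), (Rmax_left 0 (y - 1 - 3 / 2)),
      (Rmax_left 0 (y - 2 + / 2)), (Rmax_left 0 (y - 2 - / 2)), (Rmax_left 0 (y - 2 - 3 / 2)) by lra.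
    replace (y + 1 - 3 / 2) with (y - / 2) by field. replace (y - 1 + / 2) with (y - / 2) by field.
    replace (y - 2 + 3 / 2) with (y - / 2) by field. field.
  - rewrite (Rmax_right 0 (y + 1 + 2)), (Rmax_right 0 (y + 1 + 1)), (Rmax_right 0 (y + 1)), (Rmax_right 0 (y +
    1 - 1)),
     (Rmax_left 0 (y + 1 - 2)), (Rmax_right 0 (y +
       2)), (Rmax_right 0 y), (Rmax_left 0 (y - 1)), (Rmax_left 0 (y - 2)),
     (Rmax_right 0 (y - 1 + 2)), (Rmax_right 0 (y - 1 +
       1)), (Rmax_left 0 (y - 1 - 1)), (Rmax_left 0 (y - 1 - 2)),
     (Rmax_right 0 (y - 2 + 2)), (Rmax_left 0 (y - 2 +
       1)), (Rmax_left 0 (y - 2 - 1)), (Rmax_left 0 (y - 2 - 2)) by lra.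
    field.
Qed.

Lemma truncated_power_lipschitz k : exists L, 0 <= L /\ forall a x y, -2 <= a <= 2 -> -2 <= x <= 2 ->
  -2 <= y <= 2 ->
  Rabs (Rmax 0 (x + a) ^ k - Rmax 0 (y + a) ^ k) <= L * Rabs (x - y).
Proof.
  assert (B : forall a x, -2 <= a <= 2 -> -2 <= x <= 2 -> 0 <= Rmax 0 (x + a) <= 4).
  { intros a x Ha Hx. split; [apply Rmax_l|apply Rmax_lub; lra]. }
  induction k as [|k [L [HL IH]]].
  - exists 0. split; [lra|]. intros. simpl. rewrite Rminus_diag, Rabs_R0. lra.
  - exists (4 ^ k + 4 * L). split. { assert (0 <= 4 ^ k) by (apply pow_le; lra). lra. }
    intros a x y Ha Hx Hy. specialize (IH a x y Ha Hx Hy).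
    generalize (B a x Ha Hx) (B a y Ha Hy); intros Bx By.
    assert (E : Rabs (Rmax 0 (x + a) - Rmax 0 (y + a)) <= Rabs (x - y)).
    { unfold Rmax, Rabs; repeat destruct Rle_dec; repeat destruct Rcase_abs; lra. }
    set (p := Rmax 0 (x + a)) in *. set (q := Rmax 0 (y + a)) in *.
    replace (p ^ S k - q ^ S k) with ((p - q) * p ^ k + q * (p ^ k - q ^ k)) by (simpl; ring).
    eapply Rle_trans; [apply Rabs_triang|]. rewrite !Rabs_mult.
    rewrite (Rabs_right q) by lra. rewrite (Rabs_right (p ^ k)) by (apply Rle_ge, pow_le; lra).
    assert (p ^ k <= 4 ^ k) by (apply pow_incr; lra). assert (0 <= p ^ k) by (apply pow_le; lra).
    generalize (Rabs_pos (x - y)) (Rabs_pos (p - q)) (Rabs_pos (p ^ k - q ^ k)). nra.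
Qed.

Lemma cardinal_spline_lipschitz : exists L, 0 <= L /\ forall x y, -2 <= x <= 2 -> -2 <= y <= 2 ->
  Rabs (cardinal_spline m x - cardinal_spline m y) <= L * Rabs (x - y).
Proof.
  assert (T : forall c L u v d, Rabs (u - v) <= L * d -> Rabs (c * u - c * v) <= (Rabs c * L) * d).
  { intros c L u v d H. rewrite <- Rmult_minus_distr_l, Rabs_mult, Rmult_assoc. apply Rmult_le_compat_l; auto.
    apply Rabs_pos. }
  assert (A : forall L1 L2 u v u' v' d, Rabs (u - v) <= L1 * d -> Rabs (u' - v') <= L2 * d ->
    Rabs ((u + u') - (v + v')) <= (L1 + L2) * d).
  { intros. replace (u + u' - (v + v')) with ((u - v) + (u' - v')) by ring.
    eapply Rle_trans; [apply Rabs_triang|]. lra. }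
  assert (F : forall n, (n <= m)%nat -> exists L, forall x y, -2 <= x <= 2 -> -2 <= y <= 2 ->
    Rabs (sum_f_R0 (fun r => (-1) ^ r * Binomial.C m r * Rmax 0 (x + INR m / 2 - INR r) ^ (m - 1)) n -
          sum_f_R0 (fun r => (-1) ^ r * Binomial.C m r * Rmax 0 (y + INR m / 2 - INR r) ^ (m - 1)) n) <=
            L * Rabs (x - y)).
  { destruct (truncated_power_lipschitz (m - 1)) as [L0 [HL0 H0]].
    assert (G : forall r x y, (r <= m)%nat -> -2 <= x <= 2 -> -2 <= y <= 2 ->
      Rabs (Rmax 0 (x + INR m / 2 - INR r) ^ (m - 1) - Rmax 0 (y + INR m / 2 - INR r) ^ (m - 1)) <=
        L0 * Rabs (x - y)).
    { intros r x y Hr Hx Hy. unfold Rminus at 2 3.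
      replace (x + INR m / 2 - INR r) with (x + (INR m / 2 - INR r)) by ring.
      replace (y + INR m / 2 + - INR r) with (y + (INR m / 2 - INR r)) by ring.
      replace (x + INR m / 2 + - INR r) with (x + (INR m / 2 - INR r)) by ring.
      apply H0; auto. apply le_INR in Hr. generalize (pos_INR r).
      assert (INR m <= 4) by (replace 4 with (INR 4) by (simpl; ring); apply le_INR; lia). lra. }
    induction n as [|n IH]; intros Hn.
    - exists (Rabs ((-1) ^ 0 * Binomial.C m 0) * L0). intros x y Hx Hy. apply T, G; auto; lia.
    - destruct (IH ltac:(lia)) as [L1 H1]. exists (L1 + Rabs ((-1) ^ S n * Binomial.C m (S n)) * L0).
      intros x y Hx Hy. rewrite !tech5. apply A; [apply H1; auto|]. apply T, G; auto; lia. }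
  destruct (F m (le_n _)) as [L HL]. exists (Rmax 0 (Rabs (/ INR (fact (m - 1))) * L)). split; [apply Rmax_l|].
  intros x y Hx Hy. unfold cardinal_spline. eapply Rle_trans; [apply T, HL; auto|].
  apply Rmult_le_compat_r; [apply Rabs_pos|apply Rmax_r].
Qed.

End CardinalSpline.

(** * Periodic sequences and the collocation matrix *)

Lemma periodic_seq_max (d : nat -> C) n : (1 <= n)%nat -> (forall i, d (i + n)%nat = d i) ->
  exists q, forall i, Cmod (d i) <= Cmod (d q).
Proof.
  intros Hn Hd.
  assert (A : forall l, exists q, forall i, (i < S l)%nat -> Cmod (d i) <= Cmod (d q)).
  { induction l as [|l [q IH]].
    - exists 0%nat. intros i Hi. assert (i = 0%nat) as -> by lia. lra.
    - destruct (Rle_dec (Cmod (d (S l))) (Cmod (d q))) as [h|h].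
      + exists q. intros i Hi. destruct (Nat.eq_dec i (S l)) as [->|]; auto. apply IH; lia.
      + exists (S l). intros i Hi. destruct (Nat.eq_dec i (S l)) as [->|]; [lra|].
        generalize (IH i ltac:(lia)). lra. }
  destruct (A n) as [q Hq]. exists q.
  intros i. induction i as [i IH] using (well_founded_induction lt_wf).
  destruct (le_lt_dec n i) as [h|h]; [|apply Hq; lia].
  replace i with ((i - n) + n)%nat by lia. rewrite Hd. apply IH. lia.
Qed.

(** Maximum principle: at an index of maximal modulus the two neighbours are no larger, so
    [b0 - 2 * b1] times the maximum is at most [M]. *)
Lemma tridiagonal_bound (d : nat -> C) n b0 b1 M : (1 <= n)%nat -> (forall i, d (i + n)%nat = d i) ->
  0 <= b1 -> / 3 <= b0 - 2 * b1 ->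
  (forall i, Cmod (RtoC b1 * d i + RtoC b0 * d (S i) + RtoC b1 * d (S (S i)))%C <= M) ->
  forall i, Cmod (d i) <= 3 * M.
Proof.
  intros Hn Hd Hb1 Hb0 HM i. destruct (periodic_seq_max d n Hn Hd) as [q Hq].
  eapply Rle_trans; [apply Hq|].
  (* The maximal index may be [0], which has no predecessor; one period later it is a successor. *)
  assert (E : d q = d (S (q + (n - 1)))) by (replace (S (q + (n - 1))) with (q + n)%nat by lia; auto).
  set (p := (q + (n - 1))%nat) in *.
  generalize (HM p) (Hq p) (Hq (S (S p))). rewrite E. intros H1 H2 H3.
  assert (H4 : Cmod (RtoC b0 * d (S p))%C <= M + b1 * Cmod (d p) + b1 * Cmod (d (S (S p)))).
  { replace (RtoC b0 * d (S p))%C with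
      ((RtoC b1 * d p + RtoC b0 * d (S p) +
        RtoC b1 * d (S (S p))) - RtoC b1 * d p - RtoC b1 * d (S (S p)))%C by ring.
    eapply Rle_trans; [apply Cmod_sub_le|]. eapply Rle_trans; [apply Rplus_le_compat_r, Cmod_sub_le|].
    rewrite !Cmod_mult, !Cmod_R, (Rabs_right b1) by lra.
    lra. }
  rewrite Cmod_mult, Cmod_R, Rabs_right in H4 by lra.
  generalize (Cmod_ge_0 (d (S p))). nra.
Qed.

(** * Periodic splines *)

Lemma csum_window (f : nat -> C) a n : (a + 4 <= n)%nat ->
  (forall i, (1 <= i <= n)%nat -> (i <= a \/ a + 4 < i)%nat -> f i = RtoC 0) ->
  csum f 1 n = (f (S a) + f (S (S a)) + f (S (S (S a))) + f (S (S (S (S a)))))%C.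
Proof.
  intros Ha Hf. replace n with (a + (4 + (n - a - 4)))%nat by lia.
  rewrite !csum_app, !csum_S, csum_0.
  rewrite (csum_zero f a) by (intros; apply Hf; lia).
  rewrite (csum_zero (fun i => f (a + (4 + i))%nat)) by (intros; apply Hf; lia).
  replace (a + 1)%nat with (S a) by lia. replace (a + 2)%nat with (S (S a)) by lia.
  replace (a + 3)%nat with (S (S (S a))) by lia. replace (a + 4)%nat with (S (S (S (S a)))) by lia.
  cring.
Qed.

Lemma Series_two_terms (a : nat -> R) : (forall l, (2 <= l)%nat -> a l = 0) -> Series a = a 0%nat + a 1%nat.
Proof.
  intros H. apply is_series_unique. unfold is_series.
  apply (filterlim_ext_loc (fun _ => a 0%nat + a 1%nat)).
  - exists 1%nat. intros l Hl. induction Hl as [|l Hl IH].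
    + rewrite sum_Sn, sum_O. reflexivity.
    + rewrite sum_Sn, <- IH, (H (S l)) by lia. symmetry. apply Rplus_0_r.
  - apply filterlim_const.
Qed.

Lemma mesh_pos n : (1 <= n)%nat -> 0 < mesh n.
Proof. intros H. unfold mesh. generalize PI_RGT_0; intros. apply Rdiv_lt_0_compat; [lra|]. apply lt_0_INR; lia.
Qed.

Lemma mesh_n n : (1 <= n)%nat -> INR n * mesh n = 2 * PI.
Proof. intros H. unfold mesh. assert (0 < INR n) by (apply lt_0_INR; lia). field. lra. Qed.

(** Coefficients are numbered [1..n]. Adding [n] before subtracting 1 keeps natural subtraction
    exact at [i = 0]. *)
Definition extend_periodic (n : nat) (c : nat -> C) (i : nat) : C := c (S ((i + n - 1) mod n)).

Lemma extend_periodic_per n c i : (1 <= n)%nat -> extend_periodic n c (i + n) = extend_periodic n c i.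
Proof.
  intros H. unfold extend_periodic. do 2 f_equal.
  replace (i + n + n - 1)%nat with ((i + n - 1) + 1 * n)%nat by lia. apply Nat.Div0.mod_add.
Qed.

Lemma extend_periodic_id n c i : (1 <= i <= n)%nat -> extend_periodic n c i = c i.
Proof.
  intros H. unfold extend_periodic. f_equal.
  replace (i + n - 1)%nat with ((i - 1) + 1 * n)%nat by lia. rewrite Nat.Div0.mod_add, Nat.mod_small by lia.
  lia.
Qed.

Section PeriodicSpline.

Variables (gam : R -> C) (m : nat).
Hypothesis Hgam : is_contour gam.
Hypothesis Hm : m = 2%nat \/ m = 3%nat \/ m = 4%nat.

Definition spline_sum (n : nat) (c : nat -> C) (t : C) (rho : R) : C :=
  csum (fun j => c j * RtoC (B_per gam m n rho j t))%C 1 n.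

(* The periodized spline over three periods of coefficients, at
   [Z = (x - rho) / mesh n + n + 1], so that node [p] sits at [Z = n + p]. *)
Definition unrolled (n : nat) (d : nat -> C) (Z : R) : C :=
  csum (fun i => d i * RtoC (cardinal_spline m (Z - INR i)))%C 1 (n + (n + n)).

(** The scaled argument lies strictly between [- n] and [n] and the spline vanishes beyond 2, so
    only the shifts -1, 0 and 1 survive. In the pairing of [sum_Z] they fill the first two terms,
    together with the vanishing shift -2. *)
Lemma B_per_param n rho j x : (4 <= n)%nat -> 0 <= rho < mesh n -> (1 <= j <= n)%nat -> 0 <= x < 2 * PI ->
  B_per gam m n rho j (gam x) =
   cardinal_spline m ((x - node n rho j) / mesh n + INR n) + cardinal_spline m ((x - node n rho j) / mesh n)
   + cardinal_spline m ((x - node n rho j) / mesh n - INR n).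
Proof.
  intros Hn Hrho Hj Hx. unfold B_per. rewrite par_spec by auto.
  assert (Hh : 0 < mesh n) by (apply mesh_pos; lia).
  assert (HnR : 4 <= INR n) by (replace 4 with (INR 4) by (simpl; ring); apply le_INR; lia).
  assert (Hhn := mesh_n n ltac:(lia)).
  assert (Hy : - INR n < (x - node n rho j) / mesh n < INR n).
  { assert (E : x - node n rho j = (x - node n rho j) / mesh n * mesh n) by (field; lra).
    set (y := (x - node n rho j) / mesh n) in *.
    assert (1 <= INR j <= INR n) by (split; [replace 1 with (INR 1) by reflexivity|]; apply le_INR; lia).
    unfold node in E. split; apply Rmult_lt_reg_r with (mesh n); auto; nra. }
  set (y := (x - node n rho j) / mesh n) in *.
  unfold sum_Z. rewrite Series_two_terms.
  - simpl Z.of_nat. simpl Z.opp.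
    rewrite (cardinal_spline_support m Hm (y - IZR (-2) * INR n)).
    2:{ rewrite Rabs_right by lra. lra. }
    replace (y - IZR 0 * INR n) with y by ring.
    replace (y - IZR (-1) * INR n) with (y + INR n) by ring.
    replace (y - IZR 1 * INR n) with (y - INR n) by ring. ring.
  - intros l Hl. rewrite !(cardinal_spline_support m Hm); [ring| |].
    + assert (IZR (- Z.of_nat (S l)) <= -2) by (apply IZR_le; lia). rewrite Rabs_right; nra.
    + assert (2 <= IZR (Z.of_nat l)) by (apply IZR_le; lia). rewrite Rabs_left; nra.
Qed.

Lemma spline_sum_unrolled n rho c x : (4 <= n)%nat -> 0 <= rho < mesh n -> 0 <= x < 2 * PI ->
  spline_sum n c (gam x) rho = unrolled n (extend_periodic n c) ((x - rho) / mesh n + INR n + 1).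
Proof.
  intros Hn Hrho Hx. unfold spline_sum, unrolled. rewrite !csum_app.
  rewrite <- !csum_plus. apply csum_ext. intros j Hj.
  rewrite B_per_param by auto.
  assert (Hh : 0 < mesh n) by (apply mesh_pos; lia).
  replace (n + (n + j))%nat with ((j + n) + n)%nat by lia. replace (n + j)%nat with (j + n)%nat by lia.
  rewrite !extend_periodic_per by lia. rewrite extend_periodic_id by auto. rewrite !plus_INR.
  replace ((x - node n rho j) / mesh n) with ((x - rho) / mesh n - (INR j - 1)) by (unfold node; field; lra).
  set (y := (x - rho) / mesh n).
  replace (y + INR n + 1 - (INR j + INR n + INR n)) with (y - (INR j - 1) - INR n) by ring.
  replace (y + INR n + 1 - (INR j + INR n)) with (y - (INR j - 1)) by ring.
  replace (y + INR n + 1 - (INR j)) with (y - (INR j - 1) + INR n) by ring.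
  rewrite !RtoC_plus. ring.
Qed.

Lemma unrolled_local n d p Z : (1 <= p)%nat -> (p + 3 <= n + (n + n))%nat -> INR p + 1 <= Z <= INR p + 2 ->
  unrolled n d Z =
  (d p * RtoC (cardinal_spline m (Z - INR p)) + d (S p) * RtoC (cardinal_spline m (Z - INR p - 1)) +
   d (S (S p)) * RtoC (cardinal_spline m (Z - INR p - 2)) +
     d (S (S (S p))) * RtoC (cardinal_spline m (Z - INR p - 3)))%C.
Proof.
  intros Hp1 Hp HZ. destruct p as [|p]; [lia|]. unfold unrolled. rewrite S_INR in HZ. rewrite (csum_window _ p).
  - rewrite !S_INR.
    replace (Z - (INR p + 1 + 1)) with (Z - (INR p + 1) - 1) by ring.
    replace (Z - (INR p + 1 + 1 + 1)) with (Z - (INR p + 1) - 2) by ring.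
    replace (Z - (INR p + 1 + 1 + 1 + 1)) with (Z - (INR p + 1) - 3) by ring. reflexivity.
  - lia.
  - intros i Hi Hout. rewrite (cardinal_spline_support m Hm); [ring|]. destruct Hout as [h|h].
    + apply le_INR in h. rewrite Rabs_right; lra.
    + assert (h' : INR (p + 5) <= INR i) by (apply le_INR; lia).
      rewrite plus_INR in h'. simpl (INR 5) in h'. rewrite Rabs_left1; lra.
Qed.

Lemma unrolled_period n d Z : (4 <= n)%nat -> (forall i, d (i + n)%nat = d i) -> INR n <= Z <= INR n + 1 ->
  unrolled n d (Z + INR n) = unrolled n d Z.
Proof.
  intros Hn Hd HZ.
  assert (E1 : INR (n - 1) = INR n - 1) by (rewrite minus_INR by lia; reflexivity).
  rewrite (unrolled_local n d (n - 1) Z) by (lia || lra).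
  rewrite (unrolled_local n d ((n - 1) + n) (Z + INR n)) by (lia || (rewrite plus_INR; lra)).
  rewrite plus_INR. replace (Z + INR n - (INR (n - 1) + INR n)) with (Z - INR (n - 1)) by ring.
  rewrite <- !Nat.add_succ_l, !Hd. reflexivity.
Qed.

Lemma unrolled_node n d p : (1 <= p)%nat -> (p + 3 <= n + (n + n))%nat ->
  exists b0 b1, 0 <= b1 /\ / 3 <= b0 - 2 * b1 /\
  unrolled n d (INR p + 1) = (RtoC b1 * d p + RtoC b0 * d (S p) + RtoC b1 * d (S (S p)))%C /\
  b0 = cardinal_spline m 0 /\ b1 = cardinal_spline m 1.
Proof.
  intros Hp1 Hp. destruct (cardinal_spline_nodes m Hm) as [b0 [b1 [H1 [H2 [H3 [H4 H5]]]]]].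
  exists b0, b1. repeat split; auto.
  rewrite (unrolled_local n d p (INR p + 1)) by (lia || lra).
  replace (INR p + 1 - INR p) with 1 by ring. replace (1 - 1) with 0 by ring.
  replace (1 - 2) with (-1) by ring. replace (1 - 3) with (-2) by ring.
  rewrite H3, H4, H5, (cardinal_spline_support m Hm (-2)) by (rewrite Rabs_left; lra). ring.
Qed.

(** On one cell the partition of unity eliminates the first spline, and the other three are
    multiplied by coefficient differences of sizes at most [D], [2 * D] and [3 * D]; hence the
    factor 6. Bounds on the coefficients themselves would not give the small increments needed for
    interpolation. *)
Lemma unrolled_lipschitz : exists K, 0 <= K /\ forall n d D a b, (4 <= n)%nat ->
  (forall i, Cmod (d (S i) - d i)%C <= D) -> (1 <= a)%nat -> (a + b + 2 <= n + (n + n))%nat ->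
  holder_on 1 (K * D) (unrolled n d) (INR a + 1) (INR a + INR b + 1).
Proof.
  destruct (cardinal_spline_lipschitz m Hm) as [L [HL HLip]]. exists (6 * L). split; [lra|].
  intros n d D a b Hn HD Ha.
  assert (HD0 : 0 <= D) by (eapply Rle_trans; [apply Cmod_ge_0|apply (HD 0%nat)]).
  assert (Hloc : forall p, (1 <= p)%nat -> (p + 3 <= n + (n + n))%nat ->
    holder_on 1 (6 * L * D) (unrolled n d) (INR p + 1) (INR p + 2)).
  { intros p Hp1 Hp x y Hx Hxy Hy. rewrite Rpower_1 by lra.
    rewrite (unrolled_local n d p x), (unrolled_local n d p y) by (lia || lra).
    assert (Part : forall z, INR p + 1 <= z <= INR p + 2 -> cardinal_spline m (z - INR p) =
      1 - cardinal_spline m (z - INR p - 1) - cardinal_spline m (z - INR p - 2)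
        - cardinal_spline m (z - INR p - 3)).
    { intros z Hz. generalize (cardinal_spline_partition m Hm (z - INR p - 1) ltac:(lra)).
      replace (z - INR p - 1 + 1) with (z - INR p) by ring.
      replace (z - INR p - 1 - 1) with (z - INR p - 2) by ring.
      replace (z - INR p - 1 - 2) with (z - INR p - 3) by ring. lra. }
    rewrite (Part x), (Part y) by lra.
    assert (HLi : forall i, 0 <= i <= 3 ->
      Rabs (cardinal_spline m (x - INR p - i) - cardinal_spline m (y - INR p - i)) <= L * (y - x)).
    { intros i Hi. replace (y - x) with (Rabs ((x - INR p - i) - (y - INR p - i))).
      - apply HLip; lra.
      - rewrite Rabs_left; lra. }
    generalize (HLi 1 ltac:(lra)) (HLi 2 ltac:(lra)) (HLi 3 ltac:(lra)).
    generalize (cardinal_spline m (x - INR p - 1)) (cardinal_spline m (x - INR p - 2))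
      (cardinal_spline m (x - INR p - 3))
      (cardinal_spline m (y - INR p - 1)) (cardinal_spline m (y - INR p - 2))
        (cardinal_spline m (y - INR p - 3)).
    intros x1 x2 x3 y1 y2 y3 F1 F2 F3.
    assert (G0 := HD p). assert (G1 := HD (S p)). assert (G2 := HD (S (S p))).
    rewrite !RtoC_minus.
    set (e0 := (d (S p) - d p)%C) in *. set (e1 := (d (S (S p)) - d (S p))%C) in *.
    set (e2 := (d (S (S (S p))) - d (S (S p)))%C) in *.
    replace (_ - _)%C with ((e0 * RtoC (x1 - y1)) + ((e0 + e1) * RtoC (x2 - y2)) + ((e0 + e1 +
      e2) * RtoC (x3 - y3)))%C
      by (rewrite !RtoC_minus; unfold e0, e1, e2; ring).
    assert (T : forall e r c, Cmod e <= c * D -> 0 <= c -> Rabs r <= L * (y - x) ->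
      Cmod (e * RtoC r)%C <= c * (L * D * (y - x))).
    { intros e r c He Hc Hr. rewrite Cmod_mult, Cmod_R.
      replace (c * (L * D * (y - x))) with ((c * D) * (L * (y - x))) by ring.
      apply Rmult_le_compat; auto; [apply Cmod_ge_0|apply Rabs_pos]. }
    eapply Rle_trans; [apply Cmod_triangle|]. eapply Rle_trans; [apply Rplus_le_compat_r, Cmod_triangle|].
    generalize (Cmod_triangle e0 e1) (Cmod_triangle (e0 + e1) e2); intros.
    generalize (T e0 _ 1 ltac:(lra) ltac:(lra) F1) (T (e0 + e1)%C _ 2 ltac:(lra) ltac:(lra) F2)
      (T (e0 + e1 + e2)%C _ 3 ltac:(lra) ltac:(lra) F3). lra. }
  intros Hb. induction b as [|b IH].
  - intros x y Hx Hxy Hy. simpl INR in Hy. lra.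
  - apply lipschitz_on_glue with (INR a + INR b + 1); [apply IH; lia|].
    rewrite S_INR. rewrite <- plus_INR.
    replace (INR a + (INR b + 1) + 1) with (INR (a + b) + 2) by (rewrite plus_INR; ring).
    apply Hloc; lia.
Qed.


(** At [2 * PI] the point of the contour has parameter [0], while the unrolled argument is [n]
    larger; [unrolled_period] reconciles the two, so the formula holds on a closed period. *)
Lemma spline_sum_param n rho c x : (4 <= n)%nat -> 0 <= rho < mesh n -> 0 <= x <= 2 * PI ->
  spline_sum n c (gam x) rho = unrolled n (extend_periodic n c) ((x - rho) / mesh n + INR n + 1).
Proof.
  intros Hn Hrho Hx. destruct (Req_dec x (2 * PI)) as [->|E]; [|apply spline_sum_unrolled; auto; lra].
  assert (Hh : 0 < mesh n) by (apply mesh_pos; lia). assert (Hhn := mesh_n n ltac:(lia)).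
  replace (2 * PI) with (0 + 2 * PI) at 1 by ring. rewrite (gam_periodic _ Hgam).
  rewrite spline_sum_unrolled by (auto; generalize PI_RGT_0; lra).
  rewrite <- unrolled_period; auto.
  - f_equal. rewrite <- Hhn. field. lra.
  - intros i. apply extend_periodic_per. lia.
  - assert (- 1 <= (0 - rho) / mesh n <= 0); [|lra].
    split; apply Rmult_le_reg_r with (mesh n); auto;
    replace ((0 - rho) / mesh n * mesh n) with (- rho) by (field; lra); lra.
Qed.

Lemma spline_sum_lipschitz : exists K, 0 <= K /\ forall n rho c D, (4 <= n)%nat -> 0 <= rho < mesh n ->
  (forall i, Cmod (extend_periodic n c (S i) - extend_periodic n c i)%C <= D) ->
  holder 1 (K * D / mesh n) (fun x => spline_sum n c (gam x) rho).
Proof.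
  destruct unrolled_lipschitz as [K [HK H]]. exists (K + K). split; [lra|].
  intros n rho c D Hn Hrho HD.
  assert (Hh : 0 < mesh n) by (apply mesh_pos; lia). assert (Hhn := mesh_n n ltac:(lia)).
  assert (HD0 : 0 <= D) by (eapply Rle_trans; [apply Cmod_ge_0|apply (HD 0%nat)]).
  assert (HKD : 0 <= K * D / mesh n).
  { apply Rmult_le_pos; [apply Rmult_le_pos; lra|left; apply Rinv_0_lt_compat; lra]. }
  replace ((K + K) * D / mesh n) with (K * D / mesh n + K * D / mesh n) by (field; lra).
  apply holder_periodic; auto; [lra| |].
  { exact (pullback_periodic gam (fun t => spline_sum n c t rho) Hgam). }
  intros x y Hx Hxy Hy. rewrite !spline_sum_param by (auto; lra). rewrite Rpower_1 by lra.
  (* For parameters in [[0, 2 * PI]] the unrolled argument lies between [n] and [2 * n + 1], which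
     are [n + 1] cells starting from [a = n - 1]. *)
  specialize (H n (extend_periodic n c) D (n - 1)%nat (n + 1)%nat Hn HD ltac:(lia) ltac:(lia)).
  assert (Hfx : forall x, 0 <= x <= 2 * PI -> - 1 <= (x - rho) / mesh n <= INR n).
  { intros z Hz. split; apply Rmult_le_reg_r with (mesh n); auto;
    replace ((z - rho) / mesh n * mesh n) with (z - rho) by (field; lra); lra. }
  generalize (Hfx x ltac:(lra)) (Hfx y ltac:(lra)); intros Fx Fy.
  assert (E1 : INR (n - 1) = INR n - 1) by (rewrite minus_INR by lia; reflexivity).
  assert (E2 : INR (n + 1) = INR n + 1) by (rewrite plus_INR; reflexivity).
  assert (Fxy : (y - rho) / mesh n - (x - rho) / mesh n = (y - x) / mesh n) by (field; lra).
  assert (Fp : 0 < (y - x) / mesh n) by (apply Rdiv_lt_0_compat; lra).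
  eapply Rle_trans; [apply H; lra|]. rewrite Rpower_1 by lra.
  right. field. lra.
Qed.

(** * Nodal values, coefficients and interpolation *)

Lemma node_S_add n rho p : (1 <= n)%nat -> node n rho (p + n) = node n rho p + 2 * PI.
Proof. intros H. unfold node. rewrite plus_INR, <- (mesh_n n H). ring. Qed.

Lemma node_range n rho i : 0 <= rho < mesh n -> (1 <= i <= n)%nat -> 0 <= node n rho i < 2 * PI.
Proof.
  intros Hrho Hi. unfold node. rewrite <- (mesh_n n) by lia.
  assert (1 <= INR i <= INR n) by (split; [replace 1 with (INR 1) by reflexivity|]; apply le_INR; lia).
  nra.
Qed.

Lemma node_reduce n rho p : (1 <= n)%nat ->
  exists i, (1 <= i <= n)%nat /\ gam (node n rho (S p)) = gam (node n rho i).
Proof.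
  intros Hn. induction p as [p IH] using (well_founded_induction lt_wf).
  destruct (le_lt_dec n p) as [h|h].
  - destruct (IH (p - n)%nat ltac:(lia)) as [i [Hi E]]. exists i. split; auto. rewrite <- E.
    replace (S p) with (S (p - n) + n)%nat by lia. rewrite node_S_add by auto. apply (gam_periodic _ Hgam).
  - exists (S p). split; [lia|auto].
Qed.

Lemma spline_sum_node n rho c p : (4 <= n)%nat -> 0 <= rho < mesh n ->
  spline_sum n c (gam (node n rho (S p))) rho =
  (RtoC (cardinal_spline m 1) * extend_periodic n c p + RtoC (cardinal_spline m 0) * extend_periodic n c (S p) +
   RtoC (cardinal_spline m 1) * extend_periodic n c (S (S p)))%C.
Proof.
  intros Hn Hrho. assert (Hh : 0 < mesh n) by (apply mesh_pos; lia).
  assert (Hper := fun i => extend_periodic_per n c i ltac:(lia)).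
  induction p as [p IH] using (well_founded_induction lt_wf).
  destruct (le_lt_dec n p) as [h|h].
  - assert (E := IH (p - n)%nat ltac:(lia)). remember (p - n)%nat as l eqn:El.
    assert (p = (l + n)%nat) as -> by lia.
    rewrite <- !Nat.add_succ_l, node_S_add, (gam_periodic _ Hgam), !Hper by lia. exact E.
  - assert (Hr : 0 <= node n rho (S p) < 2 * PI) by (apply node_range; auto; split; lia).
    rewrite spline_sum_unrolled by auto.
    replace ((node n rho (S p) - rho) / mesh n + INR n + 1) with (INR (p + n) + 1).
    2:{ unfold node. rewrite S_INR, plus_INR. field. lra. }
    destruct (unrolled_node n (extend_periodic n c) (p + n) ltac:(lia) ltac:(lia)) as [b0 [b1 [_ [_ [-> [->
      ->]]]]]].
    rewrite <- !Nat.add_succ_l, !Hper. reflexivity.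
Qed.

Lemma spline_coef_bound n rho c M : (4 <= n)%nat -> 0 <= rho < mesh n ->
  (forall i, (1 <= i <= n)%nat -> Cmod (spline_sum n c (gam (node n rho i)) rho) <= M) ->
  forall i, (1 <= i <= n)%nat -> Cmod (c i) <= 3 * M.
Proof.
  intros Hn Hrho H i Hi. rewrite <- (extend_periodic_id n c i Hi).
  destruct (cardinal_spline_nodes m Hm) as [b0 [b1 [H1 [H2 [H3 [H4 H5]]]]]].
  apply (tridiagonal_bound (extend_periodic n c) n b0 b1); auto; try lia.
  - intros; apply extend_periodic_per; lia.
  - intros p. rewrite <- H3, <- H4, <- spline_sum_node with (rho := rho) by auto.
    destruct (node_reduce n rho p ltac:(lia)) as [l [Hl ->]]. auto.
Qed.

(** The collocation matrix commutes with the cyclic shift, so coefficient differences solve the same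
    tridiagonal system with differences of nodal values as data. *)
Lemma spline_diff_bound n rho c M : (4 <= n)%nat -> 0 <= rho < mesh n ->
  (forall p, Cmod (spline_sum n c (gam (node n rho (S (S p)))) rho - spline_sum n c (gam (node n rho (S p)))
    rho)%C <= M) ->
  forall i, Cmod (extend_periodic n c (S i) - extend_periodic n c i)%C <= 3 * M.
Proof.
  intros Hn Hrho H.
  destruct (cardinal_spline_nodes m Hm) as [b0 [b1 [H1 [H2 [H3 [H4 H5]]]]]].
  apply (tridiagonal_bound (fun i => extend_periodic n c (S i) - extend_periodic n c i)%C n b0 b1); auto;
    try lia.
  - intros i. rewrite <- Nat.add_succ_l, !extend_periodic_per by lia. auto.
  - intros p. generalize (H p). rewrite !spline_sum_node by auto. rewrite H3, H4.
    intros F. eapply Rle_trans; [right|exact F]. f_equal. ring.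
Qed.

Lemma in_S_spline_sum n rho c : in_S gam m n rho (fun t => spline_sum n c t rho).
Proof. exists c. reflexivity. Qed.

Lemma in_S_lin n rho u v a : in_S gam m n rho u -> in_S gam m n rho v ->
  in_S gam m n rho (fun t => u t - a * v t)%C.
Proof.
  intros [c Hc] [d Hd]. exists (fun j => c j - a * d j)%C. intros t Ht. rewrite Hc, Hd by auto.
  rewrite <- csum_mult, <- csum_minus. apply csum_ext. intros j _. ring.
Qed.

Lemma in_S_bounded_lipschitz n rho u : (4 <= n)%nat -> 0 <= rho < mesh n -> in_S gam m n rho u ->
  (exists M, bounded_by M (fun x => u (gam x))) /\ forall x, ccontinuous (fun x => u (gam x)) x.
Proof.
  intros Hn Hrho [c Hc]. destruct spline_sum_lipschitz as [K [HK H]].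
  destruct (periodic_seq_max (extend_periodic n c) n ltac:(lia) ltac:(intros; apply extend_periodic_per;
    lia)) as [q Hq].
  assert (Hl : holder 1 (K * (2 * Cmod (extend_periodic n c q)) / mesh n) (fun x => u (gam x))).
  { intros x y Hxy. rewrite !Hc by apply on_contour_param. apply H; auto. intros i.
    eapply Rle_trans; [apply Cmod_sub_le|]. generalize (Hq i) (Hq (S i)). lra. }
  split; [|eapply holder_continuous; [|exact Hl]; lra].
  set (L := K * (2 * Cmod (extend_periodic n c q)) / mesh n) in *.
  exists (Cmod (u (gam 0)) + L * (2 * PI)). apply bounded_by_periodic; [apply pullback_periodic; auto|].
  intros x Hx. assert (HL := holder_pos _ _ _ Hl).
  destruct (Req_dec x 0) as [->|Hx0]; [generalize (Cmod_ge_0 (u (gam 0))); nra|].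
  specialize (Hl 0 x ltac:(lra)). rewrite Rpower_1 in Hl by lra.
  replace (u (gam x)) with (u (gam 0) - (u (gam 0) - u (gam x)))%C by ring.
  eapply Rle_trans; [apply Cmod_sub_le|]. nra.
Qed.

Lemma in_S_admissible n rho u : (4 <= n)%nat -> 0 <= rho < mesh n -> in_S gam m n rho u -> admissible gam u.
Proof. intros Hn Hrho Hu. apply admissible_continuous. apply (in_S_bounded_lipschitz n rho u); auto. Qed.

Lemma in_S_zero n rho u : (4 <= n)%nat -> 0 <= rho < mesh n -> in_S gam m n rho u ->
  (forall i, (1 <= i <= n)%nat -> u (gam (node n rho i)) = RtoC 0) -> forall x, u (gam x) = RtoC 0.
Proof.
  intros Hn Hrho [c Hc] H x. rewrite Hc by apply on_contour_param. apply csum_zero. intros j Hj.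
  assert (Hcj : Cmod (c j) <= 3 * 0).
  { apply (spline_coef_bound n rho); auto. intros i Hi. unfold spline_sum.
    rewrite <- Hc by apply on_contour_param.
    rewrite H by auto. rewrite Cmod_0. lra. }
  replace (c j) with (RtoC 0); [ring|]. symmetry. apply Cmod_eq_0. generalize (Cmod_ge_0 (c j)). lra.
Qed.

Lemma in_S_unique n rho u v : (4 <= n)%nat -> 0 <= rho < mesh n -> in_S gam m n rho u -> in_S gam m n rho v ->
  interpolates gam n rho u v -> eq_on gam u v.
Proof.
  intros Hn Hrho Hu Hv H t [x <-].
  assert (E : (u (gam x) - RtoC 1 * v (gam x))%C = RtoC 0).
  { apply (in_S_zero n rho (fun t => u t - RtoC 1 * v t)%C); auto.
    - apply in_S_lin; auto.
    - intros i Hi. rewrite (H i Hi). ring. }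
  replace (u (gam x)) with ((u (gam x) - RtoC 1 * v (gam x)) + v (gam x))%C by ring. rewrite E. ring.
Qed.

(** [spline_coef_bound] with bound [0] is injectivity of the square collocation system, hence
    solvability; this justifies the choice by [epsilon]. *)
Lemma P_op_spec n rho v : (4 <= n)%nat -> 0 <= rho < mesh n ->
  in_S gam m n rho (P_op gam m n rho v) /\ interpolates gam n rho v (P_op gam m n rho v).
Proof.
  intros Hn Hrho. unfold P_op. apply epsilon_spec.
  destruct (injective_system_solvable n (fun i j => RtoC (B_per gam m n rho j (gam (node n rho i)))))
    with (b := fun i => v (gam (node n rho i))) as [c Hc].
  - intros c H j Hj.
    assert (Hcj : Cmod (c j) <= 3 * 0).
    { apply (spline_coef_bound n rho); auto. intros i Hi. unfold spline_sum.
      rewrite (csum_ext _ (fun j => RtoC (B_per gam m n rho j (gam (node n rho i))) * c j)%C) by (intros; ring).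
      rewrite H by auto. rewrite Cmod_0. lra. }
    apply Cmod_eq_0. generalize (Cmod_ge_0 (c j)). lra.
  - exists (fun t => spline_sum n c t rho). split; [apply in_S_spline_sum|].
    intros i Hi. rewrite <- Hc by auto. apply csum_ext. intros; ring.
Qed.

(* Interpolation only sees the increments of [z] over one mesh width, of size [L h^s];
   the Lipschitz constant of the interpolant is therefore [O(L h^(s-1))]. *)
Lemma interpolant_lipschitz : exists K, 0 <= K /\ forall n rho z u s L, (4 <= n)%nat -> 0 <= rho < mesh n ->
  holder s L (fun x => z (gam x)) -> in_S gam m n rho u -> interpolates gam n rho z u ->
  holder 1 (K * L * Rpower (mesh n) (s - 1)) (fun x => u (gam x)).
Proof.
  destruct spline_sum_lipschitz as [K [HK H]]. exists (K * 3). split; [lra|].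
  intros n rho z u s L Hn Hrho Hz [c Hc] Hi x y Hxy.
  assert (Hh : 0 < mesh n) by (apply mesh_pos; lia).
  rewrite !Hc by apply on_contour_param.
  assert (E : K * (3 * (L * Rpower (mesh n) s)) / mesh n = K * 3 * L * Rpower (mesh n) (s - 1)).
  { unfold Rminus. rewrite Rpower_plus, Rpower_Ropp, Rpower_1 by auto. field. lra. }
  rewrite <- E. apply H; auto. apply spline_diff_bound with rho; auto.
  assert (G : forall p, spline_sum n c (gam (node n rho (S p))) rho = z (gam (node n rho (S p)))).
  { intros p. destruct (node_reduce n rho p ltac:(lia)) as [i [Hi1 ->]]. rewrite <- Hi by auto.
    rewrite Hc by apply on_contour_param. reflexivity. }
  intros p. rewrite !G, Cmod_sub_sym.
  replace (mesh n) with (node n rho (S (S p)) - node n rho (S p)) by (unfold node; rewrite !S_INR; ring).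
  apply Hz. unfold node. rewrite !S_INR. nra.
Qed.

Lemma nearby_node n rho x : (1 <= n)%nat -> exists p y,
  (forall z : C -> C, z (gam x) = z (gam y)) /\ node n rho (S p) <= y < node n rho (S p) + mesh n.
Proof.
  intros Hn. assert (Hh := mesh_pos n Hn).
  destruct (period_reduce x rho) as [k Hk]. set (y := x - IZR k * (2 * PI)) in *.
  assert (A : forall q, rho <= y < rho + INR q * mesh n ->
    exists p, node n rho (S p) <= y < node n rho (S p) + mesh n).
  { induction q as [|q IH]; intros Hq; [simpl in Hq; lra|].
    destruct (Rlt_dec y (rho + INR q * mesh n)) as [h|h]; [apply IH; lra|].
    exists q. unfold node. rewrite S_INR in *. lra. }
  destruct (A n) as [p Hp]; [rewrite mesh_n by auto; lra|].
  exists p, y. split; auto. intros z. f_equal.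
  rewrite <- (periodic_Z gam (gam_periodic _ Hgam) k y). f_equal. unfold y. ring.
Qed.

Lemma Rpower_trade x h s t : 0 < x <= h -> 0 <= t -> Rpower x (s + t) <= Rpower h t * Rpower x s.
Proof.
  intros Hx Ht. rewrite Rpower_plus, Rmult_comm. apply Rmult_le_compat_r; [left; apply Rpower_pos|].
  apply Rpower_le_base; auto.
Qed.

(** At distances up to [h] the Lipschitz bound of the interpolant is already an s-Hoelder bound with
    constant [K * L]. Comparison with the node to the left gives the uniform error. For the exponent
    [s'], short distances trade [s - s'] for a power of [h], and at long distances the uniform error
    suffices because [h < y - x]. *)
Lemma interpolation_estimates : exists K, 0 <= K /\ forall n rho z u s L, (4 <= n)%nat -> 0 <= rho < mesh n ->
  0 < s <= 1 ->
  holder s L (fun x => z (gam x)) -> in_S gam m n rho u -> interpolates gam n rho z u ->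
  bounded_by (K * L * Rpower (mesh n) s) (fun x => u (gam x) - z (gam x))%C /\
  forall s', 0 < s' <= s ->
    holder s' (K * L * Rpower (mesh n) (s - s')) (fun x => u (gam x) - z (gam x))%C.
Proof.
  destruct interpolant_lipschitz as [K [HK H]]. exists (2 * (K + 1)). split; [lra|].
  intros n rho z u s L Hn Hrho Hs Hz Hu Hi.
  assert (Hlip := H n rho z u s L Hn Hrho Hz Hu Hi). clear H.
  assert (Hh : 0 < mesh n) by (apply mesh_pos; lia). set (h := mesh n) in *.
  assert (HL := holder_pos _ _ _ Hz).
  assert (HKL : 0 <= K * L) by (apply Rmult_le_pos; auto).
  assert (Hshort : forall x y, x < y -> y - x <= h ->
    Cmod (u (gam x) - u (gam y))%C <= K * L * Rpower (y - x) s).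
  { intros x y Hxy Hyx. eapply Rle_trans; [apply Hlip; auto|].
    rewrite Rmult_assoc. apply Rmult_le_compat_l; auto.
    generalize (Rpower_trade (y - x) h s (1 - s) ltac:(lra) ltac:(lra)).
    replace (s + (1 - s)) with 1 by ring. intros F.
    replace (s - 1) with (- (1 - s)) by ring. rewrite Rpower_Ropp.
    apply Rmult_le_reg_l with (Rpower h (1 - s)); [apply Rpower_pos|].
    rewrite <- Rmult_assoc, Rinv_r, Rmult_1_l by (generalize (Rpower_pos h (1 - s)); lra). exact F. }
  assert (Hsup : bounded_by ((K + 1) * L * Rpower h s) (fun x => u (gam x) - z (gam x))%C).
  { intros x. destruct (nearby_node n rho x ltac:(lia)) as [p [y [Hy1 Hy2]]]. rewrite !Hy1.
    assert (E : u (gam (node n rho (S p))) = z (gam (node n rho (S p)))).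
    { destruct (node_reduce n rho p ltac:(lia)) as [i [Hi1 ->]]. apply Hi; auto. }
    assert (Hp : 0 <= (K + 1) * L * Rpower h s).
    { apply Rmult_le_pos; [apply Rmult_le_pos; lra|left; apply Rpower_pos]. }
    destruct (Req_dec y (node n rho (S p))) as [->|Hne]; [rewrite E, Cmod_sub_refl; auto|].
    set (y0 := node n rho (S p)) in *.
    assert (Hpw : Rpower (y - y0) s <= Rpower h s) by (apply Rpower_le_base; unfold h; lra).
    generalize (Hshort y0 y ltac:(lra) ltac:(unfold h; lra)) (Hz y0 y ltac:(lra)). cbv beta. rewrite E.
    intros F1 F2.
    replace (u (gam y) - z (gam y))%C with ((z (gam y0) - z (gam y)) - (z (gam y0) - u (gam y)))%C by ring.
    eapply Rle_trans; [apply Cmod_sub_le|].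
    generalize (Rmult_le_compat_l _ _ _ HL Hpw) (Rmult_le_compat_l _ _ _ HKL Hpw). lra. }
  split.
  - intros x. eapply Rle_trans; [apply Hsup|].
    assert (0 <= (K + 1) * L * Rpower h s).
    { apply Rmult_le_pos; [apply Rmult_le_pos; lra|left; apply Rpower_pos]. } lra.
  - intros s' Hs' x y Hxy.
    assert (HKL1 : 0 <= (K + 1) * L) by (apply Rmult_le_pos; lra).
    destruct (Rle_dec (y - x) h) as [Hd|Hd].
    + replace (u (gam x) - z (gam x) - (u (gam y) - z (gam y)))%C with
        ((u (gam x) - u (gam y)) - (z (gam x) - z (gam y)))%C by ring.
      eapply Rle_trans; [apply Cmod_sub_le|].
      generalize (Hshort x y Hxy Hd) (Hz x y Hxy). cbv beta. intros F1 F2.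
      generalize (Rpower_trade (y - x) h s' (s - s') ltac:(lra) ltac:(lra)).
      replace (s' + (s - s')) with s by ring. intros F3.
      assert (0 <= Rpower h (s - s') * Rpower (y - x) s') by (apply Rmult_le_pos; left; apply Rpower_pos).
      generalize (Rmult_le_compat_l _ _ _ HKL1 F3) (Rmult_le_pos _ _ HKL1 H). lra.
    + eapply Rle_trans; [apply Cmod_sub_le|].
      generalize (Hsup x) (Hsup y). cbv beta. intros F1 F2.
      assert (F3 : Rpower h s <= Rpower h (s - s') * Rpower (y - x) s').
      { replace s with ((s - s') + s') at 1 by ring. rewrite Rpower_plus.
        apply Rmult_le_compat_l; [left; apply Rpower_pos|]. apply Rpower_le_base; lra. }
      generalize (Rmult_le_compat_l _ _ _ HKL1 F3). lra.
Qed.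

End PeriodicSpline.

(** * Lagrange interpolation and Gauss moments *)

(** Functions given by a polynomial of degree at most [n], in Horner form, so that no coefficient
    lists are needed. *)
Fixpoint is_poly (n : nat) (f : R -> R) : Prop :=
  match n with
  | O => exists c, forall x, f x = c
  | S n => exists c g, is_poly n g /\ forall x, f x = c + x * g x
  end.

Lemma is_poly_ext n f g : (forall x, f x = g x) -> is_poly n f -> is_poly n g.
Proof.
  destruct n as [|n]; simpl.
  - intros H [c Hc]. exists c. intros x. rewrite <- H; auto.
  - intros H [c [p [Hp Hc]]]. exists c, p. split; auto. intros x. rewrite <- H; auto.
Qed.

Lemma is_poly_const n c : is_poly n (fun _ => c).
Proof.
  revert c. induction n as [|n IH]; intros c; simpl; [exists c; auto|].
  exists c, (fun _ => 0). split; auto. intros; ring.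
Qed.

Lemma is_poly_lin n f g a : is_poly n f -> is_poly n g -> is_poly n (fun x => f x + a * g x).
Proof.
  revert f g. induction n as [|n IH]; simpl; intros f g.
  - intros [c Hc] [d Hd]. exists (c + a * d). intros x. rewrite Hc, Hd; auto.
  - intros [c [p [Hp Hc]]] [d [r [Hr Hd]]]. exists (c + a * d), (fun x => p x + a * r x).
    split; auto. intros x. rewrite Hc, Hd. ring.
Qed.

Lemma is_poly_S n f : is_poly n f -> is_poly (S n) f.
Proof.
  revert f. induction n as [|n IH]; intros f.
  - intros [c Hc]. exists c, (fun _ => 0). split; [exists 0; auto|]. intros x. rewrite Hc. ring.
  - intros [c [g [Hg Hc]]]. exists c, g. split; auto.
Qed.

Lemma is_poly_le n k f : (n <= k)%nat -> is_poly n f -> is_poly k f.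
Proof. intros H; induction H; auto. intros; apply is_poly_S; auto. Qed.

Lemma is_poly_mul_linear n f a b : is_poly n f -> is_poly (S n) (fun x => (a + b * x) * f x).
Proof.
  intros Hf. apply is_poly_ext with (fun x => (0 + x * (b * f x)) + a * f x); [intros; ring|].
  apply (is_poly_lin (S n) (fun x => 0 + x * (b * f x)) f a); [|apply is_poly_S, Hf].
  exists 0, (fun x => b * f x). split; auto.
  apply is_poly_ext with (fun x => 0 + b * f x); [intros; ring|]. apply is_poly_lin; auto. apply is_poly_const.
Qed.

Lemma is_poly_pow k : is_poly k (fun x => x ^ k).
Proof.
  induction k as [|k IH]; simpl; [exists 1; auto|]. exists 0, (fun x => x ^ k). split; auto. intros; ring.
Qed.

Lemma is_poly_factor n f r : is_poly (S n) f -> exists g, is_poly n g /\ forall x, f x = f r + (x - r) * g x.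
Proof.
  revert f. induction n as [|n IH]; intros f [c [g [Hg Hc]]].
  - exists g. split; auto. destruct Hg as [d Hd]. intros x. rewrite !Hc, !Hd. ring.
  - destruct (IH g Hg) as [g1 [Hg1 E]]. exists (fun x => g x + r * g1 x). split.
    + apply is_poly_lin; auto. apply is_poly_S; auto.
    + intros x. rewrite !Hc, (E x). ring.
Qed.

Lemma is_poly_roots n f (xi : nat -> R) : is_poly n f ->
  (forall i j, (1 <= i)%nat -> (i < j <= S n)%nat -> xi i <> xi j) ->
  (forall i, (1 <= i <= S n)%nat -> f (xi i) = 0) -> forall x, f x = 0.
Proof.
  revert f. induction n as [|n IH]; intros f Hf Hd Hz x.
  - destruct Hf as [c Hc]. rewrite Hc, <- (Hc (xi 1%nat)). apply Hz; lia.
  - destruct (is_poly_factor n f (xi (S (S n))) Hf) as [g [Hg E]].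
    rewrite E, Hz by lia. rewrite (IH g Hg); [ring| |].
    + intros i j Hi Hj. apply Hd; lia.
    + intros i Hi. assert (F := E (xi i)). rewrite !Hz in F by lia.
      assert (xi i - xi (S (S n)) <> 0) by (apply Rminus_eq_contra, Hd; lia).
      assert (G : (xi i - xi (S (S n))) * g (xi i) = 0) by lra.
      apply Rmult_integral in G. tauto.
Qed.

Lemma is_poly_continuous n f x : is_poly n f -> continuous f x.
Proof.
  revert f. induction n as [|n IH]; intros f.
  - intros [c Hc]. apply (continuous_ext (fun _ => c)); [auto|]. apply continuous_const.
  - intros [c [g [Hg Hc]]]. apply (continuous_ext (fun y : R => c + y * g y)); [intros; rewrite Hc;
    reflexivity|].
    apply (continuous_plus (V := R_NormedModule) (fun _ => c) (fun y => y * g y)); [apply continuous_const|].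
    apply (continuous_mult (K := R_AbsRing) (fun y => y) g); [apply continuous_id|auto].
Qed.

Section Gauss.

Variables (q : nat) (xi w : nat -> R).
Hypothesis Hg : is_gauss_legendre q xi w.

Let factor (i : nat) (x : R) (j : nat) : R := if Nat.eqb j i then 1 else (x - xi j) / (xi i - xi j).

Lemma gauss_nodes_incr i j : (1 <= i)%nat -> (i < j <= q)%nat -> xi i < xi j.
Proof.
  destruct Hg as [_ [H _]]. intros Hi [Hij Hj]. induction Hij as [|j Hij IH]; [apply H; lia|].
  apply Rlt_trans with (xi j); [apply IH; lia|apply H; lia].
Qed.

Lemma gauss_nodes_distinct i j : (1 <= i <= q)%nat -> (1 <= j <= q)%nat -> i <> j -> xi i <> xi j.
Proof.
  intros Hi Hj Hij. destruct (lt_dec i j).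
  - generalize (gauss_nodes_incr i j ltac:(lia) ltac:(lia)). lra.
  - generalize (gauss_nodes_incr j i ltac:(lia) ltac:(lia)). lra.
Qed.

(** Each index contributes a linear factor except [i] itself, whose factor is 1; the test asks
    whether [i] is among the indices and then lowers the degree by one. *)
Lemma lagrange_product_poly i a len :
  is_poly (if (Nat.leb a i && Nat.ltb i (a + len))%bool then pred len else len)
    (fun x => fold_right Rmult 1 (map (factor i x) (seq a len))).
Proof.
  revert a. induction len as [|len IH]; intros a.
  - simpl. destruct (_ && _)%bool; exists 1; auto.
  - specialize (IH (S a)). cbn [seq map fold_right]. unfold factor at 1.
    destruct (Nat.eqb_spec a i) as [->|Hai].
    + assert (E : (Nat.leb (S i) i && Nat.ltb i (S i + len))%bool = false).
      { destruct (Nat.leb_spec (S i) i); [lia|reflexivity]. }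
      rewrite E in IH.
      assert (E' : (Nat.leb i i && Nat.ltb i (i + S len))%bool = true).
      { rewrite Nat.leb_refl. destruct (Nat.ltb_spec i (i + S len)); [reflexivity|lia]. }
      rewrite E'. simpl pred. eapply is_poly_ext; [|exact IH]. intros; simpl; ring.
    + assert (E : (Nat.leb a i && Nat.ltb i (a + S len))%bool =
      (Nat.leb (S a) i && Nat.ltb i (S a + len))%bool).
      { destruct (Nat.leb_spec a i), (Nat.leb_spec (S a) i), (Nat.ltb_spec i (a +
        S len)), (Nat.ltb_spec i (S a + len)); simpl; lia || reflexivity. }
      rewrite E.
      apply is_poly_ext with (fun x => ((- xi a / (xi i - xi a)) +
        (/ (xi i - xi a)) * x) * fold_right Rmult 1 (map (factor i x) (seq (S a) len))).
      { intros x. unfold Rdiv. ring. }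
      destruct (_ && _)%bool eqn:B.
      * destruct len as [|len].
        -- exfalso. apply andb_prop in B. destruct B as [B1 B2].
           apply Nat.leb_le in B1. apply Nat.ltb_lt in B2. lia.
        -- simpl pred in *. apply (is_poly_mul_linear len _ (- xi a / (xi i - xi a)) (/ (xi i - xi a))) in IH.
          exact IH.
      * apply (is_poly_mul_linear len _ (- xi a / (xi i - xi a)) (/ (xi i - xi a))) in IH. exact IH.
Qed.

Lemma lagrange_basis_poly i : (1 <= i <= q)%nat -> is_poly (q - 1) (lagrange_basis q xi i).
Proof.
  intros Hi. generalize (lagrange_product_poly i 1 q).
  assert (E : (Nat.leb 1 i && Nat.ltb i (1 + q))%bool = true).
  { destruct (Nat.leb_spec 1 i), (Nat.ltb_spec i (1 + q)); simpl; lia || reflexivity. }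
  rewrite E. replace (pred q) with (q - 1)%nat by lia. auto.
Qed.

Lemma lagrange_basis_node i j : (1 <= i <= q)%nat -> (1 <= j <= q)%nat ->
  lagrange_basis q xi i (xi j) = if Nat.eqb j i then 1 else 0.
Proof.
  intros Hi Hj. unfold lagrange_basis. destruct (Nat.eqb_spec j i) as [->|Hn].
  - assert (A : forall l, (forall k, In k l -> (1 <= k <= q)%nat) ->
    fold_right Rmult 1 (map (factor i (xi i)) l) = 1).
    { induction l as [|k l IH]; intros H; simpl; auto. rewrite IH by (intros; apply H; simpl; auto).
      unfold factor. destruct (Nat.eqb_spec k i); [ring|]. field.
      apply Rminus_eq_contra, gauss_nodes_distinct; auto. apply H; simpl; auto. }
    apply A. intros k Hk. apply in_seq in Hk. lia.
  - assert (A : forall l, In j l -> fold_right Rmult 1 (map (factor i (xi j)) l) = 0).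
    { induction l as [|k l IH]; simpl; [tauto|]. intros [->|H].
      - unfold factor. destruct (Nat.eqb_spec j i); [tauto|]. unfold Rdiv. rewrite Rminus_diag. ring.
      - rewrite IH by auto. ring. }
    apply A. apply in_seq. lia.
Qed.

Lemma is_poly_sum n (f : nat -> R -> R) (c : nat -> R) l : (forall i, (1 <= i <= l)%nat -> is_poly n (f i)) ->
  is_poly n (fun x => rsum (fun i => c i * f i x) 1 l).
Proof.
  induction l as [|l IH]; intros H.
  - apply is_poly_ext with (fun _ => 0); [intros; rewrite rsum_0; auto|]. apply is_poly_const.
  - apply is_poly_ext with (fun x => rsum (fun i => c i * f i x) 1 l + c (S l) * f (S l) x).
    { intros x. rewrite rsum_S. reflexivity. }
    apply is_poly_lin; [apply IH; intros; apply H; lia|apply H; lia].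
Qed.

Lemma rsum_delta (f : nat -> R) j n : (1 <= j <= n)%nat ->
  rsum (fun i => f i * (if Nat.eqb j i then 1 else 0)) 1 n = f j.
Proof.
  assert (Z : forall n, (n < j)%nat -> rsum (fun i => f i * (if Nat.eqb j i then 1 else 0)) 1 n = 0).
  { induction n0 as [|k IH]; intros H; [apply rsum_0|]. rewrite rsum_S, IH by lia.
    destruct (Nat.eqb_spec j (S k)); [lia|]. rring. }
  induction n as [|n IH]; intros H; [lia|]. rewrite rsum_S.
  destruct (Nat.eqb_spec j (S n)) as [->|E].
  - rewrite Z by lia. rring.
  - rewrite IH by lia. rring.
Qed.

(** The difference of both sides has degree at most [q - 1] and vanishes at the [q] distinct
    nodes. *)
Lemma lagrange_reproduces k x : (k < q)%nat ->
  x ^ k = rsum (fun i => xi i ^ k * lagrange_basis q xi i x) 1 q.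
Proof.
  intros Hk.
  set (f := fun x => x ^ k + (-1) * rsum (fun i => xi i ^ k * lagrange_basis q xi i x) 1 q).
  assert (F : f x = 0).
  { apply (is_poly_roots (q - 1) f xi).
    - apply is_poly_lin.
      + apply is_poly_le with k; [lia|apply is_poly_pow].
      + apply is_poly_sum. apply lagrange_basis_poly.
    - intros i j Hi Hj. apply gauss_nodes_distinct; lia.
    - intros j Hj. unfold f.
      rewrite (sum_n_m_ext_loc (G := R_AbelianMonoid) _ (fun i => xi i ^ k * (if Nat.eqb j i then 1 else 0))).
      + rewrite rsum_delta by lia. ring.
      + intros i Hi. rewrite lagrange_basis_node by lia. reflexivity. }
  unfold f in F. lra.
Qed.

Lemma is_RInt_pow k : is_RInt (fun x => x ^ k) (-1) 1 ((1 - (-1) ^ S k) / INR (S k)).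
Proof.
  assert (Hn : INR (S k) <> 0) by (apply not_0_INR; lia).
  replace ((1 - (-1) ^ S k) / INR (S k)) with (minus (1 ^ S k / INR (S k)) ((-1) ^ S k / INR (S k))).
  2:{ rewrite pow1. unfold minus, plus, opp; simpl. field. auto. }
  apply (is_RInt_derive (V := R_CompleteNormedModule) (fun x => x ^ S k / INR (S k)) (fun x => x ^ k)).
  - intros x _. auto_derive; auto. simpl pred. field. auto.
  - intros x _. apply (is_poly_continuous k). apply is_poly_pow.
Qed.

Lemma gauss_moment_interpolatory k : (k < q)%nat ->
  rsum (fun i => w i * xi i ^ k) 1 q = (1 - (-1) ^ S k) / INR (S k).
Proof.
  intros Hk. rewrite <- (is_RInt_unique _ _ _ _ (is_RInt_pow k)).
  symmetry. apply is_RInt_unique.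
  apply (is_RInt_ext (fun x => rsum (fun i => xi i ^ k * lagrange_basis q xi i x) 1 q)).
  { intros x _. rewrite <- lagrange_reproduces; auto. }
  assert (A : forall l, (l <= q)%nat ->
    is_RInt (fun x => rsum (fun i => xi i ^ k * lagrange_basis q xi i x) 1 l) (-1) 1
    (rsum (fun i => w i * xi i ^ k) 1 l)).
  { induction l as [|l IH]; intros Hl.
    - apply (is_RInt_ext (fun _ => 0)); [intros; rewrite rsum_0; auto|]. rewrite rsum_0.
      generalize (is_RInt_const (V := R_NormedModule) (-1) 1 0). unfold scal; simpl; unfold mult; simpl.
      rewrite Rmult_0_r. auto.
    - apply (is_RInt_ext (fun x => plus (rsum (fun i => xi i ^ k * lagrange_basis q xi i x) 1 l)
      (scal (xi (S l) ^ k) (lagrange_basis q xi (S l) x)))).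
      { intros; rewrite rsum_S; auto. }
      rewrite rsum_S. apply (is_RInt_plus (V := R_NormedModule)); [apply IH; lia|].
      rewrite Rmult_comm. apply (is_RInt_scal (V := R_NormedModule)).
      destruct Hg as [_ [_ Hw]]. rewrite Hw by lia. apply (RInt_correct (V := R_CompleteNormedModule)).
      apply (ex_RInt_continuous (V := R_CompleteNormedModule)). intros x _.
      apply (is_poly_continuous (q - 1)). apply lagrange_basis_poly. lia. }
  apply A. lia.
Qed.

(* Beyond the interpolatory range the only cases are [q <= 3], where the vanishing of
   the Legendre polynomial at the nodes reduces the degree. *)
Lemma gauss_moment m k : (m = 2 \/ m = 3 \/ m = 4)%nat -> ((m + 1) / 2 <= q)%nat -> (k < m)%nat ->
  rsum (fun i => w i * xi i ^ k) 1 q = (1 - (-1) ^ S k) / INR (S k).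
Proof.
  intros Hm Hq Hk. destruct (lt_dec k q) as [h|h]; [apply gauss_moment_interpolatory; auto|].
  assert (R : forall c l, (l < q)%nat -> (forall i, (1 <= i <= q)%nat -> xi i ^ k = c * xi i ^ l) ->
     rsum (fun i => w i * xi i ^ k) 1 q = c * ((1 - (-1) ^ S l) / INR (S l))).
  { intros c l Hl H. rewrite <- gauss_moment_interpolatory by auto.
    rewrite <- (sum_n_m_mult_l (K := R_Ring)). apply sum_n_m_ext_loc. intros i Hi. rewrite H by auto.
    unfold mult; simpl. ring. }
  destruct Hg as [Hz _].
  assert (Hz' : forall i, (1 <= i <= q)%nat -> legendre q (xi i) = 0) by (intros i Hi; apply Hz; auto).
  (* For [q] equal to 1, 2, 3 the nodes satisfy [x = 0], [x ^ 2 = 1 / 3] and [x ^ 3 = 3 / 5 * x]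
     respectively; hence the factors passed to [R] below. *)
  assert (C : ((q = 1 /\ k = 1) \/ (q = 2 /\ k = 2) \/ (q = 2 /\ k = 3) \/ (q = 3 /\ k = 3))%nat).
  { destruct Hm as [->|[->| ->]]; simpl in Hq; lia. }
  destruct C as [[E Ek]|[[E Ek]|[[E Ek]|[E Ek]]]]; rewrite Ek in *; rewrite E in Hz'; unfold legendre in Hz';
    cbn in Hz' .
  - rewrite (R 0 0%nat); [simpl; field|lia|]. intros i Hi. simpl. rewrite (Hz' i) by lia. ring.
  - rewrite (R (/ 3) 0%nat); [simpl; field|lia|]. intros i Hi. simpl. generalize (Hz' i ltac:(lia)). intros.
    nra.
  - rewrite (R (/ 3) 1%nat); [simpl; field|lia|]. intros i Hi. simpl. generalize (Hz' i ltac:(lia)). intros.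
    assert (F : xi i * xi i = / 3).
    { unfold Rdiv in H. apply Rmult_integral in H. destruct H as [H|H]; [lra|].
      exfalso; revert H; apply Rinv_neq_0_compat; lra. }
    rewrite Rmult_1_r, F. ring.
  - rewrite (R (3 / 5) 1%nat); [simpl; field|lia|]. intros i Hi. simpl. generalize (Hz' i ltac:(lia)). intros.
    nra.
Qed.

End Gauss.

(** * Exactness of the panel rule *)

Section Panel.

Variables (m q : nat) (xi w : nat -> R).
Hypothesis Hm : (m = 2 \/ m = 3 \/ m = 4)%nat.
Hypothesis Hq : ((m + 1) / 2 <= q)%nat.
Hypothesis Hg : is_gauss_legendre q xi w.

(** Stated with [is_RInt], so that exactness includes integrability and passes to sums without side
    conditions. *)
Definition exact_on (a b : R) (g : R -> C) : Prop := is_RInt (V := CR) g a b (gauss_rule q xi w a b g).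

Lemma gauss_node_inside a b i : a < b -> (1 <= i <= q)%nat -> a < (a + b) / 2 + (b - a) / 2 * xi i < b.
Proof. intros Hab Hi. destruct Hg as [H _]. destruct (H i Hi) as [H1 _]. split; nra. Qed.

Lemma gauss_rule_ext a b f g : a < b -> (forall x, a < x < b -> f x = g x) ->
  gauss_rule q xi w a b f = gauss_rule q xi w a b g.
Proof.
  intros Hab H. unfold gauss_rule. f_equal. apply csum_ext. intros i Hi. rewrite H; auto.
  apply gauss_node_inside; auto.
Qed.

Lemma gauss_rule_plus a b f g : gauss_rule q xi w a b (fun x => f x + g x)%C =
  (gauss_rule q xi w a b f + gauss_rule q xi w a b g)%C.
Proof.
  unfold gauss_rule. rewrite <- Cmult_plus_distr_l. f_equal. rewrite <- csum_plus. apply csum_ext. intros; ring.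
Qed.

Lemma gauss_rule_scal a b c f : gauss_rule q xi w a b (fun x => c * f x)%C = (c * gauss_rule q xi w a b f)%C.
Proof.
  unfold gauss_rule. rewrite (csum_ext _ (fun i => c * (RtoC (w i) * f ((a + b) / 2 +
    (b - a) / 2 * xi i)%R))%C) by (intros; ring).
  rewrite csum_mult. cring.
Qed.

Definition weight_sum : R := rsum (fun i => Rabs (w i)) 1 q.

Lemma weight_sum_pos : 0 <= weight_sum.
Proof.
  unfold weight_sum. clear. induction q as [|n IH]; [rewrite rsum_0; lra|]. rewrite rsum_S.
  apply Rplus_le_le_0_compat; [exact IH|apply Rabs_pos].
Qed.

Lemma gauss_rule_bound a b f M : a < b -> (forall x, a < x < b -> Cmod (f x) <= M) ->
  Cmod (gauss_rule q xi w a b f) <= (b - a) * (weight_sum / 2 * M).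
Proof.
  intros Hab H. unfold gauss_rule. rewrite Cmod_mult, Cmod_R, Rabs_right by lra.
  replace ((b - a) * (weight_sum / 2 * M)) with ((b - a) / 2 * (weight_sum * M)) by field.
  apply Rmult_le_compat_l; [lra|]. unfold weight_sum.
  rewrite <- (sum_n_m_mult_r (K := R_Ring)). apply csum_bound. intros i Hi.
  rewrite Cmod_mult, Cmod_R. apply Rmult_le_compat_l; [apply Rabs_pos|]. apply H, gauss_node_inside; auto.
Qed.

Lemma exact_ext a b f g : a < b -> (forall x, a < x < b -> f x = g x) -> exact_on a b f -> exact_on a b g.
Proof.
  intros Hab H Hf. unfold exact_on. rewrite <- (gauss_rule_ext a b f g Hab H).
  apply (is_RInt_ext (V := CR) f); auto. intros x Hx. rewrite Rmin_left, Rmax_right in Hx by lra. auto.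
Qed.

Lemma exact_plus a b f g : exact_on a b f -> exact_on a b g -> exact_on a b (fun x => f x + g x)%C.
Proof. intros Hf Hg'. unfold exact_on. rewrite gauss_rule_plus. apply is_RInt_Cplus; auto. Qed.

Lemma exact_scal a b c f : exact_on a b f -> exact_on a b (fun x => c * f x)%C.
Proof. intros Hf. unfold exact_on. rewrite gauss_rule_scal. apply is_RInt_Cmult; auto. Qed.

Lemma exact_zero a b : exact_on a b (fun _ => RtoC 0).
Proof.
  unfold exact_on, gauss_rule. rewrite csum_zero by (intros; ring).
  replace (RtoC ((b - a) / 2) * 0)%C with (RtoC (b - a) * RtoC 0)%C by ring.
  rewrite <- scal_R_Cmult. apply (is_RInt_const (V := CR)).
Qed.

Lemma exact_sum a b (f : nat -> R -> C) n : a < b -> (forall j, (1 <= j <= n)%nat -> exact_on a b (f j)) ->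
  exact_on a b (fun x => csum (fun j => f j x) 1 n).
Proof.
  intros Hab. induction n as [|n IH]; intros H.
  - apply exact_ext with (fun _ => RtoC 0); [auto|intros; rewrite csum_0; auto|apply exact_zero].
  - apply exact_ext with (fun x => csum (fun j => f j x) 1 n + f (S n) x)%C; auto.
    { intros; rewrite csum_S; auto. }
    apply exact_plus; [apply IH; intros; apply H; lia|apply H; lia].
Qed.

Lemma RtoC_csum (f : nat -> R) n :
  csum (fun i => RtoC (f i)) 1 n = RtoC (rsum f 1 n).
Proof.
  induction n as [|n IH]; [rewrite csum_0, rsum_0; reflexivity|].
  rewrite csum_S, rsum_S, IH, RtoC_plus. reflexivity.
Qed.

Lemma exact_power a b s k : a < b -> (k < m)%nat -> exact_on a b (fun x => RtoC ((x - s) ^ k)).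
Proof.
  intros Hab Hk. unfold exact_on, gauss_rule.
  rewrite (csum_ext _ (fun i => RtoC (w i * (((a + b) / 2 - s) + (b - a) / 2 * xi i) ^ k))).
  2:{ intros i _. rewrite <- RtoC_mult. do 3 f_equal. ring. }
  rewrite RtoC_csum, <- RtoC_mult.
  set (u := (a + b) / 2 - s). set (h := (b - a) / 2).
  assert (Mom : forall l, (l < m)%nat -> rsum (fun i => w i * xi i ^ l) 1 q = (1 - (-1) ^ S l) / INR (S l)).
  { intros l Hl. apply (gauss_moment q xi w Hg m); auto. }
  (* Binomial expansion about the panel centre. Degrees up to 3 suffice because [k < m <= 4]. *)
  assert (E : forall l, rsum (fun i => w i * (u + h * xi i) ^ 3) 1 l =
     u ^ 3 * rsum (fun i => w i * xi i ^ 0) 1 l + 3 * u ^ 2 * h * rsum (fun i => w i * xi i ^ 1) 1 l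
     + 3 * u * h ^ 2 * rsum (fun i => w i * xi i ^ 2) 1 l + h ^ 3 * rsum (fun i => w i * xi i ^ 3) 1 l
   /\ rsum (fun i => w i * (u + h * xi i) ^ 2) 1 l =
     u ^ 2 * rsum (fun i => w i * xi i ^ 0) 1 l + 2 * u * h * rsum (fun i => w i * xi i ^ 1) 1 l
     + h ^ 2 * rsum (fun i => w i * xi i ^ 2) 1 l
   /\ rsum (fun i => w i * (u + h * xi i) ^ 1) 1 l =
     u * rsum (fun i => w i * xi i ^ 0) 1 l + h * rsum (fun i => w i * xi i ^ 1) 1 l
   /\ rsum (fun i => w i * (u + h * xi i) ^ 0) 1 l = rsum (fun i => w i * xi i ^ 0) 1 l).
  { induction l as [|l [I3 [I2 [I1 I0]]]]; [rewrite !rsum_0; repeat split; rring|].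
    rewrite !rsum_S, I3, I2, I1, I0. repeat split; rring. }
  destruct (E q) as [E3 [E2 [E1 E0]]].
  set (Fk := fun x => (x - s) ^ S k / INR (S k)).
  assert (Hn : INR (S k) <> 0) by (apply not_0_INR; lia).
  assert (I : is_RInt (fun x => (x - s) ^ k) a b (Fk b - Fk a)).
  { apply (is_RInt_derive (V := R_CompleteNormedModule) Fk (fun x => (x - s) ^ k)).
    - intros x _. unfold Fk. auto_derive; auto. cbv [pred]. replace (x + - s) with (x - s) by ring. field. auto.
    - intros x _. apply (continuous_comp (fun x => x - s) (fun y => y ^ k)).
      + apply (continuous_minus (V := R_NormedModule)); [apply continuous_id|apply continuous_const].
      + apply (is_poly_continuous k). apply is_poly_pow. }
  assert (V : h * rsum (fun i => w i * (u + h * xi i) ^ k) 1 q = Fk b - Fk a).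
  { assert (Hk4 : (k = 0 \/ k = 1 \/ k = 2 \/ k = 3)%nat) by lia. unfold Fk.
    destruct Hk4 as [->|[->|[->| ->]]].
    - rewrite E0, (Mom 0%nat) by lia. unfold h; simpl; field.
    - rewrite E1, (Mom 0%nat), (Mom 1%nat) by lia. unfold h, u; simpl; field.
    - rewrite E2, (Mom 0%nat), (Mom 1%nat), (Mom 2%nat) by lia. unfold h, u; simpl; field.
    - rewrite E3, (Mom 0%nat), (Mom 1%nat), (Mom 2%nat), (Mom 3%nat) by lia. unfold h, u; simpl; field. }
  rewrite V.
  apply (is_RInt_fct_extend_pair (U := R_NormedModule) (V :=
    R_NormedModule) (fun x => RtoC ((x - s) ^ k)) a b (Fk b - Fk a) 0 I).
  replace 0 with ((b - a) * 0) by ring. apply (is_RInt_const (V := R_NormedModule)).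
Qed.

(** With its knot outside the open panel a truncated power is either a full power or zero there. *)
Lemma exact_truncated_power a b y h : a < b -> 0 < h -> ~ (a < y < b) ->
  exact_on a b (fun x => RtoC (Rmax 0 ((x - y) / h) ^ (m - 1))).
Proof.
  intros Hab Hh Hy. destruct (Rle_dec y a) as [H|H].
  - apply exact_ext with (fun x => RtoC ((/ h) ^ (m - 1)) * RtoC ((x - y) ^ (m - 1)))%C; auto.
    + intros x Hx. rewrite <- RtoC_mult, <- Rpow_mult_distr. do 2 f_equal.
      rewrite Rmax_right; [field; lra|]. apply Rmult_le_pos; [lra|left; apply Rinv_0_lt_compat; auto].
    + apply exact_scal, exact_power; auto. lia.
  - apply exact_ext with (fun _ => RtoC 0); auto; [|apply exact_zero].
    intros x Hx. f_equal. rewrite Rmax_left.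
    + rewrite pow_i; [auto|lia].
    + apply Rmult_le_reg_r with h; auto. replace ((x - y) / h * h) with (x - y) by (field; lra). lra.
Qed.

Lemma exact_cardinal_spline a b (z : R -> R) h : a < b -> 0 < h ->
  (forall r, (r <= m)%nat -> exists y, ~ (a < y < b) /\ forall x, z x + INR m / 2 - INR r = (x - y) / h) ->
  exact_on a b (fun x => RtoC (cardinal_spline m (z x))).
Proof.
  intros Hab Hh H.
  assert (A : forall l, (l <= m)%nat ->
    exact_on a b (fun x => RtoC (sum_f_R0 (fun r => (-1) ^ r * Binomial.C m r
                     * Rmax 0 (z x + INR m / 2 - INR r) ^ (m - 1)) l))).
  { assert (T : forall r, (r <= m)%nat ->
    exact_on a b (fun x => RtoC ((-1) ^ r * Binomial.C m r * Rmax 0 (z x + INR m / 2 - INR r) ^ (m - 1)))).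
    { intros r Hr. destruct (H r Hr) as [y [Hy E]].
      apply exact_ext with (fun x => RtoC ((-1) ^ r * Binomial.C m r) * RtoC (Rmax 0 ((x - y) / h)
        ^ (m - 1)))%C; auto.
      - intros x _. rewrite <- RtoC_mult, E. auto.
      - apply exact_scal, exact_truncated_power; auto. }
    induction l as [|l IH]; intros Hl; [apply T; auto|].
    apply exact_ext with (fun x => RtoC (sum_f_R0 (fun r => (-1) ^ r * Binomial.C m r
                     * Rmax 0 (z x + INR m / 2 - INR r) ^ (m - 1))%R l) +
                       RtoC ((-1) ^ S l * Binomial.C m (S l) * Rmax 0 (z x +
                         INR m / 2 - INR (S l)) ^ (m - 1))%R)%C; auto.
    - intros x _. rewrite tech5, RtoC_plus. auto.
    - apply exact_plus; [apply IH; lia|apply T; auto]. }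
  apply exact_ext with (fun x => RtoC (/ INR (fact (m - 1))) * RtoC (sum_f_R0 (fun r => (-1)
    ^ r * Binomial.C m r
                     * Rmax 0 (z x + INR m / 2 - INR r) ^ (m - 1))%R m))%C; auto.
  - intros x _. rewrite <- RtoC_mult. reflexivity.
  - apply exact_scal, A. auto.
Qed.

(* The rule is exact on [v] alone, so only the increment [g - g a] of the kernel
   contributes to the error for [g v]. *)
Lemma panel_error a b (g v : R -> C) e M l : a < b -> exact_on a b v -> 0 <= M ->
  (forall x, a <= x <= b -> Cmod (g x - g a)%C <= e) -> (forall x, Cmod (v x) <= M) ->
  is_RInt (V := CR) (fun x => g x * v x)%C a b l ->
  Cmod (l - gauss_rule q xi w a b (fun x => g x * v x)%C)%C <= (b - a) * ((1 + weight_sum / 2) * (e * M)).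
Proof.
  intros Hab Hv HM He HvM Hl.
  assert (Hb : forall x, a <= x <= b -> Cmod ((g x - g a) * v x)%C <= e * M).
  { intros x Hx. rewrite Cmod_mult. apply Rmult_le_compat; auto; apply Cmod_ge_0. }
  assert (I : is_RInt (V := CR) (fun x => (g x - g a) * v x)%C a b (l - g a * gauss_rule q xi w a b v)%C).
  { apply (is_RInt_ext (V := CR) (fun x => g x * v x - g a * v x)%C); [intros; cring|].
    apply is_RInt_Cminus; auto. apply is_RInt_Cmult; auto. }
  assert (G : gauss_rule q xi w a b (fun x => g x * v x)%C =
    (gauss_rule q xi w a b (fun x => (g x - g a) * v x) + g a * gauss_rule q xi w a b v)%C).
  { rewrite <- gauss_rule_scal, <- gauss_rule_plus. apply gauss_rule_ext; auto. intros; ring. }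
  rewrite G.
  replace (l - _)%C with ((l - g a * gauss_rule q xi w a b v) - gauss_rule q xi w a b (fun x => (g x - g a)
    * v x))%C by ring.
  eapply Rle_trans; [apply Cmod_sub_le|].
  generalize (is_RInt_C_bound _ a b _ (e * M) ltac:(lra) Hb I).
  generalize (gauss_rule_bound a b (fun x => (g x - g a) * v x)%C (e * M) Hab ltac:(intros; apply Hb; lra)).
  lra.
Qed.

(** * The composite rule on a panel partition *)

Section Partition.

Variables (gam : R -> C) (nd : nat) (thd : nat -> R) (n : nat) (rho : R) (N : nat) (x : nat -> R).
Hypothesis Hgam : is_contour gam.
Hypothesis Hj : is_jump_set nd thd.
Hypothesis Hn : (4 <= n)%nat.
Hypothesis Hrho : 0 <= rho < mesh n.
Hypothesis Hx : is_panel_partition nd thd m n rho N x.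

Definition panelwise_exact (v : C -> C) : Prop :=
  forall i, (i < N)%nat -> exact_on (x i) (x (S i)) (fun th => v (gam th)).

Lemma partition_mono i j : (i <= j <= N)%nat -> x i <= x j.
Proof.
  intros [Hij HjN]. induction Hij as [|j Hij IH]; [lra|].
  destruct Hx as [_ [_ [H _]]]. generalize (H j ltac:(lia)) (IH ltac:(lia)). lra.
Qed.

Lemma partition_range i : (i <= N)%nat -> 0 <= x i <= 2 * PI.
Proof.
  intros Hi. destruct Hx as [H0 [H1 _]].
  generalize (partition_mono 0 i ltac:(lia)) (partition_mono i N ltac:(lia)). lra.
Qed.

Lemma partition_gap i j : (i < N)%nat -> (j <= N)%nat -> ~ (x i < x j < x (S i)).
Proof.
  intros Hi Hj' H. destruct (le_lt_dec j i) as [h|h].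
  - generalize (partition_mono j i ltac:(lia)). lra.
  - generalize (partition_mono (S i) j ltac:(lia)). lra.
Qed.

Lemma exact_spline u : in_S gam m n rho u -> panelwise_exact u.
Proof.
  intros [c Hc] i Hi. destruct Hx as [H0 [H1 [H2 [H3 H4]]]]. assert (Hab := H2 i Hi).
  generalize (partition_range i ltac:(lia)) (partition_range (S i) ltac:(lia)); intros Ra Rb.
  assert (Hh : 0 < mesh n) by (apply mesh_pos; lia). assert (Hhn := mesh_n n ltac:(lia)).
  apply exact_ext with (fun th => csum (fun j => c j *
     (RtoC (cardinal_spline m ((th - node n rho j) / mesh n + INR n)) +
       RtoC (cardinal_spline m ((th - node n rho j) / mesh n))
      + RtoC (cardinal_spline m ((th - node n rho j) / mesh n - INR n))))%C 1 n); auto.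
  { intros th Hth. rewrite Hc by apply on_contour_param. apply csum_ext. intros j Hjn.
    rewrite B_per_param by (auto; lra). rewrite !RtoC_plus. auto. }
  assert (T : forall j (l : Z), (1 <= j)%nat ->
    exact_on (x i) (x (S i)) (fun th => RtoC (cardinal_spline m ((th - node n rho j) / mesh n +
      IZR l * INR n)))).
  { intros j l Hj1. apply exact_cardinal_spline with (mesh n); auto. intros r Hr.
    (* [Z] numbers the [r]-th knot of the [j]-th spline moved [l] periods to the left. Inside the
       open panel this knot would lie in [[0, 2 * PI]], hence be a partition point, against
       [partition_gap]. *)
    set (Z := (Z.of_nat j - 1 - l * Z.of_nat n + Z.of_nat r)%Z).
    exists (rho + (IZR Z - INR m / 2) * mesh n). split.
    - intros Hin. destruct (H4 Z) as [i' [Hi' E]]; [lra|]. apply (partition_gap i i' Hi Hi'). rewrite E. auto.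
    - intros th. unfold Z, node. rewrite plus_IZR, !minus_IZR, mult_IZR, <- !INR_IZR_INZ. field. lra. }
  apply exact_sum; auto. intros j Hjn. apply exact_scal. apply exact_plus; [apply exact_plus|].
  - eapply exact_ext; [auto| |apply (T j 1%Z); lia]. intros th _; cbv beta. rewrite Rmult_1_l; auto.
  - eapply exact_ext; [auto| |apply (T j 0%Z); lia]. intros th _; cbv beta. rewrite Rmult_0_l, Rplus_0_r; auto.
  - eapply exact_ext; [auto| |apply (T j (-1)%Z); lia]. intros th _; cbv beta. do 2 f_equal. ring.
Qed.

(** Jump parameters are partition points, so each step is constant inside a panel and only an affine
    function remains, of degree below [m]. *)
Lemma exact_J_part v : panelwise_exact (J_part gam nd thd v).
Proof.
  intros i Hi. destruct Hx as [H0 [H1 [H2 [H3 H4]]]]. assert (Hab := H2 i Hi).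
  generalize (partition_range i ltac:(lia)) (partition_range (S i) ltac:(lia)) PI_RGT_0; intros Ra Rb HP.
  apply exact_ext with (fun th => csum (fun j => jump gam v (thd j) * RtoC (step (thd j)
    th - th / (2 * PI)))%C 1 nd); auto.
  { intros th Hth. rewrite J_part_param by (auto; lra). auto. }
  apply exact_sum; auto. intros j Hjn. apply exact_scal.
  assert (Hc : forall c, exact_on (x i) (x (S i)) (fun th => RtoC (c - th / (2 * PI)))).
  { intros c. apply exact_ext with (fun th => RtoC c * RtoC ((th - 0) ^ 0) +
    RtoC (- / (2 * PI)) * RtoC ((th - 0) ^ 1))%C; auto.
    - intros th _. rewrite <- !RtoC_mult, <- RtoC_plus. f_equal. simpl. field. lra.
    - apply exact_plus; apply exact_scal, exact_power; auto; lia. }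
  destruct (H3 j Hjn) as [i' [Hi' E]].
  destruct (Rle_dec (thd j) (x i)) as [h|h].
  - eapply exact_ext; [auto| |apply (Hc 1)]. intros th Hth. unfold step.
    destruct (Rle_dec th (thd j)); [lra|auto].
  - eapply exact_ext; [auto| |apply (Hc 0)]. intros th Hth. unfold step. destruct (Rle_dec th (thd j)); auto.
    exfalso. apply (partition_gap i i' Hi Hi'). rewrite E. lra.
Qed.

Lemma panelwise_exact_plus u v : panelwise_exact u -> panelwise_exact v ->
  panelwise_exact (fun t => u t + v t)%C.
Proof. intros Hu Hv i Hi. apply exact_plus; [apply Hu|apply Hv]; auto. Qed.

Lemma partition_sum_le (f : nat -> C) B : (forall i, (i < N)%nat -> Cmod (f (S i)) <= (x (S i) - x i) * B) ->
  Cmod (csum f 1 N) <= 2 * PI * B.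
Proof.
  intros H. destruct Hx as [H0 [H1 _]].
  assert (A : forall l, (l <= N)%nat -> Cmod (csum f 1 l) <= (x l - x 0%nat) * B).
  { induction l as [|l IH]; intros Hl.
    - rewrite csum_0, Cmod_0. right. ring.
    - rewrite csum_S. eapply Rle_trans; [apply Cmod_triangle|]. generalize (IH ltac:(lia)) (H l ltac:(lia)).
      lra. }
  generalize (A N (le_n _)). rewrite H0, H1, Rminus_0_r. auto.
Qed.

Lemma partition_RInt (f : R -> C) : ex_RInt (V := CR) f 0 (2 * PI) ->
  (forall i, (i < N)%nat -> ex_RInt (V := CR) f (x i) (x (S i))) /\
  is_RInt (V := CR) f 0 (2 * PI) (csum (fun i => RInt (V := CR) f (x (i - 1)%nat) (x i)) 1 N).
Proof.
  intros H. destruct Hx as [H0 [H1 _]].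
  assert (P : forall i, (i < N)%nat -> ex_RInt (V := CR) f (x i) (x (S i))).
  { intros i Hi. generalize (partition_range i ltac:(lia)) (partition_range (S i) ltac:(lia))
    (partition_mono i (S i) ltac:(lia)); intros.
    apply (ex_RInt_Chasles_1 (V := CR)) with (2 * PI); [lra|].
    apply (ex_RInt_Chasles_2 (V := CR)) with 0; [lra|auto]. }
  split; auto.
  assert (A : forall l, (l <= N)%nat ->
    is_RInt (V := CR) f (x 0%nat) (x l) (csum (fun i => RInt (V := CR) f (x (i - 1)%nat) (x i)) 1 l)).
  { induction l as [|l IH]; intros Hl.
    - rewrite csum_0. apply (is_RInt_point (V := CR)).
    - rewrite csum_S. apply (is_RInt_Chasles (V := CR)) with (x l); [apply IH; lia|].
      replace (S l - 1)%nat with l by lia. apply (RInt_correct (V := CR)). apply P; lia. }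
  generalize (A N (le_n _)). rewrite H0, H1. auto.
Qed.

Definition panel_rule (g : R -> C) : C :=
  csum (fun i => gauss_rule q xi w (x (i - 1)%nat) (x i) g) 1 N.

Lemma panel_rule_error (g : R -> C) v e M l : panelwise_exact v -> bounded_by M (fun th => v (gam th)) ->
  (forall i th, (i < N)%nat -> x i <= th <= x (S i) -> Cmod (g th - g (x i))%C <= e) ->
  is_RInt (V := CR) (fun th => g th * v (gam th))%C 0 (2 * PI) l ->
  Cmod (l - panel_rule (fun th => g th * v (gam th))%C)%C <= 2 * PI * ((1 + weight_sum / 2) * (e * M)).
Proof.
  intros Hv HM He Hl. destruct (partition_RInt _ (ex_intro _ l Hl)) as [P1 P2].
  rewrite <- (is_RInt_unique (V := CR) _ _ _ _ Hl), (is_RInt_unique (V := CR) _ _ _ _ P2).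
  unfold panel_rule. rewrite <- csum_minus. apply partition_sum_le. intros i Hi.
  replace (S i - 1)%nat with i by lia. destruct Hx as [_ [_ [H2 _]]].
  apply panel_error; auto.
  - apply (bounded_by_pos _ _ HM).
  - apply (RInt_correct (V := CR)). apply P1; auto.
Qed.

Lemma panel_rule_bound (g : R -> C) M : (forall th, Cmod (g th) <= M) ->
  Cmod (panel_rule g) <= 2 * PI * (weight_sum / 2 * M).
Proof.
  intros H. apply partition_sum_le. intros i Hi. replace (S i - 1)%nat with i by lia.
  destruct Hx as [_ [_ [H2 _]]].
  apply gauss_rule_bound; auto.
Qed.

Lemma panel_rule_plus f g : panel_rule (fun th => f th + g th)%C = (panel_rule f + panel_rule g)%C.
Proof. unfold panel_rule. rewrite <- csum_plus. apply csum_ext. intros. apply gauss_rule_plus. Qed.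

Lemma panel_rule_scal c f : panel_rule (fun th => c * f th)%C = (c * panel_rule f)%C.
Proof. unfold panel_rule. rewrite <- csum_mult. apply csum_ext. intros. apply gauss_rule_scal. Qed.

Lemma panel_rule_ext f g : (forall th, f th = g th) -> panel_rule f = panel_rule g.
Proof. intros H. unfold panel_rule, gauss_rule. apply csum_ext. intros. f_equal. apply csum_ext. intros.
rewrite H. auto. Qed.

End Partition.

End Panel.

(** * Stability of the discrete equation *)

Lemma Rpower_le_exponent x a b : 0 < x <= 1 -> a <= b -> Rpower x b <= Rpower x a.
Proof.
  intros Hx Hab. unfold Rpower.
  assert (H0 : ln x <= 0) by (rewrite <- ln_1; apply ln_le; lra).
  assert (H2 : b * ln x <= a * ln x) by nra.
  destruct (Rle_lt_or_eq_dec _ _ H2) as [h|h]; [left; apply exp_increasing; auto| rewrite h; lra].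
Qed.

Lemma Rpower_le_1 x a : 0 < x <= 1 -> 0 <= a -> Rpower x a <= 1.
Proof. intros Hx Ha. rewrite <- (Rpower_O x) by lra. apply Rpower_le_exponent; auto. Qed.

Lemma holder_ext s L f g : (forall x, f x = g x) -> holder s L f -> holder s L g.
Proof. intros H Hf x y Hxy. rewrite <- !H. apply Hf; auto. Qed.

Lemma holder_plus s L1 L2 f g : holder s L1 f -> holder s L2 g -> holder s (L1 + L2) (fun x => f x + g x)%C.
Proof.
  intros Hf Hg x y Hxy. replace (f x + g x - (f y + g y))%C with ((f x - f y) + (g x - g y))%C by ring.
  eapply Rle_trans; [apply Cmod_triangle|]. generalize (Hf x y Hxy) (Hg x y Hxy). lra.
Qed.

Lemma holder_scal s L c f : holder s L f -> holder s (Cmod c * L) (fun x => c * f x)%C.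
Proof.
  intros Hf x y Hxy. replace (c * f x - c * f y)%C with (c * (f x - f y))%C by ring.
  rewrite Cmod_mult, Rmult_assoc. apply Rmult_le_compat_l; [apply Cmod_ge_0|]. apply Hf; auto.
Qed.

Lemma bounded_plus M1 M2 f g : bounded_by M1 f -> bounded_by M2 g ->
  bounded_by (M1 + M2) (fun x => f x + g x)%C.
Proof. intros Hf Hg x. eapply Rle_trans; [apply Cmod_triangle|]. generalize (Hf x) (Hg x). lra. Qed.

Lemma bounded_scal M c f : bounded_by M f -> bounded_by (Cmod c * M) (fun x => c * f x)%C.
Proof. intros Hf x. rewrite Cmod_mult. apply Rmult_le_compat_l; [apply Cmod_ge_0|]. apply Hf; auto. Qed.

Lemma bounded_ext M f g : (forall x, f x = g x) -> bounded_by M f -> bounded_by M g.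
Proof. intros H Hf x. rewrite <- H. apply Hf; auto. Qed.

Lemma bounded_le M M' f : M <= M' -> bounded_by M f -> bounded_by M' f.
Proof. intros H Hf x. generalize (Hf x). lra. Qed.

Lemma Sup_pos (E : R -> Prop) : (forall x, E x -> 0 <= x) -> 0 <= Sup E.
Proof.
  intros H. unfold Sup. destruct (Lub_Rbar_correct E) as [H1 H2].
  destruct (Lub_Rbar E) as [l| |]; simpl; try lra.
  destruct (Rle_dec 0 l) as [h|h]; auto. exfalso.
  assert (F : Rbar_le l m_infty); [|exact F].
  apply H2. intros y Hy. generalize (H y Hy). specialize (H1 y Hy). simpl in H1. lra.
Qed.

(** [in_H] and the bound [M] make the two suprema finite, so that [H_norm] really dominates values
    and quotients; otherwise [Sup] could return [0]. *)
Lemma H_norm_spec gam s v M : in_H gam s v -> bounded_by M (fun x => v (gam x)) ->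
  (forall x, Cmod (v (gam x)) <= H_norm gam s v) /\
  forall x y, gam x <> gam y -> Cmod (v (gam x) - v (gam y))%C <=
    H_norm gam s v * Rpower (Cmod (gam x - gam y)%C) s.
Proof.
  intros [L HL] HM. unfold H_norm.
  set (SA := Sup (fun r => exists t, on_contour gam t /\ r = Cmod (v t))).
  set (SB := Sup (fun r => exists t u, on_contour gam t /\ on_contour gam u /\ t <> u /\
    r = Cmod (v t - v u)%C / Rpower (Cmod (t - u)%C) s)).
  assert (A : forall x, Cmod (v (gam x)) <= SA).
  { intros x. apply Sup_ge with M.
    - intros r [t [[y <-] ->]]. apply HM.
    - exists (gam x). split; auto. exists x; auto. }
  assert (A0 : 0 <= SA) by (eapply Rle_trans; [apply Cmod_ge_0|apply (A 0)]).
  assert (B0 : 0 <= SB).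
  { apply Sup_pos. intros r [t [u [_ [_ [_ ->]]]]]. apply Rmult_le_pos; [apply Cmod_ge_0|].
    left; apply Rinv_0_lt_compat, Rpower_pos. }
  split; [intros x; generalize (A x); lra|]. intros x y Hxy.
  assert (B : Cmod (v (gam x) - v (gam y))%C / Rpower (Cmod (gam x - gam y)%C) s <= SB).
  { apply Sup_ge with L.
    - intros r [t [u [Ht [Hu [Htu ->]]]]].
      apply Rmult_le_reg_r with (Rpower (Cmod (t - u)%C) s); [apply Rpower_pos|].
      unfold Rdiv. rewrite Rmult_assoc, Rinv_l, Rmult_1_r by (generalize (Rpower_pos (Cmod (t - u)%C) s); lra).
      auto.
    - exists (gam x), (gam y). repeat split; auto; eexists; reflexivity. }
  generalize (Rpower_pos (Cmod (gam x - gam y)%C) s); intros Hp. set (p := Rpower _ s) in *.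
  replace (Cmod (v (gam x) - v (gam y))%C) with (Cmod (v (gam x) - v (gam y))%C / p * p) by (field; lra).
  apply Rmult_le_compat_r; lra.
Qed.

Section Discrete.

Variables  (gam : R -> C) (nd : nat) (thd : nat -> R)
  (alpha beta mu : R) (k : C -> C -> C) (lam : C)
  (m : nat) (r Lr : R) (phase : nat -> R)
  (CPi : R) (N : nat -> nat) (x : nat -> nat -> R)
  (q : nat) (xi w : nat -> R).
Hypothesis Hgam : is_contour gam.
Hypothesis Hjumps : is_jump_set nd thd.
Hypothesis Hexp : 0 < beta /\ beta < alpha /\ alpha < mu /\ mu <= 1.
Hypothesis Hk : kernel_regular gam k mu.
Hypothesis Hker : forall v, in_X gam nd thd beta v ->
     solves_eq gam k lam (fun _ => RtoC 0) v ->
     eq_on gam v (fun _ => RtoC 0).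
Hypothesis Hm : m = 2%nat \/ m = 3%nat \/ m = 4%nat.
Hypothesis Hr : 0 < r <= 1.
Hypothesis HLr : 0 < Lr.
Hypothesis Ha : forall th eta, 0 <= th <= 2 * PI -> 0 <= eta <= 2 * PI ->
     let d := fun t => (a_ker gam k t th - a_ker gam k t eta)%C in
     in_H gam mu d /\
     H_norm gam mu d <= Lr * Rpower (Rabs (th - eta)) r.
Hypothesis Hphase : forall n, (4 <= n)%nat -> 0 <= phase n < mesh n.
Hypothesis Hpanels : forall n, (4 <= n)%nat ->
     is_panel_partition nd thd m n (phase n) (N n) (x n).
Hypothesis Hfine : forall n, (4 <= n)%nat -> forall i, (i < N n)%nat ->
     x n (S i) - x n i <= CPi * mesh n.
Hypothesis Hq : ((m + 1) / 2 <= q)%nat.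
Hypothesis Hgauss : is_gauss_legendre q xi w.

Let P := fun n => P_op gam m n (phase n).
Let Kq := fun n => Kq_op gam k q xi w (N n) (x n).

(** * Perturbation of the integral operator by quadrature *)

Lemma kernel_increment th eta : 0 <= th <= 2 * PI -> 0 <= eta <= 2 * PI ->
  (forall y, Cmod (a_ker gam k (gam y) th - a_ker gam k (gam y) eta)%C <= Lr * Rpower (Rabs (th - eta)) r) /\
  forall y z, gam y <> gam z -> Cmod ((a_ker gam k (gam y) th - a_ker gam k (gam y) eta) - (a_ker gam k (gam z)
    th - a_ker gam k (gam z) eta))%C
    <= Lr * Rpower (Rabs (th - eta)) r * Rpower (Cmod (gam y - gam z)%C) mu.
Proof.
  intros H1 H2. destruct (Ha th eta H1 H2) as [Hin Hle].
  destruct (a_ker_bounds gam k mu Hgam Hk ltac:(lra)) as [M [HM [HMb _]]].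
  destruct (H_norm_spec gam mu _ (M + M) Hin) as [A B].
  { intros y. eapply Rle_trans; [apply Cmod_sub_le|]. generalize (HMb y th) (HMb y eta). lra. }
  split.
  - intros y. eapply Rle_trans; [apply (A y)|]. auto.
  - intros y z Hyz. eapply Rle_trans; [apply (B y z Hyz)|]. apply Rmult_le_compat_r; auto.
    left; apply Rpower_pos.
Qed.

(** The restriction [th <> x n i] excludes [Rpower 0 r = 1]; at the left end the kernel increment is
    zero and is treated separately. *)
Lemma panel_increment n i th : (4 <= n)%nat -> (i < N n)%nat -> x n i <= th <= x n (S i) ->
  0 <= x n i <= 2 * PI /\ 0 <= th <= 2 * PI /\
  (th <> x n i -> Rpower (Rabs (th - x n i)) r <= Rpower CPi r * Rpower (mesh n) r).
Proof.
  intros Hn Hi Hth. generalize (partition_range m q Hm Hq nd thd n (phase n) (N n) (x n) Hn (Hpanels n Hn));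
    intros R.
  generalize (R i ltac:(lia)) (R (S i) ltac:(lia)); intros R1 R2. split; [lra|]. split; [lra|]. intros Hne.
  generalize (Hfine n Hn i Hi) (mesh_pos n ltac:(lia)); intros F Hh.
  assert (0 < CPi) by nra.
  rewrite Rpower_mult_distr by auto. rewrite Rabs_right by lra. apply Rpower_le_base; lra.
Qed.

Lemma Kq_diff n v y z : (Kq n v (gam y) - Kq n v (gam z))%C =
  panel_rule q xi w (N n) (x n) (fun th => (a_ker gam k (gam y) th - a_ker gam k (gam z) th) * v (gam th))%C.
Proof.
  transitivity (panel_rule q xi w (N n) (x n)
    (fun th => a_ker gam k (gam y) th * v (gam th) + RtoC (-1) * (a_ker gam k (gam z) th * v (gam th)))%C).
  - rewrite panel_rule_plus, panel_rule_scal, RtoC_m1. unfold Kq, Kq_op, panel_rule. cring.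
  - apply panel_rule_ext. intros th. rewrite RtoC_m1. ring.
Qed.

(** The increment of the error from [z] to [y] is itself a panel error, for the kernel difference.
    Its variation over a panel is a second difference of [a_ker], small in both variables at once;
    this is where the assumption in the norm of [H_mu] is used. *)
Lemma quadrature_error : exists K, 0 <= K /\ forall n v M, (4 <= n)%nat -> admissible gam v ->
  panelwise_exact q xi w gam (N n) (x n) v -> bounded_by M (fun y => v (gam y)) ->
  bounded_by (K * M * Rpower (mesh n) r) (fun y => K_op gam k v (gam y) - Kq n v (gam y))%C /\
  holder mu (K * M * Rpower (mesh n) r) (fun y => K_op gam k v (gam y) - Kq n v (gam y))%C.
Proof.
  destruct (speed_bounds _ Hgam) as [c [L [Hc [HL HcL]]]].
  assert (Hlip := gam_lipschitz gam L Hgam (fun x => proj2 (HcL x))).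
  generalize PI_RGT_0 (weight_sum_pos q w) (Rpower_pos CPi r) (Rpower_pos L mu); intros HP HW HC HLm.
  set (K0 := 2 * PI * ((1 + weight_sum q w / 2) * (Lr * Rpower CPi r))).
  assert (HK0 : 0 <= K0).
  { unfold K0. apply Rmult_le_pos; [lra|]. apply Rmult_le_pos; [lra|]. apply Rmult_le_pos; lra. }
  exists (K0 + K0 * Rpower L mu). split. { assert (0 <= K0 * Rpower L mu) by (apply Rmult_le_pos; lra). lra. }
  intros n v M Hn Hv He HM. assert (HM0 := bounded_by_pos _ _ HM).
  assert (Hp := Rpower_pos (mesh n) r).
  assert (HK1 : 0 <= K0 * M * Rpower (mesh n) r) by (apply Rmult_le_pos; [apply Rmult_le_pos|]; lra).
  assert (HK2 : 0 <= K0 * Rpower L mu * M * Rpower (mesh n) r) by (apply Rmult_le_pos; [apply Rmult_le_pos;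
    [apply Rmult_le_pos|]|]; lra).
  assert (HPos : 0 <= Lr * (Rpower CPi r * Rpower (mesh n) r)) by (apply Rmult_le_pos; [|apply Rmult_le_pos];
    lra).
  split.
  - intros y. apply Rle_trans with (2 * PI * ((1 +
    weight_sum q w / 2) * ((Lr * (Rpower CPi r * Rpower (mesh n) r)) * M))).
    2:{ apply Rle_trans with (K0 * M * Rpower (mesh n) r); [right; unfold K0; ring|lra]. }
    apply (panel_rule_error m q xi w Hm Hq Hgauss gam nd thd n (phase n) (N n) (x n) Hn (Hpanels n Hn)
      (a_ker gam k (gam y)) v); auto.
    2:{ apply (K_op_is_RInt gam k mu); auto. }
    intros i th Hi Hth. destruct (panel_increment n i th Hn Hi Hth) as [R1 [R2 R3]].
    destruct (Req_dec th (x n i)) as [->|Hne]; [rewrite Cmod_sub_refl; auto|].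
    eapply Rle_trans; [apply (kernel_increment th (x n i)); auto|].
    apply Rmult_le_compat_l; [lra|auto].
  - intros y z Hyz. destruct (Ceq_dec (gam y) (gam z)) as [->|Hne].
    { rewrite Cmod_sub_refl. apply Rmult_le_pos; [lra|left; apply Rpower_pos]. }
    assert (Hpz := Rpower_pos (z - y) mu).
    set (e := Lr * (Rpower CPi r * Rpower (mesh n) r) * (Rpower L mu * Rpower (z - y) mu)).
    assert (He0 : 0 <= e) by (unfold e; apply Rmult_le_pos; [lra|apply Rmult_le_pos; lra]).
    apply Rle_trans with (2 * PI * ((1 + weight_sum q w / 2) * (e * M))).
    2:{ apply Rle_trans with (K0 * Rpower L mu * M * Rpower (mesh n) r * Rpower (z - y) mu); [right;
      unfold K0, e; ring|].
        apply Rmult_le_compat_r; lra. }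
    replace (K_op gam k v (gam y) - Kq n v (gam y) - (K_op gam k v (gam z) - Kq n v (gam z)))%C with
      ((K_op gam k v (gam y) - K_op gam k v (gam z)) - (Kq n v (gam y) - Kq n v (gam z)))%C by ring.
    rewrite Kq_diff.
    apply (panel_rule_error m q xi w Hm Hq Hgauss gam nd thd n (phase n) (N n) (x n) Hn (Hpanels n Hn)
      (fun th => a_ker gam k (gam y) th - a_ker gam k (gam z) th)%C v); auto.
    2:{ apply (is_RInt_ext (V := CR) (fun th => a_ker gam k (gam y) th * v (gam th) - a_ker gam k (gam z)
      th * v (gam th))%C); [intros; cring|].
        apply is_RInt_Cminus; apply (K_op_is_RInt gam k mu); auto. }
    intros i th Hi Hth. destruct (panel_increment n i th Hn Hi Hth) as [R1 [R2 R3]].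
    destruct (Req_dec th (x n i)) as [->|Hnx]; [rewrite Cmod_sub_refl; auto|].
    replace (_ - _)%C with ((a_ker gam k (gam y) th - a_ker gam k (gam y) (x n i)) - (a_ker gam k (gam z)
      th - a_ker gam k (gam z) (x n i)))%C by ring.
    eapply Rle_trans; [apply (kernel_increment th (x n i)); auto|]. unfold e.
    apply Rmult_le_compat.
    + apply Rmult_le_pos; [lra|left; apply Rpower_pos].
    + left; apply Rpower_pos.
    + apply Rmult_le_compat_l; [lra|auto].
    + rewrite Rpower_mult_distr by lra. apply Rpower_le_base; [lra|]. split.
      * apply Cmod_gt_0. intros F. apply Hne. apply Cmod_sub_eq0. rewrite F. apply Cmod_0.
      * eapply Rle_trans; [apply Hlip|]. rewrite Rabs_left by lra. right; ring.
Qed.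

(** The discrete operators smooth like [K], uniformly in [n]: panel lengths add up to [2 * PI], the
    weights enter through [weight_sum], and the bounds of the kernel do the rest. *)
Lemma Kq_bounds : exists K, 0 <= K /\ forall n v M, (4 <= n)%nat -> bounded_by M (fun y => v (gam y)) ->
  bounded_by (K * M) (fun y => Kq n v (gam y)) /\ holder mu (K * M) (fun y => Kq n v (gam y)).
Proof.
  destruct (a_ker_bounds gam k mu Hgam Hk ltac:(lra)) as [M0 [HM0 [HMb HMh]]].
  generalize PI_RGT_0 (weight_sum_pos q w); intros HP HW.
  exists (2 * PI * (weight_sum q w / 2 * M0)). split; [apply Rmult_le_pos; [lra|apply Rmult_le_pos; lra]|].
  intros n v M Hn HM. assert (HMp := bounded_by_pos _ _ HM).
  assert (B := panel_rule_bound m q xi w Hm Hq Hgauss nd thd n (phase n) (N n) (x n) Hn (Hpanels n Hn)).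
  split.
  - intros y. replace (2 * PI * (weight_sum q w / 2 * M0) * M) with (2 * PI * (weight_sum q w / 2 * (M0 * M)))
    by ring.
    apply B. intros th. rewrite Cmod_mult. apply Rmult_le_compat; try apply Cmod_ge_0; [apply HMb|apply HM].
  - intros y z Hyz.
    replace (2 * PI * (weight_sum q w / 2 * M0) * M * Rpower (z - y) mu)
      with (2 * PI * (weight_sum q w / 2 * (M0 * Rpower (z - y) mu * M))) by ring.
    rewrite Kq_diff. apply B. intros th. rewrite Cmod_mult.
    apply Rmult_le_compat; try apply Cmod_ge_0; [apply (HMh th y z Hyz)|apply HM].
Qed.

Lemma Kq_lin n u v c t : Kq n (fun s => u s - c * v s)%C t = (Kq n u t - c * Kq n v t)%C.
Proof.
  change (panel_rule q xi w (N n) (x n) (fun th => a_ker gam k t th * (u (gam th) - c * v (gam th)))%C =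
    panel_rule q xi w (N n) (x n) (fun th => a_ker gam k t th * u (gam th))%C - c * panel_rule q xi w (N n)
      (x n) (fun th => a_ker gam k t th * v (gam th))%C)%C.
  rewrite (panel_rule_ext q xi w (N n) (x n) _ (fun th => a_ker gam k t th * u (gam th) +
    (- c) * (a_ker gam k t th * v (gam th)))%C) by (intros; ring).
  rewrite panel_rule_plus, panel_rule_scal. ring.
Qed.

Lemma Kq_plus n u v t : Kq n (fun s => u s + v s)%C t = (Kq n u t + Kq n v t)%C.
Proof.
  change (panel_rule q xi w (N n) (x n) (fun th => a_ker gam k t th * (u (gam th) + v (gam th)))%C =
    panel_rule q xi w (N n) (x n) (fun th => a_ker gam k t th * u (gam th))%C +
      panel_rule q xi w (N n) (x n) (fun th => a_ker gam k t th * v (gam th))%C)%C.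
  rewrite (panel_rule_ext q xi w (N n) (x n) _ (fun th => a_ker gam k t th * u (gam th) +
    (a_ker gam k t th * v (gam th)))%C) by (intros; ring).
  apply panel_rule_plus.
Qed.

Lemma Kq_sum n (f : nat -> C -> C) c l t : Kq n (fun s => csum (fun j => c j * f j s)%C 1 l) t =
  csum (fun j => c j * Kq n (f j) t)%C 1 l.
Proof.
  induction l as [|l IH].
  - rewrite csum_0. unfold Kq, Kq_op. apply csum_zero. intros i _. unfold gauss_rule.
    rewrite csum_zero; [ring|].
    intros l _. rewrite csum_0. ring.
  - rewrite csum_S, <- IH.
    change (panel_rule q xi w (N n) (x n) (fun th => a_ker gam k t th * csum (fun j => c j * f j (gam th))
      1 (S l))%C =
      panel_rule q xi w (N n) (x n) (fun th => a_ker gam k t th * csum (fun j => c j * f j (gam th)) 1 l)%C +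
      c (S l) * panel_rule q xi w (N n) (x n) (fun th => a_ker gam k t th * f (S l) (gam th))%C)%C.
    rewrite <- panel_rule_scal, <- panel_rule_plus. apply panel_rule_ext. intros th. rewrite csum_S. cring.
Qed.

(** * Discrete stability, solvability and error *)

Lemma mesh_power_small C e s : 0 <= C -> 0 < e -> 0 < s -> exists h0, 0 < h0 <= 1 /\
  forall n, (4 <= n)%nat -> mesh n < h0 -> C * Rpower (mesh n) s <= e.
Proof.
  intros HC He Hs. destruct (Rpower_small s C e Hs HC He) as [d [Hd H]].
  exists (Rmin d 1). split; [split; [apply Rmin_pos; lra|apply Rmin_r]|].
  intros n Hn Hm'. left. apply H. split; [apply mesh_pos; lia|]. eapply Rlt_le_trans; [exact Hm'|apply Rmin_l].
Qed.

(** A mu-Hoelder bound of [g] is required besides the uniform one, since [d] interpolates a function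
    that contains [g] and the interpolation error depends on its Hoelder constant. *)
Lemma discrete_stability : exists K h0, 0 <= K /\ 0 < h0 <= 1 /\ forall n d g G, (4 <= n)%nat -> mesh n < h0 ->
  in_S gam m n (phase n) d -> bounded_by G (fun y => g (gam y)) -> holder mu G (fun y => g (gam y)) ->
  (forall i, (1 <= i <= n)%nat -> d (gam (node n (phase n) i)) =
     (lam * Kq n d (gam (node n (phase n) i)) + g (gam (node n (phase n) i)))%C) ->
  bounded_by (K * G) (fun y => d (gam y)) /\ holder beta (K * G) (fun y => d (gam y)).
Proof.
  destruct (continuous_stability gam nd thd k lam mu beta Hgam Hjumps Hk ltac:(lra) Hker) as [A [HA HAs]].
  destruct quadrature_error as [KQ [HKQ HQ]]. destruct Kq_bounds as [KB [HKB HB]].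
  destruct (interpolation_estimates gam m Hgam Hm) as [K [HK HI]].
  assert (Hlam := Cmod_ge_0 lam). set (la := Cmod lam) in *.
  assert (HlB : 0 <= la * KB) by (apply Rmult_le_pos; auto).
  assert (HC1 : 0 <= A * (K * (la * KB))) by (apply Rmult_le_pos; auto; apply Rmult_le_pos; auto).
  assert (HC2 : 0 <= A * (la * KQ)) by (apply Rmult_le_pos; auto; apply Rmult_le_pos; auto).
  (* Interpolation and quadrature may each return at most a quarter of the supremum of [d]. *)
  destruct (mesh_power_small _ (/ 4) mu HC1 ltac:(lra) ltac:(lra)) as [h1 [Hh1 Hs1]].
  destruct (mesh_power_small _ (/ 4) r HC2 ltac:(lra) ltac:(lra)) as [h2 [Hh2 Hs2]].
  (* Absorbing the two quarters leaves [M / 2 <= A * (K + 1) * G]. *)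
  set (B := 2 * (A * (K + 1))).
  assert (HBp : 0 <= B) by (unfold B; apply Rmult_le_pos; [lra|apply Rmult_le_pos; lra]).
  assert (HlBB : 0 <= la * KB * B) by (apply Rmult_le_pos; auto).
  assert (HKl : 0 <= (K + 3) * (la * KB * B + 1)) by (apply Rmult_le_pos; lra).
  exists (B + (K + 3) * (la * KB * B + 1)), (Rmin h1 h2).
  split; [lra|]. split. { split; [apply Rmin_pos; lra|]. eapply Rle_trans; [apply Rmin_l|]; lra. }
  intros n d g G Hn Hmesh Hd Hgb Hgh Hnodes.
  assert (Hh : 0 < mesh n) by (apply mesh_pos; lia).
  assert (Hm1 : mesh n < h1) by (eapply Rlt_le_trans; [exact Hmesh|apply Rmin_l]).
  assert (Hm2 : mesh n < h2) by (eapply Rlt_le_trans; [exact Hmesh|apply Rmin_r]).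
  specialize (Hs1 n Hn Hm1). specialize (Hs2 n Hn Hm2).
  assert (HG := bounded_by_pos _ _ Hgb).
  destruct (in_S_bounded_lipschitz gam m Hgam Hm n (phase n) d Hn (Hphase n Hn) Hd) as [[M0 HM0] _].
  assert (Hadm := in_S_admissible gam m Hgam Hm n (phase n) d Hn (Hphase n Hn) Hd).
  (* The least upper bound is taken, because absorption needs a bound for [d] in terms of [M] to
     bound [M] itself. *)
  destruct (completeness (fun r => exists y, r = Cmod (d (gam y)))) as [M [HM1 HM2]].
  { exists M0. intros y [z ->]. apply HM0. }
  { exists (Cmod (d (gam 0))). exists 0. auto. }
  assert (HMb : bounded_by M (fun y => d (gam y))) by (intros y; apply HM1; exists y; auto).
  assert (HMp := bounded_by_pos _ _ HMb).
  set (z := fun t => (lam * Kq n d t + g t)%C).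
  set (Lz := la * (KB * M) + G).
  destruct (HB n d M Hn HMb) as [HB1 HB2].
  assert (Hzb : bounded_by Lz (fun y => z (gam y))) by (apply bounded_plus; auto; apply bounded_scal; auto).
  assert (Hzh : holder mu Lz (fun y => z (gam y))).
  { apply (holder_plus mu _ _ (fun y => lam * Kq n d (gam y))%C (fun y => g (gam y))); auto.
    apply (holder_scal mu _ lam (fun y => Kq n d (gam y))); auto. }
  assert (HLz := holder_pos _ _ _ Hzh).
  destruct (HI n (phase n) z d mu Lz Hn (Hphase n Hn) ltac:(lra) Hzh Hd Hnodes) as [I1 I2].
  destruct (HQ n d M Hn Hadm (exact_spline m q xi w Hm Hq Hgauss gam nd thd n (phase n) (N n) (x n)
    Hgam Hn (Hphase n Hn) (Hpanels n Hn) d Hd) HMb) as [HQ1 _].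
  assert (Hres : bounded_by (K * Lz * Rpower (mesh n) mu + la * (KQ * M * Rpower (mesh n) r) +
    G) (fun y => d (gam y) - lam * K_op gam k d (gam y))%C).
  { intros y. replace (d (gam y) - lam * K_op gam k d (gam y))%C with
      ((d (gam y) - z (gam y)) - lam * (K_op gam k d (gam y) - Kq n d (gam y)) + g (gam y))%C by (unfold z;
        ring).
    eapply Rle_trans; [apply Cmod_triangle|]. eapply Rle_trans; [apply Rplus_le_compat_r, Cmod_sub_le|].
    rewrite Cmod_mult. fold la.
    generalize (I1 y) (Rmult_le_compat_l _ _ _ Hlam (HQ1 y)) (Hgb y). lra. }
  assert (HAd := HAs d M _ Hadm HMb Hres).
  assert (HMle : M <= A * (K * Lz * Rpower (mesh n) mu + la * (KQ * M * Rpower (mesh n) r) + G)).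
  { apply HM2. intros y [y' ->]. apply HAd. }
  assert (Hmu1 : Rpower (mesh n) mu <= 1) by (apply Rpower_le_1; lra).
  assert (Hmu0 := Rpower_pos (mesh n) mu).
  assert (HMB : M <= B * G).
  { assert (E : A * (K * Lz * Rpower (mesh n) mu + la * (KQ * M * Rpower (mesh n) r) + G) =
      (A * (K * (la * KB)) * Rpower (mesh n) mu) * M + (A * (la * KQ) * Rpower (mesh n) r) * M +
        (A * K * G) * Rpower (mesh n) mu + A * G) by (unfold Lz; ring).
    rewrite E in HMle.
    assert (F1 : (A * (K * (la * KB)) * Rpower (mesh n) mu) * M <= / 4 * M) by (apply Rmult_le_compat_r; auto).
    assert (F2 : (A * (la * KQ) * Rpower (mesh n) r) * M <= / 4 * M) by (apply Rmult_le_compat_r; auto).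
    assert (F3 : (A * K * G) * Rpower (mesh n) mu <= (A * K * G) * 1) by (apply Rmult_le_compat_l; auto;
      apply Rmult_le_pos; auto; apply Rmult_le_pos; auto).
    unfold B. lra. }
  assert (HLzG : Lz <= (la * KB * B + 1) * G).
  { unfold Lz. generalize (Rmult_le_compat_l _ _ _ HlB HMB). lra. }
  assert (HKlG : 0 <= (K + 3) * (la * KB * B + 1) * G) by (apply Rmult_le_pos; auto).
  split.
  - apply bounded_le with M; auto. assert (0 <= B * G) by (apply Rmult_le_pos; auto). lra.
  (* The Hoelder bound comes last: the Hoelder constant [Lz] of [z] is controlled by the uniform
     bound just obtained, and [d - z] is an interpolation error. *)
  - assert (Hdh : holder beta (K * Lz * Rpower (mesh n) (mu - beta) + (Lz + 2 * Lz)) (fun y => d (gam y))).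
    { apply holder_ext with (fun y => (d (gam y) - z (gam y)) + z (gam y))%C; [intros; ring|].
      apply holder_plus; [apply I2; lra|]. apply holder_exponent with mu; auto. lra. }
    eapply holder_le; [|exact Hdh].
    assert (Hb1 : Rpower (mesh n) (mu - beta) <= 1) by (apply Rpower_le_1; lra).
    assert (F1 : K * Lz * Rpower (mesh n) (mu - beta) <= K * Lz * 1) by (apply Rmult_le_compat_l; auto;
      apply Rmult_le_pos; auto).
    assert (F2 : (K + 3) * Lz <= (K + 3) * ((la * KB * B + 1) * G)) by (apply Rmult_le_compat_l; auto; lra).
    assert (0 <= B * G) by (apply Rmult_le_pos; auto).
    lra.
Qed.

Lemma solves_discrete_nodes n f u : (4 <= n)%nat -> in_S gam m n (phase n) u ->
  (solves_discrete gam nd thd lam m n (phase n) (P n) (Kq n) f u <->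
   forall i, (1 <= i <= n)%nat -> u (gam (node n (phase n) i)) =
     (lam * Kq n u (gam (node n (phase n) i)) + (C_part gam nd thd f (gam (node n (phase n) i)) +
       lam * Kq n (J_part gam nd thd f) (gam (node n (phase n) i))))%C).
Proof.
  intros Hn Hu. assert (HP := fun v => P_op_spec gam m Hgam Hm n (phase n) v Hn (Hphase n Hn)).
  set (b := fun t => (C_part gam nd thd f t + lam * Kq n (J_part gam nd thd f) t)%C).
  destruct (HP (Kq n u)) as [HPS HPi]. destruct (HP b) as [HbS Hbi]. split.
  - intros [_ H] i Hi. specialize (H (gam (node n (phase n) i)) (on_contour_param _ _)). cbv beta in H.
    unfold P in H. rewrite (HPi i Hi) in H. fold b in H. rewrite (Hbi i Hi) in H. unfold b in H. rewrite <- H.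
    ring.
  - intros H. split; auto. apply (in_S_unique gam m Hgam Hm n (phase n)); auto.
    + apply in_S_lin; auto.
    + intros i Hi. unfold P. fold b. rewrite (HPi i Hi), (Hbi i Hi). rewrite (H i Hi). unfold b. ring.
Qed.

Lemma discrete_unique_solvability : exists h0, 0 < h0 <= 1 /\ forall n f, (4 <= n)%nat -> mesh n < h0 ->
  exists u, solves_discrete gam nd thd lam m n (phase n) (P n) (Kq n) f u /\
    forall u', solves_discrete gam nd thd lam m n (phase n) (P n) (Kq n) f u' -> eq_on gam u' u.
Proof.
  (* Stability with [g = 0] and [G = 0] gives injectivity of the nodal system, and a square
     injective system is solvable. *)
  destruct discrete_stability as [K [h0 [HK [Hh0 H]]]]. exists h0. split; auto. intros n f Hn Hmesh.
  assert (Hz : forall d, in_S gam m n (phase n) d ->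
    (forall i, (1 <= i <= n)%nat ->
      d (gam (node n (phase n) i)) = (lam * Kq n d (gam (node n (phase n) i)))%C) ->
    forall y, d (gam y) = RtoC 0).
  { intros d Hd Hi y. destruct (H n d (fun _ => RtoC 0) 0 Hn Hmesh Hd) as [Hb _].
    - intros z. rewrite Cmod_0. lra.
    - intros z z' _. rewrite Cmod_sub_refl. lra.
    - intros i Hi'. rewrite Hi by auto. ring.
    - apply Cmod_eq_0. generalize (Hb y) (Cmod_ge_0 (d (gam y))). cbv beta. lra. }
  set (Bj := fun j t => RtoC (B_per gam m n (phase n) j t)).
  set (b := fun i => (C_part gam nd thd f (gam (node n (phase n) i)) +
    lam * Kq n (J_part gam nd thd f) (gam (node n (phase n) i)))%C).
  assert (HA : forall c i, csum (fun j => (Bj j (gam (node n (phase n) i)) - lam * Kq n (Bj j)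
    (gam (node n (phase n) i))) * c j)%C 1 n
    = (spline_sum gam m n c (gam (node n (phase n) i)) (phase n)
      - lam * Kq n (fun t => spline_sum gam m n c t (phase n)) (gam (node n (phase n) i)))%C).
  { intros c i. unfold spline_sum. rewrite (Kq_sum n Bj c n), <- csum_mult, <- csum_minus.
    apply csum_ext. intros j _. unfold Bj. ring. }
  destruct (injective_system_solvable n (fun i j => Bj j (gam (node n (phase n) i)) - lam * Kq n (Bj j)
    (gam (node n (phase n) i)))%C) with (b := b) as [c Hc].
  { intros c Hc j Hj.
    assert (Hcj : Cmod (c j) <= 3 * 0).
    { apply (spline_coef_bound gam m Hgam Hm n (phase n)); auto. intros i Hi.
      rewrite (Hz (fun t => spline_sum gam m n c t (phase n))); [rewrite Cmod_0; lra|apply in_S_spline_sum|].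
      intros l Hl. specialize (Hc l Hl). rewrite HA in Hc.
      set (s1 := spline_sum _ _ _ _ _ _) in *. set (s2 := (lam * _)%C) in *.
      replace s1 with ((s1 - s2) + s2)%C by ring. rewrite Hc. ring. }
    apply Cmod_eq_0. generalize (Cmod_ge_0 (c j)). lra. }
  set (u := fun t => spline_sum gam m n c t (phase n)).
  assert (Hu : in_S gam m n (phase n) u) by apply in_S_spline_sum.
  assert (Hun : solves_discrete gam nd thd lam m n (phase n) (P n) (Kq n) f u).
  { apply solves_discrete_nodes; auto. intros i Hi. specialize (Hc i Hi). rewrite HA in Hc. fold (b i).
    unfold u at 1. set (s1 := spline_sum _ _ _ _ _ _) in *. fold u in Hc. set (s2 := (lam * _)%C) in *.
    replace s1 with ((s1 - s2) + s2)%C by ring. rewrite Hc. ring. }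
  exists u. split; auto. intros u' Hu'. assert (HuS := proj1 Hu').
  intros t [y <-].
  assert (E : (u' (gam y) - RtoC 1 * u (gam y))%C = RtoC 0).
  { apply (Hz (fun t => u' t - RtoC 1 * u t)%C); [apply in_S_lin; auto|].
    intros i Hi. rewrite Kq_lin. rewrite (proj1 (solves_discrete_nodes n f u' Hn HuS) Hu' i Hi).
    rewrite (proj1 (solves_discrete_nodes n f u Hn Hu) Hun i Hi). ring. }
  replace (u' (gam y)) with ((u' (gam y) - RtoC 1 * u (gam y)) + u (gam y))%C by ring. rewrite E. ring.
Qed.

Lemma discrete_error : exists K h0, 0 <= K /\ 0 < h0 <= 1 /\ forall n f phi u, (4 <= n)%nat -> mesh n < h0 ->
  in_X gam nd thd alpha f -> in_X gam nd thd beta phi -> solves_eq gam k lam f phi ->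
  solves_discrete gam nd thd lam m n (phase n) (P n) (Kq n) f u ->
  let err := fun t => (phi t - (u t + J_part gam nd thd f t))%C in
  in_X gam nd thd beta err /\
  X_norm gam nd thd beta err <= K * (Rpower (mesh n) (alpha - beta) +
    Rpower (mesh n) r) * X_norm gam nd thd alpha f.
Proof.
  destruct (continuous_stability gam nd thd k lam mu beta Hgam Hjumps Hk ltac:(lra) Hker) as [A [HA HAs]].
  destruct quadrature_error as [KQ [HKQ HQ]].
  destruct (interpolation_estimates gam m Hgam Hm) as [K [HK HI]].
  destruct discrete_stability as [KS [h0 [HKS [Hh0 HS]]]].
  destruct (K_op_bounds gam k mu Hgam Hk ltac:(lra)) as [MK [HMK HKop]].
  destruct (C_part_holder gam nd thd Hgam Hjumps alpha ltac:(lra)) as [KC [HKC HCp]].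
  destruct (X_norm_le_holder gam nd thd Hgam Hjumps beta ltac:(lra)) as [KX [HKX HX]].
  assert (Hlam := Cmod_ge_0 lam). set (la := Cmod lam) in *.
  (* By the equation [w0] is [C_part] plus [lam * K phi]; [KC] bounds the first, and the second is
     mu-Hoelder with constant [MK * A], lowered to exponent [alpha] by [holder_exponent]. *)
  set (W := KC + la * (MK * A + 2 * (MK * A))).
  assert (HMA : 0 <= MK * A) by (apply Rmult_le_pos; auto).
  assert (HW : 0 <= W) by (unfold W; apply Rplus_le_le_0_compat; auto; apply Rmult_le_pos; lra).
  (* Uniform bound, per unit of [F], of [J + p]: the [nd] jumps are at most [2 * F] each, and [p]
     differs from [w0] by at most [K * W * F] because [ha <= 1]. *)
  set (B := 2 * INR nd + (1 + K) * W).
  assert (HKW : 0 <= K * W) by (apply Rmult_le_pos; auto).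
  assert (HB : 0 <= B) by (unfold B; generalize (pos_INR nd); lra).
  (* The source term below has size [G = (E1 * ha + E2 * hr) * F], from interpolation and quadrature
     respectively. *)
  set (E1 := la * (MK * (K * W))). set (E2 := la * (KQ * B)).
  assert (HE1 : 0 <= E1) by (unfold E1; apply Rmult_le_pos; auto; apply Rmult_le_pos; auto).
  assert (HE2 : 0 <= E2) by (unfold E2; apply Rmult_le_pos; auto; apply Rmult_le_pos; auto).
  assert (HSE1 : 0 <= KS * E1) by (apply Rmult_le_pos; auto).
  assert (HSE2 : 0 <= KS * E2) by (apply Rmult_le_pos; auto).
  set (Kerr := K * W + KS * E1 + KS * E2).
  exists (KX * Kerr), h0. split; [apply Rmult_le_pos; unfold Kerr; lra|]. split; auto.
  intros n f phi u Hn Hmesh Hf Hphi Heq Hdisc err.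
  assert (HuS := proj1 Hdisc).
  assert (Hnod := proj1 (solves_discrete_nodes n f u Hn HuS) Hdisc).
  set (F := X_norm gam nd thd alpha f). assert (HF : 0 <= F) by apply X_norm_pos.
  assert (Hh : 0 < mesh n) by (apply mesh_pos; lia).
  set (ha := Rpower (mesh n) alpha). set (hab := Rpower (mesh n) (alpha - beta)). set (hr := Rpower (mesh n) r).
  assert (Hha : 0 < ha) by apply Rpower_pos. assert (Hhab : 0 < hab) by apply Rpower_pos.
  assert (Hhr : 0 < hr) by apply Rpower_pos.
  assert (Hhle : ha <= hab) by (apply Rpower_le_exponent; lra).
  assert (Hha1 : ha <= 1) by (apply Rpower_le_1; lra).
  assert (Hpa : admissible gam phi) by (apply (admissible_in_X gam nd thd beta); auto; lra).
  assert (Hfb := X_norm_bounded gam nd thd Hgam Hjumps alpha f ltac:(lra) Hf). fold F in Hfb.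
  assert (Hphib : bounded_by (A * F) (fun y => phi (gam y))).
  (* The norm of [phi] in [X_beta] enters only as some finite bound; the size of [phi] is governed
     by [F]. *)
  { apply (HAs phi (X_norm gam nd thd beta phi)); auto.
    - apply X_norm_bounded; auto; lra.
    - intros y. rewrite (Heq (gam y)) by apply on_contour_param. apply Hfb. }
  destruct (HKop phi _ Hpa Hphib) as [Kphb Kphh].
  destruct (HCp f Hf) as [HCh HCb]. fold F in HCh, HCb.
  set (J := J_part gam nd thd f) in *. set (w0 := fun t => (phi t - J t)%C).
  assert (HJb := J_part_bounded gam nd thd Hgam Hjumps alpha f ltac:(lra) Hf). fold F J in HJb.
  assert (HJa : admissible gam J) by (apply admissible_J_part; auto).
  assert (Hw : forall y, w0 (gam y) = (C_part gam nd thd f (gam y) + lam * K_op gam k phi (gam y))%C).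
  { intros y. unfold w0, C_part. fold J. rewrite <- (Heq (gam y)) by apply on_contour_param. ring. }
  assert (Hwh : holder alpha (W * F) (fun y => w0 (gam y))).
  { apply holder_ext with (fun y => C_part gam nd thd f (gam y) + lam * K_op gam k phi (gam y))%C; [intros;
    rewrite Hw; auto|].
    replace (W * F) with (KC * F + la * (MK * (A * F) + 2 * (MK * (A * F)))) by (unfold W; ring).
    apply (holder_plus alpha _ _ (fun y => C_part gam nd thd f (gam y))
      (fun y => lam * K_op gam k phi (gam y))%C); auto.
    apply (holder_scal alpha _ lam (fun y => K_op gam k phi (gam y))). apply holder_exponent with mu; auto.
    lra. }
  assert (Hwb : bounded_by (W * F) (fun y => w0 (gam y))).
  { apply bounded_ext with (fun y => C_part gam nd thd f (gam y) + lam * K_op gam k phi (gam y))%C; [intros;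
    rewrite Hw; auto|].
    apply bounded_le with (KC * F + la * (MK * (A * F))).
    - unfold W. assert (0 <= la * (MK * A) * F) by (apply Rmult_le_pos; auto; apply Rmult_le_pos; auto). lra.
    - apply (bounded_plus _ _ (fun y => C_part gam nd thd f (gam y))
      (fun y => lam * K_op gam k phi (gam y))%C); auto.
      apply (bounded_scal _ lam (fun y => K_op gam k phi (gam y))). auto. }
  assert (Hwa : admissible gam w0) by (apply admissible_minus; auto).
  destruct (P_op_spec gam m Hgam Hm n (phase n) w0 Hn (Hphase n Hn)) as [HpS Hpi].
  set (p := P_op gam m n (phase n) w0) in *.
  assert (Hpadm := in_S_admissible gam m Hgam Hm n (phase n) p Hn (Hphase n Hn) HpS).
  destruct (HI n (phase n) w0 p alpha (W * F) Hn (Hphase n Hn) ltac:(lra) Hwh HpS Hpi) as [I1 I2].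
  fold ha in I1.
  specialize (I2 beta ltac:(lra)). fold hab in I2.
  assert (HWF : 0 <= W * F) by (apply Rmult_le_pos; auto).
  assert (HKWF : 0 <= K * (W * F)) by (apply Rmult_le_pos; auto).
  assert (HJpb : bounded_by (B * F) (fun y => J (gam y) + p (gam y))%C).
  { intros y. replace (J (gam y) + p (gam y))%C with (J (gam y) + ((p (gam y) - w0 (gam y)) +
    w0 (gam y)))%C by ring.
    eapply Rle_trans; [apply Cmod_triangle|]. eapply Rle_trans; [apply Rplus_le_compat_l, Cmod_triangle|].
    generalize (HJb y) (I1 y) (Hwb y). cbv beta.
    assert (K * (W * F) * ha <= K * (W * F) * 1) by (apply Rmult_le_compat_l; auto).
    unfold B. lra. }
  destruct (HQ n (fun t => J t + p t)%C (B * F) Hn) as [Q1 Q2]; auto.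
  { apply admissible_plus; auto. }
  { apply panelwise_exact_plus; [apply (exact_J_part m q xi w Hm Hq Hgauss gam nd thd n (phase n)); auto|].
    apply (exact_spline m q xi w Hm Hq Hgauss gam nd thd n (phase n)); auto. }
  fold hr in Q1, Q2.
  destruct (HKop (fun t => p t - w0 t)%C (K * (W * F) * ha)) as [D1 D2]; auto.
  { apply admissible_minus; auto. }
  (* The subtraction is written with the factor -1 so that the rules for sums and multiples of
     bounds apply. *)
  set (g := fun t => (lam * ((K_op gam k (fun t => J t + p t)%C t - Kq n (fun t => J t + p t)%C t) +
    RtoC (-1) * K_op gam k (fun t => p t - w0 t)%C t))%C).
  set (G := la * (KQ * (B * F) * hr + 1 * (MK * (K * (W * F) * ha)))).
  assert (Hm1 : Cmod (RtoC (-1)) = 1) by (rewrite Cmod_R, Rabs_left; lra).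
  assert (Hgb : bounded_by G (fun y => g (gam y))).
  { unfold G, g. apply (bounded_scal _ lam (fun y => (K_op gam k (fun t => J t +
    p t)%C (gam y) - Kq n (fun t => J t + p t)%C (gam y)) +
      RtoC (-1) * K_op gam k (fun t => p t - w0 t)%C (gam y))%C).
    apply bounded_plus; auto. rewrite <- Hm1.
    apply (bounded_scal _ (RtoC (-1)) (fun y => K_op gam k (fun t => p t - w0 t)%C (gam y))). auto. }
  assert (Hgh : holder mu G (fun y => g (gam y))).
  { unfold G, g. apply (holder_scal mu _ lam (fun y => (K_op gam k (fun t => J t +
    p t)%C (gam y) - Kq n (fun t => J t + p t)%C (gam y)) +
      RtoC (-1) * K_op gam k (fun t => p t - w0 t)%C (gam y))%C).
    apply holder_plus; auto. rewrite <- Hm1.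
    apply (holder_scal mu _ (RtoC (-1)) (fun y => K_op gam k (fun t => p t - w0 t)%C (gam y))). auto. }
  destruct (HS n (fun t => p t - RtoC 1 * u t)%C g G Hn Hmesh) as [S1 S2]; auto.
  { apply in_S_lin; auto. }
  { intros i Hi. rewrite (Hpi i Hi), (Hnod i Hi), Hw. rewrite Kq_lin. unfold g.
    rewrite Kq_plus. rewrite (K_op_plus gam k mu), (K_op_minus gam k mu) by auto.
    unfold w0. rewrite (K_op_minus gam k mu) by auto. fold J.
    rewrite RtoC_m1. ring. }
  (* The jumps of [phi] cancel: the error is minus the interpolation error of [w0] plus a spline,
     both globally Hoelder. *)
  assert (Herr : forall y, err (gam y) =
    (RtoC (-1) * (p (gam y) - w0 (gam y)) + (p (gam y) - RtoC 1 * u (gam y)))%C).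
  { intros y. unfold err, w0. fold J. rewrite RtoC_m1. ring. }
  assert (HGle : KS * G <= (KS * E1 * hab + KS * E2 * hr) * F).
  { assert (E : KS * G = KS * E1 * F * ha + KS * E2 * F * hr) by (unfold G, E1, E2; ring). rewrite E.
    assert (KS * E1 * F * ha <= KS * E1 * F * hab) by (apply Rmult_le_compat_l; auto; apply Rmult_le_pos;
      auto). lra. }
  set (T := Kerr * (hab + hr) * F).
  assert (HT : K * (W * F) * hab + KS * G <= T).
  { unfold T, Kerr.
    assert (0 <= K * W * F * hr) by (apply Rmult_le_pos; [apply Rmult_le_pos; auto|lra]).
    assert (0 <= KS * E1 * F * hr) by (apply Rmult_le_pos; [apply Rmult_le_pos; auto|lra]).
    assert (0 <= KS * E2 * F * hab) by (apply Rmult_le_pos; [apply Rmult_le_pos; auto|lra]). lra. }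
  destruct (HX err T) as [X1 X2].
  - apply holder_ext with (fun y => RtoC (-1) * (p (gam y) - w0 (gam y)) + (p (gam y) - RtoC 1 * u (gam y)))%C;
    [intros; rewrite Herr; auto|].
    eapply holder_le; [exact HT|]. apply holder_plus; auto.
    replace (K * (W * F) * hab) with (Cmod (RtoC (-1)) * (K * (W * F) * hab)) by (rewrite Hm1; ring).
    apply (holder_scal beta _ (RtoC (-1)) (fun y => p (gam y) - w0 (gam y))%C). auto.
  - apply bounded_ext with (fun y => RtoC (-1) * (p (gam y) - w0 (gam y)) +
    (p (gam y) - RtoC 1 * u (gam y)))%C; [intros; rewrite Herr; auto|].
    apply bounded_le with (1 * (K * (W * F) * ha) + KS * G).
    + assert (K * (W * F) * ha <= K * (W * F) * hab) by (apply Rmult_le_compat_l; auto). lra.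
    + apply bounded_plus; auto. rewrite <- Hm1.
      apply (bounded_scal _ (RtoC (-1)) (fun y => p (gam y) - w0 (gam y))%C). auto.
  - split; auto. eapply Rle_trans; [exact X2|]. unfold T. right. unfold hab, hr, F. ring.
Qed.

End Discrete.

Theorem theorem10p3
  (gam : R -> C) (nd : nat) (thd : nat -> R)
  (alpha beta mu : R) (k : C -> C -> C) (lam : C)
  (m : nat) (r Lr : R) (eta0 : R) (phase : nat -> R)
  (CPi : R) (N : nat -> nat) (x : nat -> nat -> R)
  (q : nat) (xi w : nat -> R)
  (Hgam : is_contour gam)
  (Hjumps : is_jump_set nd thd)
  (Hexp : 0 < beta /\ beta < alpha /\ alpha < mu /\ mu <= 1)
  (Hk : kernel_regular gam k mu)
  (Hker : forall v, in_X gam nd thd beta v ->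
     solves_eq gam k lam (fun _ => RtoC 0) v ->
     eq_on gam v (fun _ => RtoC 0))
  (Hm : m = 2%nat \/ m = 3%nat \/ m = 4%nat)
  (Hr : 0 < r <= 1) (HLr : 0 < Lr)
  (Ha : forall th eta, 0 <= th <= 2 * PI -> 0 <= eta <= 2 * PI ->
     let d := fun t => (a_ker gam k t th - a_ker gam k t eta)%C in
     in_H gam mu d /\
     H_norm gam mu d <= Lr * Rpower (Rabs (th - eta)) r)
  (Heta0 : 0 < eta0 < 1 / (2 * INR nd))
  (Hphase : forall n, (4 <= n)%nat ->
     admissible_phase nd thd eta0 n (phase n))
  (Hpanels : forall n, (4 <= n)%nat ->
     is_panel_partition nd thd m n (phase n) (N n) (x n))
  (Hfine : forall n, (4 <= n)%nat -> forall i, (i < N n)%nat ->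
     x n (S i) - x n i <= CPi * mesh n)
  (Hq : ((m + 1) / 2 <= q)%nat)
  (Hgauss : is_gauss_legendre q xi w) :
  let P := fun n => P_op gam m n (phase n) in
  let Kq := fun n => Kq_op gam k q xi w (N n) (x n) in
  let discrete := fun n f u =>
    solves_discrete gam nd thd lam m n (phase n) (P n) (Kq n) f u in
  exists Clam Clam' h0 : R, 0 < h0 /\
    forall n, (4 <= n)%nat -> mesh n < h0 ->
    forall f, in_X gam nd thd alpha f ->
      (exists u, discrete n f u /\
         forall u', discrete n f u' -> eq_on gam u' u) /\
      (forall phi u,
         in_X gam nd thd beta phi -> solves_eq gam k lam f phi ->
         discrete n f u ->
         let err := fun t => (phi t - (u t + J_part gam nd thd f t))%C in
         in_X gam nd thd beta err /\
         X_norm gam nd thd beta err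
           <= Clam * (Rpower (mesh n) (alpha - beta) + Rpower (mesh n) r)
              * X_norm gam nd thd alpha f /\
         (alpha - beta <= r ->
          X_norm gam nd thd beta err
            <= Clam' * Rpower (mesh n) (alpha - beta)
               * X_norm gam nd thd alpha f)).
Proof.
  intros P Kq discrete.
  assert (Hphase' : forall n, (4 <= n)%nat -> 0 <= phase n < mesh n) by (intros n Hn; apply (Hphase n Hn)).
  destruct (discrete_unique_solvability gam nd thd alpha beta mu k lam m r Lr phase CPi N x q xi w
    Hgam Hjumps Hexp Hk Hker Hm Hr HLr Ha Hphase' Hpanels Hfine Hq Hgauss) as [h1 [Hh1 H1]].
  destruct (discrete_error gam nd thd alpha beta mu k lam m r Lr phase CPi N x q xi w
    Hgam Hjumps Hexp Hk Hker Hm Hr HLr Ha Hphase' Hpanels Hfine Hq Hgauss) as [K [h2 [HK [Hh2 H2]]]].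
  exists K, (2 * K), (Rmin h1 h2). split; [apply Rmin_pos; lra|].
  intros n Hn Hmesh f Hf.
  assert (Hm1 : mesh n < h1) by (eapply Rlt_le_trans; [exact Hmesh|apply Rmin_l]).
  assert (Hm2 : mesh n < h2) by (eapply Rlt_le_trans; [exact Hmesh|apply Rmin_r]).
  split; [apply (H1 n f Hn Hm1)|].
  intros phi u Hphi Heq Hu err.
  destruct (H2 n f phi u Hn Hm2 Hf Hphi Heq Hu) as [E1 E2].
  split; [exact E1|]. split; [exact E2|].
  intros Hab. eapply Rle_trans; [exact E2|].
  apply Rmult_le_compat_r; [apply X_norm_pos|].
  assert (Hh : 0 < mesh n) by (apply mesh_pos; lia).
  (* The threshold [h2 <= 1] keeps the mesh below 1, so the larger exponent gives the smaller power;
     the two rates merge into the constant [2 * K]. *)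
  assert (F : Rpower (mesh n) r <= Rpower (mesh n) (alpha - beta)) by (apply Rpower_le_exponent; lra).
  generalize (Rmult_le_compat_l _ _ _ HK F). lra.
Qed.
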